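(* Let $d\in\mathbb{N}$, let $n \in \mathbb{N}$, and let $(X,Y),(X_1,Y_1),\dots,(X_n,Y_n)$ be independent and identically distributed $\mathbb{R}^d\times\mathbb{R}$-valued random variables such that $\mathrm{supp}(X)$ is bounded, such that $$\mathbf{E}\left\{e^{c_5\cdot Y^2}\right\}<\infty ,$$ and such that the regression function $m(x)=\mathbf{E}\{Y\mid X=x\}$ is bounded. Let $\sigma(x)=1/(1+e^{-x})$ be the logistic squasher, let $K_n,L,r,t_n\in\mathbb{N}$, $\lambda_n,\tau>0$, and let $m_n$ be the estimate defined in the context. Let $\tilde K_n\in\{1,\dots,K_n\}$ and let $w_{k,i,j}^{(l)}$ (for $k=1,\dots,\tilde K_n$; the output weights being $w_{1,1,k}^{(L)}$, $k=1,\dots,\tilde K_n$) be weights with $$w_{k,i,j}^{(l)}\in[-c_1(\log n)^2,\,c_1(\log n)^2]\ \text{ for the levels } l=1,\dots,L,\qquad w_{k,i,j}^{(0)}\in[-c_2(\log n)^2 n^\tau,\,c_2(\log n)^2n^\tau].$$ Assume $$\left|\sum_{k=1}^{\tilde K_n} w_{1,1,k}^{(L)}\cdot f_{\bar{\mathbf w},k,1}^{(L)}(x)\right|\le\beta_n\qquad (x\in \mathrm{supp}(X))$$ for all $\bar{\mathbf w}$ satisfying $|\bar w_{k,i,j}^{(l)}-w_{k,i,j}^{(l)}|\le\log n$ for all $k\in\{1,\dots,\tilde K_n\}$, all $i,j$ and all $l\in\{0,\dots,L-1\}$. Assume furthermore $$\frac{K_n}{n^\kappa}\to0\quad(n\to\infty)\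 \text{ for some }\kappa>0,\qquad \frac{K_n}{\tilde K_n\cdot n^{r(d+1)\tau+1}}\to\infty\quad(n\to\infty),$$ and that $t_n,\lambda_n$ are given by $$t_n=\lceil c_6\cdot L_n\cdot\log n\rceil,\qquad \lambda_n=\frac1{L_n}$$ for some $L_n>0$ which satisfies $L_n\ge(\log n)^{10L+10}\cdot K_n^{3/2}$. Assume $$2c_3c_6\ge1,\qquad c_4c_5\ge1,\qquad 4c_4c_6\le1 .$$ Then for any $\epsilon>0$ there is a constant $c_7>0$, not depending on $n$, such that $$\mathbf{E}\int|m_n(x)-m(x)|^2\,\mathbf{P}_X(dx)\le c_7\cdot\Bigg(\frac{n^{\tau d+\epsilon}}{n}+\sum_{k=1}^{\tilde K_n}|w_{1,1,k}^{(L)}|^2+\sup_{\bar{\mathbf w}}\int\Big|\sum_{k=1}^{\tilde K_n}w_{1,1,k}^{(L)}\cdot f_{\bar{\mathbf w},k,1}^{(L)}(x)-m(x)\Big|^2\mathbf{P}_X(dx)\Bigg),$$ where the supremum is over all $\bar{\mathbf w}=(\bar w_{k,i,j}^{(l)})$ with $|\bar w_{k,i,j}^{(l)}-w_{k,i,j}^{(l)}|\le\log n$ for all $k\in\{1,\dots,\tilde K_n\}$, all $i,j$ and all $l\in\{0,\dots,L-1\}$.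
   Context: The numbers $d,L,r,\tau$ and $c_1,\dots,c_6>0$ are fixed (independent of $n$), as is the distribution of $(X,Y)$; $K_n,\tilde K_n,t_n,\lambda_n,L_n$ and the weights $w_{k,i,j}^{(l)}$ may depend on $n$. $\mathbf{P}_X$ is the distribution of $X$. Networks. With $\sigma(x)=1/(1+e^{-x})$, a weight vector $\mathbf w=(w_{k,i,j}^{(l)})_{k,i,j,l}$ defines $f_{\mathbf w}:\mathbb{R}^d\to\mathbb{R}$, $$f_{\mathbf w}(x)=\sum_{k=1}^{K_n}w_{1,1,k}^{(L)}\cdot f_{k,1}^{(L)}(x),$$ where $f_{k,i}^{(l)}=f_{\mathbf w,k,i}^{(l)}$ are defined recursively by $$f_{k,i}^{(l)}(x)=\sigma\Big(\sum_{j=1}^{r}w_{k,i,j}^{(l-1)}f_{k,j}^{(l-1)}(x)+w_{k,i,0}^{(l-1)}\Big)\quad(l=2,\dots,L),\qquad f_{k,i}^{(1)}(x)=\sigma\Big(\sum_{j=1}^{d}w_{k,i,j}^{(0)}x^{(j)}+w_{k,i,0}^{(0)}\Big).$$ So $f_{\mathbf w}$ is a linear combination, with output weights $w_{1,1,k}^{(L)}$, of $K_n$ fully connected networks of depth $L$ and width $r$ computed in parallel; the weights $w_{k,i,j}^{(l)}$ with $l\le L-1$ are the inner weights of the $k$-th one, and $f_{\mathbf w,k,1}^{(L)}$ depends only on these. Estimate. Initial weights $\mathbf w^{(0)}$: all output weights $(\mathbf w^{(0)})_{1,1,k}^{(L)}$ ($k=1,\dots,K_n$) are $0$; $(\mathbf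 w^{(0)})_{k,i,j}^{(l)}$ is uniformly distributed on $[-c_1(\log n)^2,c_1(\log n)^2]$ for $l\in\{1,\dots,L-1\}$; $(\mathbf w^{(0)})_{k,i,j}^{(0)}$ is uniformly distributed on $[-c_2(\log n)^2n^\tau,c_2(\log n)^2n^\tau]$; all components are independent. Let $$F_n(\mathbf w)=\frac1n\sum_{i=1}^n|Y_i-f_{\mathbf w}(X_i)|^2+c_3\sum_{k=1}^{K_n}|w_{1,1,k}^{(L)}|^2,\qquad \mathbf w^{(t)}=\mathbf w^{(t-1)}-\lambda_n\nabla_{\mathbf w}F_n(\mathbf w^{(t-1)})\quad(t=1,\dots,t_n).$$ The estimate is $m_n(x)=T_{\beta_n}(f_{\mathbf w^{(t_n)}}(x))$ with $\beta_n=c_4\log n$ and $T_\beta z=\max\{-\beta,\min\{\beta,z\}\}$ for $z\in\mathbb{R}$, $\beta>0$. The expectation in the claim is over the data and the random initialization. *)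

(* Defs.v *)
From mathcomp Require Import all_boot all_order all_algebra.
From mathcomp Require Import all_classical all_reals all_analysis.

Set Implicit Arguments.
Unset Strict Implicit.
Unset Printing Implicit Defensive.

Import Order.TTheory GRing.Theory Num.Theory.
Import numFieldNormedType.Exports.

Local Open Scope classical_set_scope.
Local Open Scope ring_scope.

Definition logistic (R : realType) (x : R) : R := (1 + expR (- x))^-1.

Definition truncate (R : realType) (b z : R) : R := Num.max (- b) (Num.min b z).

(* Inner weights of one fully connected network with d inputs, depth L and
   width r: [inl (i, j)] is w_{i,j}^{(0)} and [inr (l, i, j)] is
   w_{i,j}^{(l+1)}.  Nodes i are counted from 0.  The index j = 0 is the bias,
   and [lift ord0 j] belongs to the j-th input, inputs being counted from 0. *)
Definition inner_index (d L r : nat) : Type :=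
  ('I_r * 'I_d.+1 + 'I_L.-1 * 'I_r * 'I_r.+1)%type.

(* [inl k] is the output weight w_{1,1,k}^{(L)} and [inr (k, a)] is the inner
   weight a of the k-th network. *)
Definition weight_index (d L r K : nat) : Type :=
  ('I_K + 'I_K * inner_index d L r)%type.

Section Network.
Context (R : realType) (d L r : nat).
Implicit Types (x : d.-tuple R) (v : inner_index d L r -> R).

(* w_{i,j}^{(l)} for 1 <= l <= L-1 *)
Definition hidden_weight v (l : nat) (i : 'I_r) (j : 'I_r.+1) : R :=
  if insub l.-1 is Some l' then v (inr (l', i, j)) else 0.

(* [layer v x l i] is f_i^{(l+1)}(x). *)
Fixpoint layer v x (l : nat) (i : 'I_r) : R :=
  if l is l'.+1 then
    logistic (\sum_(j < r) hidden_weight v l i (lift ord0 j) * layer v x l' j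
              + hidden_weight v l i ord0)
  else
    logistic (\sum_(j < d) v (inl (i, lift ord0 j)) * tnth x j
              + v (inl (i, ord0))).

(* f_1^{(L)}; the width is positive, so that there is a first node. *)
Definition subnetwork (r_gt0 : (0 < r)%N) v x : R :=
  layer v x L.-1 (Ordinal r_gt0).

Definition combination (r_gt0 : (0 < r)%N) (K : nat) (a : 'I_K -> R)
    (v : 'I_K -> inner_index d L r -> R) x : R :=
  \sum_(k < K) a k * subnetwork r_gt0 (v k) x.

Definition network (r_gt0 : (0 < r)%N) (K : nat)
    (w : weight_index d L r K -> R) x : R :=
  combination r_gt0 (fun k => w (inl k)) (fun k a => w (inr (k, a))) x.

Definition empirical_risk (r_gt0 : (0 < r)%N) (c3 : R) (n K : nat)
    (x : 'I_n -> d.-tuple R) (y : 'I_n -> R)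
    (w : weight_index d L r K -> R) : R :=
  n%:R^-1 * (\sum_(i < n) `|y i - network r_gt0 w (x i)| ^+ 2)
  + c3 * \sum_(k < K) `|w (inl k)| ^+ 2.

Definition initial_weights (K : nat) (v : 'I_K -> inner_index d L r -> R) :
    weight_index d L r K -> R :=
  fun a => match a with inl _ => 0 | inr (k, b) => v k b end.

(* Half-length of the symmetric interval allowed for an inner weight. *)
Definition inner_radius (c1 c2 tau : R) (n : nat) (a : inner_index d L r) : R :=
  match a with
  | inl _ => c2 * ln n%:R ^+ 2 * n%:R `^ tau
  | inr _ => c1 * ln n%:R ^+ 2
  end.

End Network.

Definition partial_derivative (R : realType) (I : eqType)
    (F : (I -> R) -> R) (w : I -> R) (a : I) : R :=
  derive1 (fun z : R => F (@dfwith I (fun=> R) w a z)) (w a).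

Definition gradient_descent (R : realType) (I : eqType)
    (F : (I -> R) -> R) (lambda : R) (w0 : I -> R) (t : nat) : I -> R :=
  iter t (fun w a => w a - lambda * partial_derivative F w a) w0.

Definition estimate (R : realType) (d L r : nat) (r_gt0 : (0 < r)%N)
    (c3 c4 lambda : R) (t n K : nat)
    (x : 'I_n -> d.-tuple R) (y : 'I_n -> R)
    (v : 'I_K -> inner_index d L r -> R) (z : d.-tuple R) : R :=
  truncate (c4 * ln n%:R)
    (network r_gt0
      (gradient_descent (empirical_risk r_gt0 c3 x y) lambda
        (initial_weights v) t) z).

Section Probability.
Local Open Scope ereal_scope.
Context (disp : measure_display) (T : measurableType disp) (R : realType).
Variable P : probability T R.

(* Topological support of a measure on R^d; the sup-norm balls define the usual
   topology. *)
Definition law_support (d : nat) (mu : set (d.-tuple R) -> \bar R) :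
    set (d.-tuple R) :=
  [set x | forall e : R, (0 < e)%R ->
    0 < mu [set y | forall i, (`|tnth y i - tnth x i| < e)%R]].

Definition bounded_in_Rd (d : nat) (A : set (d.-tuple R)) : Prop :=
  exists M : R, forall x, A x -> forall i, (`|tnth x i| <= M)%R.

(* m is a version of x |-> E(Y | X = x). *)
Definition regression_function (d : nat) (X : {RV P >-> d.-tuple R})
    (Y : {RV P >-> R}) (m : d.-tuple R -> R) : Prop :=
  [/\ measurable_fun setT m,
      (distribution P X).-integrable setT (EFin \o m) &
      forall A, measurable A ->
        \int[P]_(w in X @^-1` A) (Y w)%:E
        = \int[distribution P X]_(x in A) (m x)%:E].

(* The event systems F i, for i in I, are mutually independent. *)
Definition mutually_independent (I : choiceType) (F : I -> set (set T)) : Prop :=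
  forall (s : seq I) (E : I -> set T), uniq s -> (forall i, F i (E i)) ->
    P (\bigcap_(i in [set` s]) E i) = \prod_(i <- s) P (E i).

Definition generated_events (d' : measure_display) (S : measurableType d')
    (Z : T -> S) : set (set T) :=
  preimage_set_system setT Z measurable.

Definition same_law (d' : measure_display) (S : measurableType d')
    (Z Z' : T -> S) : Prop :=
  forall A, measurable A -> P (Z @^-1` A) = P (Z' @^-1` A).

(* For a = b this is the point mass at a, a case which [uniform_prob] leaves
   out and which occurs for [inner_radius] at n = 1, where log n = 0. *)
Definition uniformly_distributed (Z : {RV P >-> R}) (a b : R) : Prop :=
  P (Z @^-1` `[a, b]) = 1 /\
  forall ab : (a < b)%R, forall A, measurable A ->
    distribution P Z A = uniform_prob ab A.

(* The data (X, Y), (X_1, Y_1), ..., (X_n, Y_n) and all random initial weights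
   form an independent family; [inl None] stands for (X, Y). *)
Definition sample_events (d L r n K : nat)
    (X : {RV P >-> d.-tuple R}) (Y : {RV P >-> R})
    (Xs : 'I_n -> {RV P >-> d.-tuple R}) (Ys : 'I_n -> {RV P >-> R})
    (V : 'I_K -> inner_index d L r -> {RV P >-> R})
    (i : option 'I_n + 'I_K * inner_index d L r) : set (set T) :=
  match i with
  | inl None => generated_events (fun w => (X w, Y w))
  | inl (Some i) => generated_events (fun w => (Xs i w, Ys i w))
  | inr (k, a) => generated_events (V k a)
  end.

End Probability.

(* Main.v *)
Require Import Defs.
From mathcomp Require Import all_boot all_order all_algebra finmap.
From mathcomp Require Import all_classical all_reals all_analysis measurable_realfun.
From mathcomp Require Import ring lra.

(** The proof compares four quantities: the risk of the estimate, its empirical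
    risk, the empirical risk of a target network, and the risk of that network.

    Training.  As long as the inner weights stay in a ball of logarithmic radius,
    the regularized empirical risk is smooth with a constant of order [K] times
    powers of [log n] ([layer_expansion], [risk_expansion]).  The step size is
    below the inverse of this constant, so each step lowers the risk by a multiple
    of the squared gradient.  The initial risk is the mean of the squared
    responses, with high probability at most [c4 log n]; hence the weights travel
    at most [4/5 log n] and never leave the ball ([gradient_descent_stays]).  In
    the output weights alone the risk is convex, and telescoping squared distances
    bounds the final risk by the risk of the target output weights, placed on
    selected subnetworks with their current inner weights, plus the penalty
    ([gradient_descent_outer], [training_oracle]).

    Initialization.  The random subnetworks are divided into one block for each
    target subnetwork.  The blocks are so large that, up to probability [1 / n],
    each contains a subnetwork whose initial inner weights are within [log n / 5]
    of its target ([initial_selection], [initialization_failure]).  Together with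
    the drift the selected weights remain within [log n] of the targets, which is
    the neighbourhood over which the theorem takes its supremum.

    Complexity.  Only the input weights are large, of order [n ^ tau] up to
    logarithms.  On a cube whose side is slightly smaller than [n ^ (- tau)],
    repeated Taylor expansion of the logistic function approximates every
    subnetwork by a linear combination of the same finitely many features, whose
    number does not depend on [n] ([layer_features]).  A combination of [K]
    subnetworks is then described by the rounded coefficients on about
    [n ^ (tau d)] cubes, whatever [K] is, and the logarithm of the number of
    descriptions is at most [n ^ (tau d + eps)] ([network_code],
    [code_parameters]).

    Deviations.  For the squared loss, the second moment of the difference between
    the losses of a bounded function and of the regression function is controlled
    by its mean.  Suitably tilted exponential moments are therefore at most one
    ([loss_gap_mgf]), independence multiplies them, and a union bound over the
    descriptions compares risk and empirical risk up to constant factors and an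
    error of order [n ^ (tau d + eps) / n] ([uniform_deviation],
    [class_deviation]).

    The exceptional events have probability of order [1 / n], because the response
    has an exponential moment and [c4 c5 >= 1], and the truncated estimate costs
    only [(log n) ^ 2] on them ([oracle_inequality]).  It remains to check that all
    numerical conditions hold for large [n]; for small [n] the trivial bound of the
    risk is absorbed in the constant. *)

Set Implicit Arguments.
Unset Strict Implicit.
Unset Printing Implicit Defensive.

Import Order.TTheory GRing.Theory Num.Theory.
Import numFieldNormedType.Exports.

Local Open Scope classical_set_scope.
Local Open Scope ring_scope.

(** * Taylor expansion of the logistic function *)

Section Calculus.
Context {R : realType}.
Implicit Types (x z h : R).

Lemma mean_value_at0 (f df : R -> R) h :
  (forall x, is_derive x 1 f (df x)) ->
  exists2 c, `|c| <= `|h| & f h - f 0 = df c * h.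
Proof.
move=> fdf.
have cf : continuous f.
  by move=> x; apply/differentiable_continuous/derivable1_diffP; case: (fdf x).
case: (leP 0 h) => h0.
  have [|c /itvP ci ->] := @MVT_segment _ f df _ _ h0 (fun x _ => fdf x).
    exact: continuous_subspaceT.
  by exists c; rewrite ?subr0// !ger0_norm ?ci.
have [|c /itvP ci E] := @MVT_segment _ f df _ _ (ltW h0) (fun x _ => fdf x).
  exact: continuous_subspaceT.
exists c; first by rewrite !ler0_norm ?lerN2 ?ci// ltW.
by rewrite -opprB E sub0r mulrN opprK.
Qed.

(** Induction on the order: by the mean value theorem in [h], the remainder of
    [g 0] is [h] times the remainder of order [k - 1] of its derivative [g 1]. *)
Lemma taylor_remainder_le (g : nat -> R -> R) (C : R) (k : nat) z h :
  (forall i x, is_derive x 1 (g i) (g i.+1 x)) ->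
  (forall x, `|g k x| <= C) ->
  `|g 0%N (z + h) - \sum_(j < k) g j z / j`!%:R * h ^+ j| <= C * `|h| ^+ k.
Proof.
elim: k g h => [|k IH] g h gd gC.
  by rewrite big_ord0 subr0 expr0 mulr1.
pose p := \poly_(j < k.+1) (g j z / j`!%:R).
pose dp y := \sum_(j < k) g j.+1 z / j`!%:R * y ^+ j.
have pE y : \sum_(j < k.+1) g j z / j`!%:R * y ^+ j = p.[y].
  by rewrite horner_poly.
have dpE y : dp y = p^`().[y].
  have -> : p^`() = \poly_(j < k) (g j.+1 z / j`!%:R).
    apply/polyP => j; rewrite coef_deriv !coef_poly ltnS.
    case: ifP => // _; last by rewrite mul0rn.
    rewrite factS natrM -mulr_natr; field.
    by rewrite addrC natr1 !pnatr_eq0 -lt0n fact_gt0.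
  by rewrite horner_poly.
have Gd (y : R) : is_derive y 1 (fun y : R => g 0%N (z + y) - p.[y])
    (g 1%N (z + y) - dp y).
  apply: is_deriveB; last by rewrite dpE; exact: is_derive_poly.
  have H := gd 0%N (z + y).
  have := @is_derive1_comp R (g 0%N) (fun t => z + t) y _ 1 H.
  rewrite mulr1; apply.
  have -> : [eta +%R z] = shift z by apply/funext => t; rewrite /= addrC.
  exact: is_derive_shift.
have [c ch E] := mean_value_at0 h Gd.
have G0 : g 0%N (z + 0) - p.[0] = 0.
  by rewrite horner_coef0 coef_poly /= fact0 invr1 mulr1 addr0 subrr.
rewrite pE; move: E; rewrite G0 subr0 => ->.
rewrite normrM exprSr mulrA ler_wpM2r//.
rewrite (le_trans (IH (fun i => g i.+1) c _ _))//.
by rewrite ler_wpM2l ?lerXn2r ?nnegrE// (le_trans _ (gC 0)).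
Qed.
End Calculus.
Section Logistic.
Context {R : realType}.
Implicit Types (x z h : R).

Lemma logistic_itv x : 0 < logistic x < 1.
Proof.
have e0 := expR_gt0 (- x).
rewrite /logistic invr_gt0 invf_lt1 ?ltrDl ?e0 ?addr_gt0//.
Qed.

Lemma logistic_norm_le1 x : `|logistic x| <= 1.
Proof. by case/andP: (logistic_itv x) => l0 l1; rewrite ger0_norm ltW. Qed.

Lemma is_derive_logistic x :
  is_derive x 1 (@logistic R) (logistic x - logistic x ^+ 2).
Proof.
have e0 := expR_gt0 (- x).
have n0 : 1 + expR (- x) != 0 by rewrite gt_eqF// addr_gt0.
rewrite /logistic; apply: is_derive_eq.
rewrite /GRing.scale/=; field.
done.
Qed.

(** [logistic_diff j], evaluated at the logistic function, is its [j]-th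
    derivative: the logistic function satisfies s' = s - s^2. *)
Fixpoint logistic_diff (j : nat) : {poly R} :=
  if j is j'.+1 then (logistic_diff j')^`() * ('X - 'X^2) else 'X.

Lemma is_derive_logistic_diff j x :
  is_derive x 1 (fun x => (logistic_diff j).[logistic x])
    (logistic_diff j.+1).[logistic x].
Proof.
have H := is_derive_logistic x.
have := @is_derive1_comp R (horner (logistic_diff j)) (@logistic R) x _ _
  (is_derive_poly _ _) H.
by rewrite /= !hornerE.
Qed.

Lemma logistic_diff_bounded j :
  exists2 C : R, 0 < C & forall x, `|(logistic_diff j).[logistic x]| <= C.
Proof.
exists (1 + \sum_(i < size (logistic_diff j)) `|(logistic_diff j)`_i|).
  by rewrite ltr_pwDl// sumr_ge0.
move=> x; rewrite horner_coef.
apply: (le_trans (ler_norm_sum _ _ _)).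
rewrite -[leLHS]add0r lerD// ler_sum// => i _.
by rewrite normrM ler_piMr// normrX exprn_ile1// logistic_norm_le1.
Qed.

(** The derivatives of the logistic function are polynomials in its values, which
    lie between zero and one; so the remainder bound holds on the whole line. *)
Lemma logistic_taylor k : exists2 C : R, 0 < C & forall z h,
  `|logistic (z + h) - \sum_(j < k) (logistic_diff j).[logistic z] / j`!%:R * h ^+ j|
    <= C * `|h| ^+ k.
Proof.
have [C C0 HC] := logistic_diff_bounded k; exists C => // z h.
have := @taylor_remainder_le R (fun j x => (logistic_diff j).[logistic x]) C k z h
  (@is_derive_logistic_diff) HC.
by rewrite hornerX.
Qed.

Definition logistic_slope z : R := logistic z - logistic z ^+ 2.

Lemma logistic_slope_itv z : 0 <= logistic_slope z <= 1.
Proof.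
case/andP: (logistic_itv z) => l0 l1; rewrite /logistic_slope; apply/andP; split; nra.
Qed.

Lemma logistic_lipschitz z h : `|logistic (z + h) - logistic z| <= `|h|.
Proof.
have := @taylor_remainder_le R (fun j x => (logistic_diff j).[logistic x]) 1 1 z h
  (@is_derive_logistic_diff).
rewrite big_ord1/= fact0 divr1 expr0 mulr1 !hornerX expr1 mul1r; apply => x.
rewrite derivX !hornerE; have /andP[? ?] := logistic_slope_itv x.
by rewrite ger0_norm.
Qed.

Lemma logistic_first_order z h :
  `|logistic (z + h) - logistic z - logistic_slope z * h| <= h ^+ 2.
Proof.
have := @taylor_remainder_le R (fun j x => (logistic_diff j).[logistic x]) 1 2 z h
  (@is_derive_logistic_diff).
rewrite big_ord_recl big_ord1/= fact0 divr1 expr0 mulr1 !hornerX derivX.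
rewrite /bump/= divr1 expr1 mul1r !hornerE opprD addrA real_normK ?num_real//.
apply => x; rewrite derivB derivX derivXn !hornerE/=.
case/andP: (logistic_itv x) => l0 l1.
by rewrite ler_norml; apply/andP; split; nra.
Qed.
End Logistic.

(** * First-order expansion of a network in its inner weights *)

Section LinearForm.
Context {R : realType} {I : finType}.
Implicit Types (l : (I -> R) -> R).

(** Linearity is stated through coefficients, because the coefficients are what
    becomes the gradient. *)
Definition linear_form l := exists G : I -> R, forall u, l u = \sum_b G b * u b.

Lemma linear_form_eval b : linear_form (fun u => u b).
Proof.
exists (fun b' => (b' == b)%:R) => u.
rewrite (bigD1 b)//= eqxx mul1r big1 ?addr0// => b' /negbTE ->.
by rewrite mul0r.
Qed.

Lemma linear_form0 : linear_form (fun=> 0).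
Proof. by exists (fun=> 0) => u; rewrite big1// => b _; rewrite mul0r. Qed.

Lemma linear_formD l1 l2 : linear_form l1 -> linear_form l2 ->
  linear_form (fun u => l1 u + l2 u).
Proof.
move=> [G1 H1] [G2 H2]; exists (fun b => G1 b + G2 b) => u.
by rewrite H1 H2 -big_split; apply: eq_bigr => b _; rewrite mulrDl.
Qed.

Lemma linear_formZ c l : linear_form l -> linear_form (fun u => c * l u).
Proof.
move=> [G H]; exists (fun b => c * G b) => u.
by rewrite H mulr_sumr; apply: eq_bigr => b _; rewrite mulrA.
Qed.

Lemma linear_form_sum (J : finType) (l : J -> (I -> R) -> R) :
  (forall j, linear_form (l j)) -> linear_form (fun u => \sum_j l j u).
Proof.
move=> /choice[G H]; exists (fun b => \sum_j G j b) => u.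
under eq_bigr do rewrite H.
by rewrite exchange_big; apply: eq_bigr => b _; rewrite mulr_suml.
Qed.
End LinearForm.

Section LayerExpansion.
Context {R : realType} {d L r : nat}.
Implicit Types (x : d.-tuple R) (v u : inner_index d L r -> R).

Lemma hidden_weightD v u l i j :
  hidden_weight (fun b => v b + u b) l i j = hidden_weight v l i j + hidden_weight u l i j.
Proof. by rewrite /hidden_weight; case: insub => // *; rewrite addr0. Qed.

Lemma hidden_weight_le v B l i j : 0 <= B -> (forall b, `|v (inr b)| <= B) ->
  `|hidden_weight v l i j| <= B.
Proof. by rewrite /hidden_weight => B0 vB; case: insub => //; rewrite normr0. Qed.

Lemma linear_form_hidden l i j :
  linear_form (fun u : inner_index d L r -> R => hidden_weight u l i j).
Proof.
rewrite /hidden_weight; case: insub => [k|]; last exact: linear_form0.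
exact: (linear_form_eval (inr (k, i, j))).
Qed.

Lemma layer_norm_le1 v x l i : `|layer v x l i| <= 1.
Proof. by case: l => [|l] /=; exact: logistic_norm_le1. Qed.

(** Chain rule with a quadratic remainder, for one application of the
    logistic function. *)
Lemma logistic_expansion (z dz lz A Q e : R) : 0 <= e ->
  `|dz| <= A * e -> `|dz - lz| <= Q * e ^+ 2 ->
  `|logistic (z + dz) - logistic z - logistic_slope z * lz|
    <= (A ^+ 2 + Q) * e ^+ 2.
Proof.
move=> e0 dzA dzQ.
have -> : logistic (z + dz) - logistic z - logistic_slope z * lz =
  (logistic (z + dz) - logistic z - logistic_slope z * dz) +
  logistic_slope z * (dz - lz) by ring.
apply: (le_trans (ler_normD _ _)); rewrite [leRHS]mulrDl; apply: lerD.
  apply: (le_trans (logistic_first_order _ _)).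
  by rewrite -exprMn -(real_normK (num_real dz)) lerXn2r ?nnegrE// (le_trans _ dzA).
case/andP: (logistic_slope_itv z) => s0 s1.
by rewrite normrM (ger0_norm s0) (le_trans _ dzQ)// ler_piMl.
Qed.

(** The constants depend on the depth only through powers of the bound [B] on
    the weights of the hidden levels; the weights of the first level need no
    bound, because the network depends on them through a bounded activation. *)
Lemma layer_expansion (M : R) (l : nat) : 0 <= M ->
  exists A Q : R, [/\ 0 <= A, 0 <= Q & forall (B : R) v x i, 1 <= B ->
    (forall b, `|v (inr b)| <= B) -> (forall j, `|tnth x j| <= M) ->
    exists2 g, linear_form g & forall (e : R) u, 0 <= e -> (forall b, `|u b| <= e) ->
      let D := layer (fun b => v b + u b) x l i - layer v x l i in
      `|D| <= A * B ^+ l * e /\ `|D - g u| <= Q * B ^+ (2 * l) * e ^+ 2].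
Proof.
move=> M0; elim: l => [|l [A [Q [A0 Q0 IH]]]].
  exists (d%:R * M + 1), ((d%:R * M + 1) ^+ 2 + 0); split.
  - by rewrite addr_ge0// mulr_ge0.
  - by rewrite addr0 sqr_ge0.
  move=> B v x i B1 vB xM.
  pose lz u := \sum_(j < d) tnth x j * u (inl (i, lift ord0 j)) + u (inl (i, ord0)).
  set z := \sum_(j < d) v (inl (i, lift ord0 j)) * tnth x j + v (inl (i, ord0)).
  exists (fun u => logistic_slope z * lz u).
    apply/linear_formZ/linear_formD; last exact: linear_form_eval.
    by apply: linear_form_sum => j; apply/linear_formZ/linear_form_eval.
  move=> e u e0 ue /=; rewrite -/z.
  have -> : \sum_(j < d) (v (inl (i, lift ord0 j)) + u (inl (i, lift ord0 j))) * tnth x j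
    + (v (inl (i, ord0)) + u (inl (i, ord0))) = z + lz u.
    rewrite /z /lz addrACA -big_split/=; congr (_ + _).
    by apply: eq_bigr => j _; ring.
  have lzA : `|lz u| <= (d%:R * M + 1) * e.
    apply: (le_trans (ler_normD _ _)); rewrite mulrDl mul1r lerD//.
    apply: (le_trans (ler_norm_sum _ _ _)).
    have -> : d%:R * M * e = \sum_(j < d) M * e.
      by rewrite sumr_const card_ord -mulr_natl; ring.
    by apply: ler_sum => j _; rewrite normrM ler_pM.
  split; first by rewrite expr0 mulr1 (le_trans (logistic_lipschitz _ _)).
  rewrite muln0 expr0 mulr1; apply: logistic_expansion => //.
  by rewrite subrr normr0 mul0r.
pose A' := r%:R * A + r%:R + 1.
pose Q' := r%:R * (Q + A).
have A'0 : 0 <= A' by rewrite /A' !addr_ge0// mulr_ge0.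
have Q'0 : 0 <= Q' by rewrite /Q' mulr_ge0// addr_ge0.
exists A', (A' ^+ 2 + Q'); split => //; first by rewrite addr_ge0// sqr_ge0.
move=> B v x i B1 vB xM.
have /choice[g /all_and2[glin gP]] : forall j, exists g, linear_form g /\
    forall (e : R) u, 0 <= e -> (forall b, `|u b| <= e) ->
      let D := layer (fun b => v b + u b) x l j - layer v x l j in
      `|D| <= A * B ^+ l * e /\ `|D - g u| <= Q * B ^+ (2 * l) * e ^+ 2.
  by move=> j; have [g ? ?] := IH B v x j B1 vB xM; exists g.
pose w v j := hidden_weight v l.+1 i j.
pose f j := layer v x l j.
set z := \sum_(j < r) w v (lift ord0 j) * f j + w v ord0.
pose lz u := \sum_(j < r) (w v (lift ord0 j) * g j u + f j * w u (lift ord0 j)) + w u ord0.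
have B0 : 0 <= B by rewrite (le_trans _ B1).
exists (fun u => logistic_slope z * lz u).
  apply/linear_formZ/linear_formD; last exact: linear_form_hidden.
  apply: linear_form_sum => j; apply: linear_formD; apply: linear_formZ => //.
  exact: linear_form_hidden.
move=> e u e0 ue.
pose f' j := layer (fun b => v b + u b) x l j.
pose dz := \sum_(j < r) (w v (lift ord0 j) * (f' j - f j) + w u (lift ord0 j) * f' j) + w u ord0.
have dzE : \sum_(j < r) w (fun b => v b + u b) (lift ord0 j) * f' j +
    w (fun b => v b + u b) ord0 = z + dz.
  rewrite /z /dz addrACA -big_split/=; congr (_ + _); last exact: hidden_weightD.
  by apply: eq_bigr => j _; rewrite /w hidden_weightD; ring.
move=> D; have {D}-> : D = logistic (z + dz) - logistic z by rewrite -dzE.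
have wv j : `|w v j| <= B by exact: hidden_weight_le.
have wu j : `|w u j| <= e by apply: hidden_weight_le.
have dzA : `|dz| <= A' * B ^+ l.+1 * e.
  apply: (le_trans (ler_normD _ _)).
  have -> : A' * B ^+ l.+1 * e = r%:R * ((A + 1) * B ^+ l.+1 * e) + B ^+ l.+1 * e.
    by rewrite /A'; ring.
  have Bl1 : 1 <= B ^+ l.+1 by rewrite exprn_ege1.
  apply: lerD; last by rewrite (le_trans (wu _))// ler_peMl.
  apply: (le_trans (ler_norm_sum _ _ _)).
  rewrite mulr_natl -[X in _ *+ X]card_ord -sumr_const; apply: ler_sum => j _.
  apply: (le_trans (ler_normD _ _)); rewrite mulrDl mulrDl; apply: lerD.
    rewrite normrM exprS.
    have [+ _] := gP j e u e0 ue => H.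
    rewrite [leRHS](_ : _ = B * (A * B ^+ l * e)); last by ring.
    exact: ler_pM.
  rewrite mul1r normrM; apply: (@le_trans _ _ (e * 1)).
    by rewrite ler_pM// layer_norm_le1.
  by rewrite mulr1 ler_peMl.
split; first exact: le_trans (logistic_lipschitz _ _) _.
have -> : (A' ^+ 2 + Q') * B ^+ (2 * l.+1) * e ^+ 2 =
  ((A' * B ^+ l.+1) ^+ 2 + Q' * B ^+ (2 * l.+1)) * e ^+ 2.
  by rewrite exprMn -exprM [(l.+1 * 2)%N]mulnC; ring.
apply: logistic_expansion => //.
have -> : dz - lz u = \sum_(j < r) (w v (lift ord0 j) * ((f' j - f j) - g j u) +
    w u (lift ord0 j) * (f' j - f j)).
  rewrite /dz /lz opprD addrACA subrr addr0 -sumrB; apply: eq_bigr => j _; ring.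
apply: (le_trans (ler_norm_sum _ _ _)).
rewrite /Q' -!mulrA mulr_natl -[X in _ *+ X]card_ord -sumr_const; apply: ler_sum => j _.
have [H1 H2] := gP j e u e0 ue.
apply: (le_trans (ler_normD _ _)); rewrite [leRHS]mulrDl; apply: lerD; rewrite normrM.
  apply: (@le_trans _ _ (B * (Q * B ^+ (2 * l) * e ^+ 2))); first exact: ler_pM.
  rewrite mulnS exprD [leRHS](_ : _ = B * (B * (Q * B ^+ (2 * l) * e ^+ 2))); last by ring.
  by rewrite ler_wpM2l// ler_peMl// !mulr_ge0// ?exprn_ge0.
apply: (@le_trans _ _ (e * (A * B ^+ l * e))); first exact: ler_pM.
rewrite [leLHS](_ : _ = A * (B ^+ l * e ^+ 2)); last by ring.
by rewrite ler_wpM2l// ler_wpM2r ?sqr_ge0// ler_weXn2l// (leq_trans (leqnSn l))// leq_pmull.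
Qed.
End LayerExpansion.

(** * Partial derivatives *)

Section SumOfSquares.
Context {R : realType}.

Lemma sqr_sum_le (I : finType) (f : I -> R) :
  (\sum_i f i) ^+ 2 <= #|I|%:R * \sum_i f i ^+ 2.
Proof.
set S := \sum_i f i; set Q := \sum_i _; set N := #|I|%:R.
have [N0|N0] := eqVneq #|I| 0%N.
  rewrite /N N0 mul0r /S big_pred0 ?expr0n// => i.
  by have := card0_eq N0 i.
have : 0 <= \sum_i (N * f i - S) ^+ 2 by rewrite sumr_ge0// => i _; exact: sqr_ge0.
have -> : \sum_i (N * f i - S) ^+ 2 = N * (N * Q - S ^+ 2).
  have -> : \sum_i (N * f i - S) ^+ 2 =
      \sum_i (N ^+ 2 * f i ^+ 2 + (- (2 * N * S) * f i + S ^+ 2)).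
    by apply: eq_bigr => i _; ring.
  rewrite !big_split/= -!mulr_sumr sumr_const -[_ *+ _]mulr_natl -/N -/Q -/S.
  by ring.
by rewrite pmulr_rge0 ?subr_ge0// ltr0n lt0n.
Qed.
End SumOfSquares.

Section PartialDerivative.
Context {R : realType}.

(** A first-order expansion with a quadratic remainder determines the
    derivative, because the difference quotients then converge to its slope.  The
    expansion of the risk is purely algebraic, and this is the step from there to
    the gradient. *)
Lemma derive1_quadratic (phi : R -> R) z0 (g C : R) :
  (forall z, `|phi z - phi z0 - g * (z - z0)| <= C * (z - z0) ^+ 2) ->
  derive1 phi z0 = g.
Proof.
move=> H; rewrite /derive1; apply: cvg_lim => //.
apply/cvgrPdist_lt => e e0.
have C0 : 0 <= C.
  have := le_trans (normr_ge0 _) (H (z0 + 1)).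
  by rewrite addrAC subrr add0r expr1n mulr1.
near=> h.
have h0 : h != 0 by near: h; exact: nbhs_dnbhs_neq.
have hs : `|h| < e / (C + 1).
  near: h; apply: dnbhs0_lt; rewrite divr_gt0// ltr_pwDr//.
have := H (h + z0); rewrite addrK => Hh.
rewrite distrC /GRing.scale/=.
have -> : h^-1 * (phi (h + z0) - phi z0) - g =
   h^-1 * (phi (h + z0) - phi z0 - g * h).
  by field.
rewrite normrM normfV ltr_pdivrMl ?normr_gt0//.
apply: (le_lt_trans Hh); rewrite -real_normK ?num_real// expr2 mulrA [ltRHS]mulrC.
rewrite ltr_pM2r ?normr_gt0//.
have : (C + 1) * `|h| < e by rewrite mulrC -ltr_pdivlMr// ltr_pwDr.
apply: le_lt_trans; rewrite ler_wpM2r// lerDl//.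
Unshelve. all: by end_near. Qed.

Lemma partial_derivative_quadratic (I : finType) (F : (I -> R) -> R) w (G : I -> R) C :
  (forall u, `|F (fun i => w i + u i) - F w - \sum_i G i * u i| <= C * \sum_i u i ^+ 2) ->
  forall i, partial_derivative F w i = G i.
Proof.
move=> H i; apply: (@derive1_quadratic _ _ _ C) => z.
have E z' : dfwith w i z' = (fun j => w j + (if j == i then z' - w i else 0)).
  apply/funext => j; rewrite /dfwith; case: eqP => [ij|ij].
    case: _ / ij => /=; rewrite eqxx; ring.
  by case: eqP ij => [->//|]; rewrite addr0.
have {}E0 : dfwith w i (w i) = w.
  by rewrite E; apply/funext => j; case: eqP => [->|]; rewrite ?subrr addr0.
have S (f : I -> R -> R) : (forall j, f j 0 = 0) ->
    \sum_j f j (if j == i then z - w i else 0) = f i (z - w i).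
  move=> f0; rewrite (bigD1 i)//= eqxx big1 ?addr0// => j /negbTE ->; exact: f0.
have := H (fun j => if j == i then z - w i else 0).
rewrite (S (fun j t => G j * t)); last by move=> j; rewrite mulr0.
rewrite (S (fun j t => t ^+ 2)); last by move=> j; rewrite expr0n.
by rewrite -E E0.
Qed.
End PartialDerivative.

(** * Gradient descent on a locally smooth function *)

Section GradientDescent.
Context {R : realType} {I : finType}.
Context (F : (I -> R) -> R) (lambda delta : R) (w0 : I -> R) (T : nat).
Context (F_ge0 : forall w, 0 <= F w) (lambda_gt0 : 0 < lambda)
  (travel : 2 * lambda * T%:R * F w0 <= delta ^+ 2) (delta_ge0 : 0 <= delta).

Let near w := forall i, `|w i - w0 i| <= delta.
Let grad w i := partial_derivative F w i.
Let wt t := gradient_descent F lambda w0 t.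

Context (descent : forall w, near w -> F w <= F w0 ->
  F (fun i => w i - lambda * grad w i)
    <= F w - lambda / 2 * \sum_i grad w i ^+ 2).

Let wtS t i : wt t.+1 i = wt t i - lambda * grad (wt t) i.
Proof. by []. Qed.

(** Each step lowers the risk by a multiple of the squared gradient, so the
    total energy spent is at most the initial risk; by the Cauchy-Schwarz
    inequality this bounds the distance travelled, and therefore the iterates
    stay in the region where the descent inequality is available. *)
Lemma gradient_descent_stays t : (t <= T)%N -> near (wt t) /\ F (wt t) <= F w0.
Proof.
have energy0 k : 0 <= \sum_(s < k) \sum_i grad (wt s) i ^+ 2.
  by rewrite sumr_ge0// => s _; rewrite sumr_ge0// => i _; rewrite sqr_ge0.
move=> tT.
suff : F (wt t) + lambda / 2 * \sum_(s < t) \sum_i grad (wt s) i ^+ 2 <= F w0 /\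
    near (wt t).
  move=> [H ?]; split => //; apply: le_trans H; rewrite lerDl mulr_ge0//.
  by rewrite divr_ge0// ltW.
elim: t tT => [_|t IH tT].
  by rewrite big_ord0 mulr0 addr0; split => // i; rewrite subrr normr0.
have [E nt] := IH (ltnW tT).
have Ft : F (wt t) <= F w0.
  apply: le_trans E; rewrite lerDl mulr_ge0//.
  by rewrite divr_ge0// ltW.
have {}E : F (wt t.+1) + lambda / 2 * \sum_(s < t.+1) \sum_i grad (wt s) i ^+ 2 <= F w0.
  rewrite big_ord_recr/= mulrDr.
  have D : F (wt t.+1) <= F (wt t) - lambda / 2 * \sum_i grad (wt t) i ^+ 2 := descent nt Ft.
  lra.
split=> // i.
have wE : wt t.+1 i - w0 i = - lambda * \sum_(s < t.+1) grad (wt s) i.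
  elim: (t.+1) => [|k IHk]; first by rewrite big_ord0 mulr0 subrr.
  by rewrite wtS big_ord_recr/= mulrDr -IHk; ring.
rewrite -[leRHS]ger0_norm// -ler_sqr ?nnegrE// !real_normK ?num_real//.
apply: le_trans travel; rewrite wE exprMn sqrrN.
have S1 : (\sum_(s < t.+1) grad (wt s) i) ^+ 2 <=
    t.+1%:R * \sum_(s < t.+1) \sum_i grad (wt s) i ^+ 2.
  apply: (le_trans (sqr_sum_le _)); rewrite card_ord ler_wpM2l// ler_sum// => s _.
  by rewrite (bigD1 i)//= lerDl sumr_ge0// => j _; rewrite sqr_ge0.
apply: (@le_trans _ _ (2 * lambda * t.+1%:R * F w0)); last first.
  by rewrite ler_wpM2r// ler_wpM2l ?ler_nat// mulr_ge0// ltW.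
have F1 := F_ge0 (wt t.+1).
have S2 : lambda / 2 * \sum_(s < t.+1) \sum_i grad (wt s) i ^+ 2 <= F w0 by lra.
set S := \sum_(s < t.+1) \sum_i _ in S1 S2.
apply: (@le_trans _ _ (lambda ^+ 2 * (t.+1%:R * S))); first by rewrite ler_wpM2l ?sqr_ge0.
have -> : lambda ^+ 2 * (t.+1%:R * S) = 2 * lambda * t.+1%:R * (lambda / 2 * S) by field.
by rewrite ler_wpM2l// mulr_ge0// mulr_ge0// ltW.
Qed.

(** The coordinates in [o] see a convex function, up to the drift of the other
    coordinates.  The usual telescoping of squared distances to a reference
    point [wref] therefore compares the final risk with the risks of [wref]
    completed by the current other coordinates. *)
Lemma gradient_descent_outer (o : pred I) (wref : I -> R) U :
  (forall w u, (forall i, ~~ o i -> u i = 0) ->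
    near w -> F w <= F w0 ->
    F w + \sum_i grad w i * u i <= F (fun i => w i + u i)) ->
  (0 < T)%N ->
  (forall t, (t < T)%N -> F (fun i => if o i then wref i else wt t i) <= U) ->
  F (wt T) <= U + (\sum_(i | o i) (wref i - w0 i) ^+ 2) / (2 * lambda * T%:R).
Proof.
move=> convex T0 HU.
pose dist t := \sum_(i | o i) (wref i - wt t i) ^+ 2.
have step t : (t < T)%N -> F (wt t.+1) <= U + (dist t - dist t.+1) / (2 * lambda).
  move=> tT; have [nt Ft] := gradient_descent_stays (ltnW tT).
  have D : F (wt t.+1) <= F (wt t) - lambda / 2 * \sum_i grad (wt t) i ^+ 2 := descent nt Ft.
  pose u i := if o i then wref i - wt t i else 0.
  have uE : (fun i => wt t i + u i) = fun i => if o i then wref i else wt t i.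
    by apply/funext => i; rewrite /u; case: ifP; rewrite ?addr0// => _; rewrite addrC subrK.
  have := convex (wt t) u (fun i oi => ifN _ _ oi) nt Ft; rewrite uE => C.
  have := HU _ tT => HUt.
  have S1 : \sum_(i | o i) grad (wt t) i ^+ 2 <= \sum_i grad (wt t) i ^+ 2.
    by rewrite [leRHS](bigID o)/= lerDl sumr_ge0// => i _; rewrite sqr_ge0.
  have S1' : lambda / 2 * \sum_(i | o i) grad (wt t) i ^+ 2 <=
      lambda / 2 * \sum_i grad (wt t) i ^+ 2.
    by rewrite ler_wpM2l// divr_ge0// ltW.
  have -> : (dist t - dist t.+1) / (2 * lambda) =
      - \sum_i grad (wt t) i * u i - lambda / 2 * \sum_(i | o i) grad (wt t) i ^+ 2.
    have -> : \sum_i grad (wt t) i * u i = \sum_(i | o i) grad (wt t) i * u i.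
      rewrite (bigID o)/= [X in _ + X]big1 ?addr0// => i /negbTE oi.
      by rewrite /u oi mulr0.
    rewrite /dist -sumrB mulr_suml mulr_sumr -sumrN -sumrB; apply: eq_bigr => i oi.
    by rewrite /u oi wtS; field; rewrite gt_eqF.
  lra.
have tel k : (k <= T)%N ->
    k%:R * F (wt T) <= k%:R * U + (dist (T - k)%N - dist T) / (2 * lambda).
  elim: k => [|k IH] kT; first by rewrite !mul0r subn0 subrr mul0r addr0.
  have H1 := IH (ltnW kT).
  have kT' : (T - k.+1 < T)%N by rewrite ltn_subrL T0.
  have H2 := step _ kT'.
  have mono j : (j <= k)%N -> F (wt T) <= F (wt (T - j)%N).
    elim: j => [|j IHj] jk; first by rewrite subn0.
    apply: (le_trans (IHj (ltnW jk))).
    have jT : (j < T)%N by rewrite (leq_trans jk)// ltnW.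
    have [nt Ft] := gradient_descent_stays (leq_subr j.+1 T).
    have D : F (wt (T - j.+1).+1) <= F (wt (T - j.+1)%N) - lambda / 2 * \sum_i grad (wt (T - j.+1)%N) i ^+ 2 := descent nt Ft.
    have -> : (T - j = (T - j.+1).+1)%N by rewrite subnSK.
    apply: (le_trans D); rewrite gerBl mulr_ge0//; first by rewrite divr_ge0// ltW.
    by rewrite sumr_ge0// => i _; rewrite sqr_ge0.
  have := mono k (leqnn _) => H3.
  move: H2; have -> : ((T - k.+1).+1 = T - k)%N by rewrite subnSK.
  move=> H2; rewrite -natr1 (mulrDl _ _ (F (wt T))) (mulrDl _ _ U) !mul1r.
  have -> : (dist (T - k.+1)%N - dist T) / (2 * lambda) =
     (dist (T - k)%N - dist T) / (2 * lambda) + (dist (T - k.+1)%N - dist (T - k)%N) / (2 * lambda).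
    by rewrite -mulrDl; congr (_ / _); ring.
  lra.
have := tel T (leqnn _); rewrite subnn.
have T0' : 0 < T%:R :> R by rewrite ltr0n.
have -> : \sum_(i | o i) (wref i - w0 i) ^+ 2 = dist 0%N by [].
have d0 : 0 <= dist T by rewrite sumr_ge0// => i _; rewrite sqr_ge0.
move=> H; rewrite -(ler_pM2l T0') mulrDr; apply: (le_trans H); rewrite lerD2l.
have -> : T%:R * (dist 0%N / (2 * lambda * T%:R)) = dist 0%N / (2 * lambda).
  by field; rewrite !gt_eqF.
by rewrite ler_wpM2r ?invr_ge0 ?mulr_ge0 ?(ltW lambda_gt0)// gerBl.
Qed.
End GradientDescent.

(** * Smoothness of the regularized empirical risk *)

Section RiskExpansion.
Context {R : realType} {d L r : nat} (r_gt0 : (0 < r)%N).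

(** Half of a Lipschitz constant of the gradient of the risk: linear in the
    number [K] of subnetworks and polynomial in the bounds [Phi] of the risk and
    [B] of the inner weights of the higher levels. *)
Definition smoothness_bound (A Q c3 Phi B : R) (K : nat) : R :=
  K%:R * (2 * (1 + Phi) * (A * B ^+ L.-1 + (1 + Phi / c3) * (Q * B ^+ (2 * L.-1)))
    + (1 + (1 + Phi / c3) * (A * B ^+ L.-1)) ^+ 2 + c3).

(** The subnetworks enter the risk linearly in the output weights, so their
    first-order expansions combine to one of the risk.  A risk of at most [Phi]
    bounds both the residuals and, through the penalty, the output weights, which
    multiply the remainders of the subnetworks.  When the inner weights do not
    move, the remainder is a sum of squares; this is convexity in the output
    weights. *)
Lemma risk_expansion (M : R) : 0 <= M ->
  exists A Q : R, [/\ 0 <= A, 0 <= Q &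
  forall (c3 Phi B : R) (n K : nat) (x : 'I_n -> d.-tuple R) (y : 'I_n -> R)
    (w : weight_index d L r K -> R),
  (0 < n)%N -> (0 < K)%N -> 0 < c3 -> 1 <= B -> 0 <= Phi ->
  (forall i j, `|tnth (x i) j| <= M) ->
  (forall k b, `|w (inr (k, inr b))| <= B) ->
  empirical_risk r_gt0 c3 x y w <= Phi ->
  let F := empirical_risk r_gt0 c3 x y in
  exists G : weight_index d L r K -> R,
  (forall u, `|F (fun b => w b + u b) - F w - \sum_b G b * u b|
     <= smoothness_bound A Q c3 Phi B K * \sum_b u b ^+ 2) /\
  (forall u, (forall k b, u (inr (k, b)) = 0) ->
     F w + \sum_b G b * u b <= F (fun b => w b + u b))].
Proof.
move=> M0; have [A [Q [A0 Q0 HL]]] := @layer_expansion R d L r M L.-1 M0.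
exists A, Q; split => // c3 Phi B n K x y w n0 K0 c30 B1 Phi0 xM wB wPhi F.
have B0 : 0 <= B by rewrite (le_trans _ B1).
set A1 := A * B ^+ L.-1; set Q1 := Q * B ^+ (2 * L.-1).
have A10 : 0 <= A1 by rewrite mulr_ge0// exprn_ge0.
have Q10 : 0 <= Q1 by rewrite mulr_ge0// exprn_ge0.
set phi := 1 + Phi / c3.
have phi0 : 0 <= Phi / c3 by rewrite divr_ge0// ltW.
have phi1 : 1 <= phi by rewrite lerDl.
pose a k := w (inl k); pose v k b := w (inr (k, b)).
pose ua (u : weight_index d L r K -> R) k := u (inl k).
pose uv (u : weight_index d L r K -> R) k b := u (inr (k, b)).
pose f (i : 'I_n) k := subnetwork r_gt0 (v k) (x i).
pose f' u (i : 'I_n) k := subnetwork r_gt0 (fun b => v k b + uv u k b) (x i).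
have /choice[g gP] : forall ik : 'I_n * 'I_K, exists g, linear_form g /\
    forall (e : R) u, 0 <= e -> (forall b, `|uv u ik.2 b| <= e) ->
      `|f' u ik.1 ik.2 - f ik.1 ik.2| <= A1 * e /\
      `|f' u ik.1 ik.2 - f ik.1 ik.2 - g (uv u ik.2)| <= Q1 * e ^+ 2.
  move=> [i k].
  have [g gl gP] := HL B (v k) (x i) (Ordinal r_gt0) B1 (fun b => wB k b) (xM i).
  by exists g; split => // e u e0 ue; exact: gP.
pose net (w : weight_index d L r K -> R) i := network r_gt0 w (x i).
pose res i := y i - net w i.
pose D u i := \sum_k (ua u k * f' u i k + a k * (f' u i k - f i k)).
pose l u i := \sum_k (f i k * ua u k + a k * g (i, k) (uv u k)).
have netD u i : net (fun b => w b + u b) i = net w i + D u i.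
  rewrite /net /network /combination /D -big_split/=; apply: eq_bigr => k _.
  rewrite -/(f i k) -/(f' u i k) -/(a k) -/(ua u k); ring.
pose lin u := n%:R^-1 * (\sum_i - 2 * res i * l u i) + c3 * \sum_k 2 * a k * ua u k.
have linL : linear_form lin.
  apply: linear_formD; apply: linear_formZ; apply: linear_form_sum => i.
    apply: linear_formZ; apply: linear_form_sum => k; apply: linear_formD; apply: linear_formZ.
      exact: linear_form_eval.
    have [[G HG] _] := gP (i, k).
    have -> : (fun u => g (i, k) (uv u k)) = (fun u => \sum_b G b * u (inr (k, b))).
      by apply/funext => u; rewrite HG.
    apply: linear_form_sum => b; apply: linear_formZ; exact: linear_form_eval.
  apply: linear_formZ; exact: linear_form_eval.
have FE u : F (fun b => w b + u b) - F w - lin u =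
    n%:R^-1 * (\sum_i (- 2 * res i * (D u i - l u i) + D u i ^+ 2)) +
    c3 * \sum_k ua u k ^+ 2.
  rewrite /F /empirical_risk /lin.
  have -> : \sum_(i < n) `|y i - network r_gt0 (fun b => w b + u b) (x i)| ^+ 2 =
     \sum_(i < n) `|y i - network r_gt0 w (x i)| ^+ 2 + \sum_i - 2 * res i * l u i +
     \sum_i (- 2 * res i * (D u i - l u i) + D u i ^+ 2).
    rewrite -!big_split/=; apply: eq_bigr => i _.
    rewrite !real_normK ?num_real// -/(net _ i) -/(net w i) netD /res; ring.
  have -> : \sum_(k < K) `|w (inl k) + u (inl k)| ^+ 2 =
     \sum_(k < K) `|w (inl k)| ^+ 2 + \sum_k 2 * a k * ua u k + \sum_k ua u k ^+ 2.
    rewrite -!big_split/=; apply: eq_bigr => k _.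
    rewrite !real_normK ?num_real// /a /ua; ring.
  ring.
have [G linE] := linL; exists G; split; last first.
  move=> u u0; rewrite -linE -subr_ge0.
  have -> : F (fun b => w b + u b) - (F w + lin u) = F (fun b => w b + u b) - F w - lin u by ring.
  rewrite FE addr_ge0//.
    rewrite mulr_ge0// sumr_ge0// => i _.
    have uv0 k b : uv u k b = 0 by exact: u0.
    suff -> : D u i = l u i by rewrite subrr mulr0 add0r sqr_ge0.
    apply: eq_bigr => k _.
    have [_ /(_ 0 u (lexx _))] := gP (i, k).
    case=> [b|/=]; first by rewrite uv0 normr0.
    rewrite !mulr0 !normr_le0 expr0n mulr0 normr_le0 => /eqP E1 /eqP.
    rewrite E1 sub0r => /eqP; rewrite oppr_eq0 => /eqP ->.
    by rewrite !mulr0 !addr0 (subr0_eq E1) mulrC.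
  by rewrite mulr_ge0 ?(ltW c30)// sumr_ge0// => k _; rewrite sqr_ge0.
move=> u; rewrite -linE FE.
set S := \sum_b u b ^+ 2.
have S0 : 0 <= S by rewrite sumr_ge0// => b _; rewrite sqr_ge0.
set e := Num.sqrt S; have e0 : 0 <= e by rewrite sqrtr_ge0.
have eS : e ^+ 2 = S by rewrite sqr_sqrtr.
have ue b : `|u b| <= e.
  rewrite -(ger0_norm e0) -ler_sqr ?nnegrE// !real_normK ?num_real// eS.
  by rewrite /S (bigD1 b)//= lerDl sumr_ge0// => j _; rewrite sqr_ge0.
set s := Num.sqrt (K%:R : R).
have sK : s ^+ 2 = K%:R by rewrite sqr_sqrtr.
have s0 : 0 <= s by rewrite sqrtr_ge0.
have s1 : 1 <= s by rewrite -sqrtr1 ler_sqrt// ler1n.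
have sum_abs (h : 'I_K -> R) c : 0 <= c -> \sum_k h k ^+ 2 <= c ^+ 2 -> \sum_k `|h k| <= s * c.
  move=> cc hc; have sc : 0 <= s * c by rewrite mulr_ge0.
  rewrite -(ler_sqr (sumr_ge0 _ (fun k _ => normr_ge0 (h k)))) ?nnegrE//.
  apply: (le_trans (sqr_sum_le _)); rewrite card_ord exprMn sK ler_wpM2l//.
  by under eq_bigr do rewrite real_normK ?num_real//.
have uaS : \sum_k ua u k ^+ 2 <= S.
  by rewrite /S big_sumType/= lerDl sumr_ge0// => b _; rewrite sqr_ge0.
have Sua : \sum_k `|ua u k| <= s * e by apply: sum_abs => //; rewrite eS.
have n1 : 0 < (n%:R : R)^-1 by rewrite invr_gt0 ltr0n.
have resS : n%:R^-1 * \sum_i `|res i| ^+ 2 <= Phi.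
  apply: le_trans wPhi; rewrite /empirical_risk lerDl mulr_ge0 ?(ltW c30)//.
  by rewrite sumr_ge0// => k _; rewrite sqr_ge0.
have aPhi : \sum_k a k ^+ 2 <= Phi / c3.
  rewrite ler_pdivlMr// mulrC; apply: le_trans wPhi; rewrite /empirical_risk.
  under [in leLHS]eq_bigr do rewrite -real_normK ?num_real//.
  rewrite lerDr mulr_ge0//.
  by rewrite sumr_ge0// => k _; rewrite sqr_ge0.
have Sa : \sum_k `|a k| <= s * phi.
  apply: sum_abs; first exact: le_trans phi1.
  by apply: (le_trans aPhi); rewrite /phi; nra.
have meanres : n%:R^-1 * \sum_i `|res i| <= 1 + Phi.
  apply: (@le_trans _ _ (n%:R^-1 * \sum_i (1 + `|res i| ^+ 2))).
    rewrite ler_wpM2l ?(ltW n1)// ler_sum// => i _.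
    by have := normr_ge0 (res i); nra.
  rewrite big_split/= sumr_const card_ord mulrDr lerD//.
  by rewrite -mulr_natl mulr1 mulVf// pnatr_eq0 -lt0n.
have De i : `|D u i| <= s * (1 + phi * A1) * e.
  apply: (le_trans (ler_norm_sum _ _ _)).
  apply: (@le_trans _ _ (\sum_k (`|ua u k| + `|a k| * (A1 * e)))).
    apply: ler_sum => k _; apply: (le_trans (ler_normD _ _)); rewrite !normrM lerD//.
      by rewrite ler_piMr// layer_norm_le1.
    have [_ /(_ e u e0 (fun b => ue _))[H _]] := gP (i, k).
    by rewrite ler_wpM2l.
  rewrite big_split/= -mulr_suml.
  have -> : s * (1 + phi * A1) * e = s * e + s * phi * (A1 * e) by ring.
  by rewrite lerD// ler_wpM2r// mulr_ge0.
have Dle i : `|D u i - l u i| <= s * (A1 + phi * Q1) * S.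
  have -> : D u i - l u i = \sum_k (ua u k * (f' u i k - f i k) +
      a k * (f' u i k - f i k - g (i, k) (uv u k))).
    by rewrite -sumrB; apply: eq_bigr => k _; ring.
  apply: (le_trans (ler_norm_sum _ _ _)).
  apply: (@le_trans _ _ (\sum_k (`|ua u k| * (A1 * e) + `|a k| * (Q1 * e ^+ 2)))).
    apply: ler_sum => k _; apply: (le_trans (ler_normD _ _)); rewrite !normrM.
    have [_ /(_ e u e0 (fun b => ue _))[H1 H2]] := gP (i, k).
    by rewrite lerD// ler_wpM2l.
  rewrite big_split/= -!mulr_suml.
  have -> : s * (A1 + phi * Q1) * S = s * e * (A1 * e) + s * phi * (Q1 * e ^+ 2).
    by rewrite -eS; ring.
  by rewrite lerD// ler_wpM2r// mulr_ge0// ?sqr_ge0.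
have K1 : (1 : R) <= K%:R by rewrite ler1n.
have sK' : s <= K%:R by rewrite -sK expr2 ler_peMl.
apply: (le_trans (ler_normD _ _)).
have -> : smoothness_bound A Q c3 Phi B K * S =
   K%:R * (2 * (1 + Phi) * (A1 + phi * Q1)) * S + K%:R * (1 + phi * A1) ^+ 2 * S +
   K%:R * c3 * S by rewrite /smoothness_bound -/A1 -/Q1 -/phi; ring.
apply: lerD; last first.
  rewrite normrM (ger0_norm (ltW c30)) ger0_norm; last first.
    by rewrite sumr_ge0// => k _; rewrite sqr_ge0.
  apply: (@le_trans _ _ (c3 * S)); first by rewrite ler_wpM2l// ltW.
  by rewrite -mulrA ler_peMl// mulr_ge0// ltW.
rewrite normrM gtr0_norm//.
apply: (@le_trans _ _ (n%:R^-1 * \sum_i (`|res i| * (2 * (s * (A1 + phi * Q1) * S)) +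
    (s * (1 + phi * A1) * e) ^+ 2))).
  rewrite ler_wpM2l ?(ltW n1)//; apply: (le_trans (ler_norm_sum _ _ _)).
  apply: ler_sum => i _; apply: (le_trans (ler_normD _ _)); apply: lerD.
    rewrite !normrM normrN (ger0_norm (_ : 0 <= 2))//.
    rewrite [leLHS](_ : _ = `|res i| * (2 * `|D u i - l u i|)); last by ring.
    by rewrite ler_wpM2l// ler_wpM2l// Dle.
  by rewrite normrX lerXn2r ?nnegrE// !mulr_ge0// addr_ge0// mulr_ge0// (le_trans _ phi1).
rewrite big_split/= -mulr_suml sumr_const card_ord -(mulr_natl (_ ^+ 2) n).
rewrite (mulrDr n%:R^-1) (mulrA n%:R^-1) mulKf; last by rewrite pnatr_eq0 -lt0n.
have pQ : 0 <= A1 + phi * Q1 by rewrite addr_ge0// mulr_ge0// (le_trans _ phi1).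
apply: lerD.
  apply: (@le_trans _ _ ((1 + Phi) * (2 * (s * (A1 + phi * Q1) * S)))).
    by rewrite ler_wpM2r// !mulr_ge0.
  have -> : (1 + Phi) * (2 * (s * (A1 + phi * Q1) * S)) = s * ((2 * (1 + Phi) * (A1 + phi * Q1)) * S) by ring.
  rewrite [leRHS](_ : _ = K%:R * ((2 * (1 + Phi) * (A1 + phi * Q1)) * S)); last by ring.
  by rewrite ler_wpM2r// !mulr_ge0// addr_ge0.
by rewrite !exprMn sK eS.
Qed.
End RiskExpansion.

(** * Training compared with fixed target weights *)

Section Training.
Context {R : realType} {d L r : nat} (r_gt0 : (0 < r)%N).

Lemma sum_extend_by_zero (I J : finType) (sel : J -> I) (a : J -> R) (h : I -> R -> R) :
  injective sel -> (forall i, h i 0 = 0) ->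
  \sum_i h i (if [pick j | sel j == i] is Some j then a j else 0)
    = \sum_j h (sel j) (a j).
Proof.
move=> sel_inj h0.
rewrite (bigID (mem (sel @: J)))/= [X in _ + X]big1 ?addr0; last first.
  move=> i iS; case: pickP => [j /eqP ji|//].
  by move: iS; rewrite -ji imset_f.
rewrite big_imset; last by move=> ? ? _ _; exact: sel_inj.
apply: eq_big => [j|j _]; first by rewrite inE.
case: pickP => [j' /eqP /sel_inj -> //|/(_ j)]; by rewrite eqxx.
Qed.

(** With the target weights [a] placed on the selected subnetworks, the drift
    of the inner weights is the only difference to a fixed competitor. *)
Lemma training_oracle (M : R) : 0 <= M ->
  exists A Q : R, [/\ 0 <= A, 0 <= Q &
  forall (c3 Phi B lambda delta U : R) (n K Kt T : nat)
    (x : 'I_n -> d.-tuple R) (y : 'I_n -> R)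
    (v0 : 'I_K -> inner_index d L r -> R) (sel : 'I_Kt -> 'I_K) (a : 'I_Kt -> R),
  (0 < n)%N -> (0 < K)%N -> (0 < T)%N -> 0 < c3 -> 0 < lambda -> 0 <= delta ->
  injective sel ->
  (forall i j, `|tnth (x i) j| <= M) ->
  1 <= B -> (forall k b, `|v0 k (inr b)| + delta <= B) ->
  n%:R^-1 * (\sum_i `|y i| ^+ 2) <= Phi ->
  2 * lambda * T%:R * Phi <= delta ^+ 2 ->
  lambda * smoothness_bound (L := L) A Q c3 Phi B K <= 2^-1 ->
  (forall vb, (forall k b, `|vb k b - v0 (sel k) b| <= delta) ->
     n%:R^-1 * (\sum_i `|y i - combination r_gt0 a vb (x i)| ^+ 2) <= U) ->
  let w := gradient_descent (empirical_risk r_gt0 c3 x y) lambda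
    (initial_weights v0) T in
  [/\ forall k b, `|w (inr (k, b)) - v0 k b| <= delta,
      c3 * (\sum_k `|w (inl k)| ^+ 2) <= Phi &
      n%:R^-1 * (\sum_i `|y i - network r_gt0 w (x i)| ^+ 2)
        <= U + (c3 + (2 * lambda * T%:R)^-1) * \sum_k `|a k| ^+ 2]].
Proof.
move=> M0; have [A [Q [A0 Q0 HE]]] := @risk_expansion R d L r r_gt0 M M0.
exists A, Q; split => // c3 Phi B lambda delta U n K Kt T x y v0 sel a n0 K0 T0 c30 lambda0
  delta0 sel_inj xM B1 vB yPhi travel smooth HU w.
set F := empirical_risk r_gt0 c3 x y in w *; set w0 := initial_weights v0 in w *.
have n1 : 0 < (n%:R : R)^-1 by rewrite invr_gt0 ltr0n.
have part1 w' : 0 <= n%:R^-1 * \sum_(i < n) `|y i - network r_gt0 w' (x i)| ^+ 2.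
  by rewrite mulr_ge0 ?(ltW n1)// sumr_ge0// => i _; rewrite sqr_ge0.
have part2 (w' : weight_index d L r K -> R) : 0 <= c3 * \sum_(k < K) `|w' (inl k)| ^+ 2.
  by rewrite mulr_ge0 ?(ltW c30)// sumr_ge0// => k _; rewrite sqr_ge0.
have F0 w' : 0 <= F w' by rewrite addr_ge0.
have Fw0 : F w0 <= Phi.
  apply: le_trans yPhi; rewrite /F /empirical_risk [X in _ + _ * X]big1 ?mulr0 ?addr0.
    rewrite ler_wpM2l ?(ltW n1)//; apply: ler_sum => i _.
    rewrite /network /combination big1 ?subr0// => k _.
    by rewrite /w0 /= mul0r.
  by move=> k _; rewrite /= normr0 expr0n.
have Phi0 : 0 <= Phi by rewrite (le_trans (F0 w0)).
have expansion w' : (forall b, `|w' b - w0 b| <= delta) -> F w' <= F w0 ->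
  (forall u, `|F (fun b => w' b + u b) - F w' - \sum_b partial_derivative F w' b * u b|
     <= smoothness_bound (L := L) A Q c3 Phi B K * \sum_b u b ^+ 2) /\
  (forall u, (forall k b, u (inr (k, b)) = 0) ->
     F w' + \sum_b partial_derivative F w' b * u b <= F (fun b => w' b + u b)).
  move=> nw Fw.
  have [||G [G1 G2]] := HE c3 Phi B n K x y w' n0 K0 c30 B1 Phi0 xM.
  - move=> k b; apply: le_trans (vB k b).
    have -> : w' (inr (k, inr b)) = v0 k (inr b) + (w' (inr (k, inr b)) - w0 (inr (k, inr b))).
      by rewrite /w0/=; ring.
    by apply: (le_trans (ler_normD _ _)); rewrite lerD2l.
  - exact: le_trans Fw0.
  have pE := partial_derivative_quadratic G1.
  split=> u; first by under eq_bigr do rewrite pE; exact: G1.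
  by move=> u0; under eq_bigr do rewrite pE; exact: G2.
have travel' : 2 * lambda * T%:R * F w0 <= delta ^+ 2.
  by apply: le_trans travel; rewrite ler_wpM2l// !mulr_ge0// ltW.
have descent w' : (forall i, `|w' i - w0 i| <= delta) -> F w' <= F w0 ->
    F (fun i => w' i - lambda * partial_derivative F w' i)
      <= F w' - lambda / 2 * \sum_i partial_derivative F w' i ^+ 2.
  move=> nw Fw; have [H _] := expansion w' nw Fw.
  have := H (fun i => - (lambda * partial_derivative F w' i)).
  have -> : \sum_b partial_derivative F w' b * - (lambda * partial_derivative F w' b) =
      - lambda * \sum_b partial_derivative F w' b ^+ 2.
    by rewrite mulr_sumr; apply: eq_bigr => b _; ring.
  have -> : \sum_b (- (lambda * partial_derivative F w' b)) ^+ 2 =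
      lambda ^+ 2 * \sum_b partial_derivative F w' b ^+ 2.
    by rewrite mulr_sumr; apply: eq_bigr => b _; ring.
  set S := \sum_b _; set Lam := smoothness_bound _ _ _ _ _ _ in smooth * => H1.
  have S0 : 0 <= S by rewrite sumr_ge0// => b _; rewrite sqr_ge0.
  have H2 : lambda * S * (lambda * Lam) <= lambda * S * 2^-1.
    by rewrite ler_wpM2l// mulr_ge0// ltW.
  move: (le_trans (ler_norm _) H1); nra.
have [nT FT] := gradient_descent_stays F0 lambda0 travel' delta0 descent (leqnn T).
split.
- by move=> k b; have := nT (inr (k, b)).
- by apply: le_trans (le_trans FT Fw0); rewrite /F /empirical_risk lerDr.
pose o (b : weight_index d L r K) := if b is inl _ then true else false.
pose ast k := if [pick j | sel j == k] is Some j then a j else 0.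
pose wref (b : weight_index d L r K) := if b is inl k then ast k else 0.
have normS : \sum_k `|ast k| ^+ 2 = \sum_j `|a j| ^+ 2.
  apply: (sum_extend_by_zero a (h := fun _ t => `|t| ^+ 2)) => // i.
  by rewrite normr0 expr0n.
have H := gradient_descent_outer F0 lambda0 travel' delta0 descent
  (o := o) (wref := wref) (U := U + c3 * \sum_k `|a k| ^+ 2).
apply: (@le_trans _ _ (F w)); first by rewrite /F /empirical_risk lerDl.
apply: (le_trans (H _ T0 _)).
- move=> w' u uo nw Fw; have [_ C] := expansion w' nw Fw.
  by apply: C => k b; exact: uo.
- move=> t tT; rewrite /F /empirical_risk /wref/= normS lerD2r.
  have [nt _] := gradient_descent_stays F0 lambda0 travel' delta0 descent (ltnW tT).
  set wt := gradient_descent _ _ _ t.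
  have := HU (fun j b => wt (inr (sel j, b))) (fun j b => nt (inr (sel j, b))).
  congr (_ * _ <= _); apply: eq_bigr => i _; congr (`|y i - _| ^+ 2).
  symmetry; apply: (sum_extend_by_zero a
    (h := fun k t => t * subnetwork r_gt0 (fun b => wt (inr (k, b))) (x i))) => // k.
  by rewrite mul0r.
have -> : \sum_(b | o b) (wref b - w0 b) ^+ 2 = \sum_k `|a k| ^+ 2.
  rewrite big_mkcond big_sumType/= [X in _ + X]big1 ?addr0// -normS; apply: eq_bigr => k _.
  by rewrite subr0 real_normK ?num_real.
by rewrite le_eqVlt; apply/orP; left; apply/eqP; ring.
Qed.
End Training.

(** * Local approximation of networks by features *)

Section LocalApproximation.
Context {R : realType}.

(** One application of the logistic function: the [k]-fold products of the
    given features again span a good approximation space. Products of exactly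
    [k] factors suffice for all powers up to [k], since one of the features is
    constantly one. *)
Lemma logistic_features (k : nat) : exists2 S : R, 1 <= S &
  forall (Y : Type) (I : finType) (fs : I -> Y -> R) (one : I) (D : set Y)
    (z : Y -> R) (z0 C E rho : R) (c : I -> R),
  (forall y, fs one y = 1) -> 1 <= C -> (forall i, `|c i| <= C) ->
  (forall y, D y -> `|z y - z0| <= rho) ->
  (forall y, D y -> `|z y - z0 - \sum_i c i * fs i y| <= E) ->
  exists c' : {ffun 'I_k -> I} -> R,
    (forall f, `|c' f| <= S * C ^+ k) /\
    (forall y, D y -> `|logistic (z y) - \sum_f c' f * \prod_i fs (f i) y|
       <= S * (rho + E) ^+ k + E).
Proof.
have [CT CT0 HT] := @logistic_taylor R k.
have /choice[b bP] : forall j : nat, exists b : R, 0 < b /\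
    forall x : R, `|(logistic_diff j).[logistic x]| <= b.
  by move=> j; have [b ? ?] := @logistic_diff_bounded R j; exists b.
have b0 j : 0 < b j by case: (bP j).
exists (1 + CT + \sum_(j < k) b j).
  by rewrite -addrA lerDl addr_ge0 ?(ltW CT0)// sumr_ge0// => j _; rewrite ltW.
set S := 1 + CT + _.
move=> Y I fs one D z z0 C E rho c one1 C1 cC zrho zE.
have C0 : 0 <= C by rewrite (le_trans _ C1).
pose s j := (logistic_diff j).[logistic z0] / j`!%:R.
have sb j : `|s j| <= b j.
  rewrite /s normrM normfV (ger0_norm (ler0n _ _)) ler_pdivrMr ?ltr0n ?fact_gt0//.
  apply: (le_trans (proj2 (bP j) _)); rewrite ler_peMr ?(ltW (b0 j))//.
  by rewrite ler1n fact_gt0.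
pose co (j i : nat) a := if (i < j)%N then c a else (a == one)%:R.
exists (fun f => \sum_(j < k) s j * \prod_(i < k) co j i (f i)); split=> [f|y Dy].
  apply: (le_trans (ler_norm_sum _ _ _)).
  apply: (@le_trans _ _ (\sum_(j < k) b j * C ^+ k)).
    apply: ler_sum => j _; rewrite normrM ler_pM// normr_prod.
    rewrite -[X in _ ^+ X]card_ord -prodr_const.
    apply: ler_prod => i _; rewrite normr_ge0 /co/=; case: ifP => // _.
    by case: eqP => _; rewrite ?normr1 ?normr0.
  rewrite -mulr_suml ler_wpM2r ?exprn_ge0// /S lerDr addr_ge0// ltW//.
pose p := \sum_i c i * fs i y.
have zp : `|z y - z0 - p| <= E := zE _ Dy.
have pE : `|p| <= rho + E.
  have -> : p = (z y - z0) - (z y - z0 - p) by ring.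
  by apply: (le_trans (ler_normB _ _)); rewrite lerD// zrho.
have -> : \sum_(f : {ffun 'I_k -> I}) (\sum_(j < k) s j * \prod_(i < k) co j i (f i)) *
    \prod_(i < k) fs (f i) y = \sum_(j < k) s j * p ^+ j.
  under eq_bigr do rewrite mulr_suml.
  rewrite exchange_big/=; apply: eq_bigr => j _.
  under eq_bigr do rewrite -mulrA -big_split/=.
  rewrite -mulr_sumr -(bigA_distr_bigA (fun (i : 'I_k) (a : I) => co j i a * fs a y)); congr (_ * _).
  transitivity (\prod_(i < k) (if (i < j)%N then p else 1)).
    apply: eq_bigr => i _; rewrite /co; case: ifP => // _.
    rewrite (bigD1 one)//= eqxx one1 mulr1 big1 ?addr0// => a /negbTE ->.
    by rewrite mul0r.
  rewrite -big_mkcond/= (big_ord_narrow (F := fun=> p) (ltnW (ltn_ord j))).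
  by rewrite prodr_const card_ord.
have -> : logistic (z y) - \sum_(j < k) s j * p ^+ j =
  (logistic (z0 + p) - \sum_(j < k) s j * p ^+ j) +
  (logistic ((z0 + p) + (z y - z0 - p)) - logistic (z0 + p)).
  have -> : z0 + p + (z y - z0 - p) = z y by ring.
  by ring.
apply: (le_trans (ler_normD _ _)); apply: lerD; last first.
  exact: le_trans (logistic_lipschitz _ _) _.
apply: (le_trans (HT _ _)); apply: ler_pM => //; first exact: ltW.
- rewrite /S addrAC lerDr addr_ge0// sumr_ge0// => j _; exact: ltW.
- by rewrite lerXn2r// nnegrE// (le_trans _ pE).
Qed.

(** The [l]-th approximation space of a cube: coordinates rescaled to the cube
    for [l = 0], then [k]-fold products of the previous features. *)
Fixpoint feature_index (d k l : nat) : finType :=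
  if l is l'.+1 then {ffun 'I_k -> feature_index d k l'} else option 'I_d.

Fixpoint feature (d k l : nat) : feature_index d k l -> ('I_d -> R) -> R :=
  match l with
  | 0 => fun a y => if a is Some j then y j else 1
  | l'.+1 => fun a y => \prod_(i < k) feature (a i) y
  end.

Lemma feature_one d k l :
  exists one : feature_index d k l, forall y, feature one y = 1.
Proof.
elim: l => [|l [one H]]; first by exists None.
by exists [ffun=> one] => y /=; rewrite big1// => i _; rewrite ffunE.
Qed.

Lemma feature_norm_le1 d k l (a : feature_index d k l) y :
  (forall j, `|y j| <= 1) -> `|feature a y| <= 1.
Proof.
move=> y1; elim: l a => [|l IH] a /=; first by case: a => [j|]//; rewrite normr1.
by rewrite normr_prod prodr_ile1// => i _; rewrite normr_ge0/=.
Qed.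

Context {d L r : nat}.
Implicit Types (x : d.-tuple R) (v : inner_index d L r -> R).

Definition in_cube (x0 : 'I_d -> R) (h : R) x := forall j, `|tnth x j - x0 j| <= h.

Definition in_box (A B : R) v :=
  (forall ij, `|v (inl ij)| <= A) /\ (forall b, `|v (inr b)| <= B).

(** On a cube whose side is small compared to the weights of the first level
    every node is close to the span of the features, with an error of order [k]
    in the side; all constants depend on the bound [B] of the other weights
    only polynomially. *)
Lemma layer_features (k l : nat) : (0 < k)%N ->
  exists (C : R) (e : nat), 1 <= C /\
  forall (A B h : R) v (x0 : d.-tuple R), 1 <= B -> 0 < h -> 0 <= A -> d%:R * A * h <= 1 ->
    in_box A B v ->
    forall i, exists c : feature_index d k l.+1 -> R,
    (forall a, `|c a| <= C * B ^+ e) /\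
    forall x, in_cube (tnth x0) h x ->
      `|layer v x l i - layer v x0 l i| <= C * B ^+ e * (d%:R * A * h) /\
      `|layer v x l i - \sum_a c a * feature a (fun j => (tnth x j - tnth x0 j) / h)|
        <= C * B ^+ e * (d%:R * A * h) ^+ k.
Proof.
move=> k0; have [S S1 HS] := logistic_features k.
have S0 : 0 <= S by rewrite (le_trans _ S1).
elim: l => [|l [C [e [C1 IH]]]].
  exists S, 0%N; split=> // A B h v x0 B1 h0 A0 rho1 [vA vB] i.
  set rho := d%:R * A * h in rho1 *.
  have rho0 : 0 <= rho by rewrite !mulr_ge0// ltW.
  pose z x := \sum_(j < d) v (inl (i, lift ord0 j)) * tnth x j + v (inl (i, ord0)).
  pose c (a : feature_index d k 0) := if a is Some j then v (inl (i, lift ord0 j)) * h else 0.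
  have cA (j : 'I_d) : `|v (inl (i, lift ord0 j)) * h| <= A * h.
    by rewrite normrM (gtr0_norm h0) ler_wpM2r// ltW.
  have zrho x : in_cube (tnth x0) h x -> `|z x - z x0| <= rho.
    move=> xc; rewrite /z opprD addrACA subrr addr0 -sumrB.
    apply: (le_trans (ler_norm_sum _ _ _)).
    have -> : rho = \sum_(j < d) A * h.
      by rewrite sumr_const card_ord -mulr_natl /rho; ring.
    apply: ler_sum => j _; rewrite -mulrBr normrM ler_pM//; exact: xc.
  have zE x : in_cube (tnth x0) h x -> `|z x - z x0 - \sum_a c a *
      @feature d k 0 a (fun j => (tnth x j - tnth x0 j) / h)| <= 0.
    move=> xc; rewrite normr_le0 subr_eq0; apply/eqP.
    rewrite /z opprD addrACA subrr addr0 -sumrB/=.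
    rewrite (bigD1 None)//= mul0r add0r (reindex_omap Some id)/=; last by case.
    apply: eq_big => [j|j _]; first by rewrite eqxx.
    by field; rewrite gt_eqF.
  have [|c' [c'C c'E]] := HS _ _ (fun a x => @feature d k 0 a (fun j => (tnth x j - tnth x0 j) / h)) None
    (in_cube (tnth x0) h) z (z x0) 1 0 rho c (fun=> erefl) (lexx _) _ zrho zE.
    case=> [j|]; last by rewrite normr0.
    rewrite /c (le_trans (cA j))// (le_trans _ rho1)// /rho -mulrA ler_peMl//.
      by rewrite mulr_ge0// ltW.
    by rewrite ler1n (leq_ltn_trans _ (ltn_ord j)).
  exists c'; split; first by move=> a; rewrite expr0 mulr1 (le_trans (c'C a))// expr1n mulr1.
  move=> x xc; split.
    rewrite expr0 mulr1 /= -/(z x) -/(z x0).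
    have -> : z x = z x0 + (z x - z x0) by ring.
    apply: (le_trans (logistic_lipschitz _ _)); apply: (le_trans (zrho x xc)).
    by rewrite ler_peMl.
  by have := c'E x xc; rewrite !addr0 expr0 mulr1.
pose C1' := 2 * r%:R * C + 1.
have C0 : 0 <= C by rewrite (le_trans _ C1).
have C1'1 : 1 <= C1' by rewrite lerDr !mulr_ge0.
have C1'0 : 0 <= C1' by rewrite (le_trans _ C1'1).
exists (S * C1' ^+ k + C1'), (e.+1 * k.+1)%N; split.
  by rewrite (le_trans C1'1)// lerDr mulr_ge0// exprn_ge0.
move=> A B h v x0 B1 h0 A0 rho1 vAB i.
set rho := d%:R * A * h in rho1 *.
have rho0 : 0 <= rho by rewrite !mulr_ge0// ltW.
have B0 : 0 <= B by rewrite (le_trans _ B1).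
have /choice[c cP] := IH A B h v x0 B1 h0 A0 rho1 vAB.
pose f x j := layer v x l j.
pose w j := hidden_weight v l.+1 i j.
have wB j : `|w j| <= B by apply: hidden_weight_le => //; case: vAB.
pose z x := \sum_(j < r) w (lift ord0 j) * f x j + w ord0.
have [one one1] := feature_one d k l.+1.
pose cz (a : feature_index d k l.+1) := \sum_(j < r) w (lift ord0 j) * (c j a - (a == one)%:R * f x0 j).
pose D := C1' * B ^+ e.+1.
have Be1 : 1 <= B ^+ e.+1 by rewrite exprn_ege1.
have D1 : 1 <= D by rewrite /D (le_trans C1'1)// ler_peMr.
have D0 : 0 <= D by rewrite (le_trans _ D1).
have CBe : 1 <= C * B ^+ e by rewrite (le_trans C1)// ler_peMr// exprn_ege1.
have sumr (F : 'I_r -> R) c0 : (forall j, `|F j| <= c0) ->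
    `|\sum_j w (lift ord0 j) * F j| <= r%:R * (B * c0).
  move=> Fc; apply: (le_trans (ler_norm_sum _ _ _)).
  rewrite mulr_natl -[X in _ *+ X]card_ord -sumr_const; apply: ler_sum => j _.
  by rewrite normrM ler_pM.
have czD a : `|cz a| <= D.
  apply: (@le_trans _ _ (r%:R * (B * (2 * (C * B ^+ e))))); last first.
    have -> : r%:R * (B * (2 * (C * B ^+ e))) = (2 * r%:R * C) * B ^+ e.+1 by rewrite exprS; ring.
    by rewrite /D ler_wpM2r ?exprn_ge0// lerDl.
  apply: sumr => j; apply: (le_trans (ler_normB _ _)); rewrite mulr2n [leRHS]mulrDl mul1r.
  apply: lerD; first by case: (cP j).
  rewrite (le_trans _ CBe)// normrM -[leRHS]mulr1 ler_pM//; last exact: layer_norm_le1.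
  by case: eqP => _; rewrite ?normr1 ?normr0.
have zrho x : in_cube (tnth x0) h x -> `|z x - z x0| <= r%:R * (B * (C * B ^+ e * rho)).
  move=> xc; have -> : z x - z x0 = \sum_(j < r) w (lift ord0 j) * (f x j - f x0 j).
    by rewrite /z opprD addrACA subrr addr0 -sumrB; apply: eq_bigr => j _; ring.
  by apply: sumr => j; have [_ /(_ x xc)[]] := cP j.
pose ft a x := @feature d k l.+1 a (fun j => (tnth x j - tnth x0 j) / h).
have zE x : in_cube (tnth x0) h x -> `|z x - z x0 - \sum_a cz a * ft a x|
    <= r%:R * (B * (C * B ^+ e * rho ^+ k)).
  move=> xc; have -> : z x - z x0 - \sum_a cz a * ft a x =
      \sum_(j < r) w (lift ord0 j) * (f x j - \sum_a c j a * ft a x).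
    have -> : \sum_a cz a * ft a x = \sum_(j < r) w (lift ord0 j) * (\sum_a c j a * ft a x - f x0 j).
      under eq_bigr do rewrite mulr_suml.
      rewrite exchange_big/=; apply: eq_bigr => j _.
      under eq_bigr do rewrite -mulrA.
      rewrite -mulr_sumr; congr (_ * _).
      under [LHS]eq_bigr do rewrite mulrBl.
      rewrite sumrB; congr (_ - _).
      rewrite (bigD1 one)//= eqxx /ft one1 mulr1 mul1r big1 ?addr0// => a /negbTE ->.
      by rewrite !mul0r.
    by rewrite /z opprD addrACA subrr addr0 -!sumrB; apply: eq_bigr => j _; ring.
  by apply: sumr => j; have [_ /(_ x xc)[]] := cP j.
have [c' [c'C c'E]] := HS _ _ ft one (in_cube (tnth x0) h) z (z x0) D
  (r%:R * (B * (C * B ^+ e * rho ^+ k))) (r%:R * (B * (C * B ^+ e * rho))) cz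
  (fun x => one1 _) D1 czD zrho zE.
have rhok : rho ^+ k <= rho by rewrite -[leRHS]expr1 ler_wiXn2l.
have halfD (t : R) : 0 <= t -> r%:R * (B * (C * B ^+ e * t)) <= D * t / 2.
  move=> t0; have -> : r%:R * (B * (C * B ^+ e * t)) = (r%:R * C) * (B ^+ e.+1 * t).
    by rewrite exprS; ring.
  have -> : D * t / 2 = (C1' / 2) * (B ^+ e.+1 * t) by rewrite /D; ring.
  apply: ler_wpM2r; first by rewrite mulr_ge0// exprn_ge0.
  by rewrite /C1'; lra.
have Dpow (j : nat) : (j <= k.+1)%N -> B ^+ (e.+1 * j) <= B ^+ (e.+1 * k.+1).
  by move=> jk; rewrite ler_weXn2l// leq_mul2l jk orbT.
have DkB : S * D ^+ k <= S * C1' ^+ k * B ^+ (e.+1 * k.+1).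
  by rewrite /D exprMn -exprM mulrA ler_wpM2l ?Dpow// mulr_ge0// exprn_ge0.
have DB : D <= C1' * B ^+ (e.+1 * k.+1).
  by rewrite /D ler_wpM2l// -[X in B ^+ X]muln1 Dpow.
have Bk0 : 0 <= B ^+ (e.+1 * k.+1) by rewrite exprn_ge0.
exists c'; split.
  move=> a; apply: (le_trans (c'C a)); apply: (le_trans DkB).
  by rewrite ler_wpM2r// lerDl.
move=> x xc; split.
  have -> : layer v x l.+1 i = logistic (z x0 + (z x - z x0)).
    by rewrite addrC subrK.
  apply: (le_trans (logistic_lipschitz _ _)); apply: (le_trans (zrho x xc)).
  apply: (le_trans (halfD _ rho0)); apply: (@le_trans _ _ (D * rho)).
    by have := mulr_ge0 D0 rho0; lra.
  rewrite ler_wpM2r//; apply: (le_trans DB); rewrite ler_wpM2r// lerDr.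
  by rewrite mulr_ge0// exprn_ge0.
apply: (le_trans (c'E x xc)).
have rk0 : 0 <= rho ^+ k by rewrite exprn_ge0.
apply: (@le_trans _ _ (S * (D * rho) ^+ k + D * rho ^+ k)).
  apply: lerD; last by rewrite (le_trans (halfD _ rk0))//; have := mulr_ge0 D0 rk0; lra.
  have p1 t : 0 <= t -> 0 <= r%:R * (B * (C * B ^+ e * t)).
    by move=> t0; rewrite !mulr_ge0// exprn_ge0.
  have H : r%:R * (B * (C * B ^+ e * rho)) + r%:R * (B * (C * B ^+ e * rho ^+ k)) <= D * rho.
    have := halfD _ rho0; have := halfD _ rk0.
    have := ler_wpM2l D0 rhok; lra.
  rewrite ler_wpM2l// lerXn2r// nnegrE; last exact: mulr_ge0.
  by rewrite addr_ge0// p1.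
by rewrite exprMn mulrA -mulrDl ler_wpM2r// [leRHS]mulrDl lerD.
Qed.
End LocalApproximation.

(** * Finite codes for classes of networks *)

Section Covering.
Context {R : realType} {d L r : nat} (r_gt0 : (0 < r)%N).
Local Notation params K := (('I_K -> R) * ('I_K -> inner_index d L r -> R))%type.

Definition in_class (alpha A B : R) K (w : params K) :=
  (forall k, `|w.1 k| <= alpha) /\ forall k, in_box A B (w.2 k).

(** Networks are encoded by the rounded coefficients of their local
    approximations.  The length of the code depends on the number of cubes and
    on the dimension of the approximation space, but not on the number [K] of
    subnetworks, which enters only through the size of the coefficients. *)
Lemma network_code (k : nat) : (0 < k)%N ->
  exists (C : R) (e p : nat), 1 <= C /\
  forall (K G N : nat) (alpha A B h M step : R),
    1 <= B -> 0 < h -> 0 <= A -> d%:R * A * h <= 1 -> 0 <= alpha -> 0 < step ->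
    M / h < G.+1%:R ->
    let H := K%:R * alpha * (C * B ^+ e) in
    2 * H / step < N.+1%:R ->
    exists (Code : finType) (code : params K -> Code),
      #|Code| = (N.+1 ^ (G.+1 ^ d * p))%N /\
      forall w w', in_class alpha A B w -> in_class alpha A B w' -> code w = code w' ->
      forall x : d.-tuple R, (forall j, `|tnth x j| <= M) ->
      `|combination r_gt0 w.1 w.2 x - combination r_gt0 w'.1 w'.2 x|
        <= 2 * H * (d%:R * A * h) ^+ k + p%:R * step.
Proof.
move=> k0; have [C [e [C1 HC]]] := @layer_features R d L r k L.-1 k0.
pose p := #|feature_index d k L.-1.+1|.
exists C, e, p; split=> // K G N alpha A B h M step B1 h0 A0 rho1 alpha0 step0 MG H HN.
have C0 : 0 <= C by rewrite (le_trans _ C1).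
have B0 : 0 <= B by rewrite (le_trans _ B1).
have CB0 : 0 <= C * B ^+ e by rewrite mulr_ge0// exprn_ge0.
have H0 : 0 <= H by rewrite /H !mulr_ge0// exprn_ge0.
set rho := d%:R * A * h in rho1 *.
have rho0 : 0 <= rho by rewrite !mulr_ge0// ltW.
pose cube := {ffun 'I_d -> 'I_G.+1}.
pose feat := feature_index d k L.-1.+1.
pose ctr (q : cube) : d.-tuple R := [tuple - M + (2 * (q j)%:R + 1) * h | j < d].
pose ft q (a : feat) (x : d.-tuple R) := feature a (fun j => (tnth x j - tnth (ctr q) j) / h).
have /choice[c cP] : forall vq : (inner_index d L r -> R) * cube, exists c : feat -> R,
    in_box A B vq.1 ->
    (forall a, `|c a| <= C * B ^+ e) /\
    forall x, in_cube (tnth (ctr vq.2)) h x ->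
      `|subnetwork r_gt0 vq.1 x - \sum_a c a * ft vq.2 a x| <= C * B ^+ e * rho ^+ k.
  move=> [v q]; have [vAB|nvAB] := pselect (in_box A B v); last by exists (fun=> 0).
  have [c [c1 c2]] := HC A B h v (ctr q) B1 h0 A0 rho1 vAB (Ordinal r_gt0).
  by exists c => _; split => // x xc; have [] := c2 x xc.
pose co (w : params K) q a := \sum_k w.1 k * c (w.2 k, q) a.
have sumK (a : 'I_K -> R) (F : 'I_K -> R) b : (forall k, `|a k| <= alpha) ->
    (forall k, `|F k| <= b) -> `|\sum_k a k * F k| <= K%:R * alpha * b.
  move=> aa Fb; apply: (le_trans (ler_norm_sum _ _ _)).
  rewrite -mulrA mulr_natl -[X in _ *+ X]card_ord -sumr_const; apply: ler_sum => j _.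
  by rewrite normrM ler_pM.
have coH w q a : in_class alpha A B w -> `|co w q a| <= H.
  move=> [w1 w2]; apply: sumK => // j.
  by have [] := cP (w.2 j, q) (w2 j).
have net w q x : in_class alpha A B w -> in_cube (tnth (ctr q)) h x ->
    `|combination r_gt0 w.1 w.2 x - \sum_a co w q a * ft q a x| <= H * rho ^+ k.
  move=> [w1 w2] xc; rewrite /combination.
  have -> : \sum_a co w q a * ft q a x = \sum_j w.1 j * \sum_a c (w.2 j, q) a * ft q a x.
    under eq_bigr do rewrite mulr_suml.
    rewrite exchange_big/=; apply: eq_bigr => j _.
    by rewrite mulr_sumr; apply: eq_bigr => a _; rewrite mulrA.
  rewrite -sumrB; under eq_bigr do rewrite -mulrBr.
  rewrite /H -[X in _ <= X]mulrA; apply: sumK => // j.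
  by have [_] := cP (w.2 j, q) (w2 j); exact.
pose Code := {ffun cube * feat -> 'I_N.+1}.
pose code (w : params K) : Code := [ffun qa => inord (Num.trunc ((co w qa.1 qa.2 + H) / step))].
exists Code, code; split.
  by rewrite card_ffun card_prod card_ffun !card_ord.
have truncP w q a : in_class alpha A B w ->
    let t := Num.trunc ((co w q a + H) / step) in
    (t < N.+1)%N /\ t%:R * step <= co w q a + H < t.+1%:R * step.
  move=> wc t; have /ler_normlP[cl cu] := coH _ q a wc.
  have pos : 0 <= (co w q a + H) / step by rewrite divr_ge0 ?(ltW step0)//; lra.
  have := truncn_itv pos; rewrite -/t ler_pdivlMr// ltr_pdivrMr// => tt.
  split=> //; rewrite -(ltr_nat R); apply: le_lt_trans HN; rewrite ler_pdivlMr//.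
  by case/andP: tt => tt _; apply: (le_trans tt); lra.
move=> w w' wc wc' ee x xM.
pose u j := (tnth x j + M) / (2 * h).
have h20 : 0 < 2 * h by rewrite mulr_gt0.
have u0 j : 0 <= u j by rewrite divr_ge0 ?(ltW h20)//; have /ler_normlP[] := xM j; lra.
have uG j : (Num.trunc (u j) < G.+1)%N.
  rewrite -(ltr_nat R); apply: le_lt_trans MG.
  have /andP[tu _] := truncn_itv (u0 j).
  apply: (le_trans tu); rewrite /u ler_pdivrMr// mulrCA divfK ?gt_eqF//.
  by have /ler_normlP[] := xM j; lra.
pose q : cube := [ffun j => inord (Num.trunc (u j))].
have xc : in_cube (tnth (ctr q)) h x.
  move=> j; rewrite tnth_mktuple ffunE inordK//.
  have := truncn_itv (u0 j); set t := Num.trunc _.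
  rewrite /u ler_pdivlMr// ltr_pdivrMr// -natr1 => /andP[t1 t2].
  by rewrite ler_norml; apply/andP; split; lra.
have cc a : `|co w q a - co w' q a| <= step.
  have [wN /andP[w1 w2]] := truncP w q a wc; have [wN' /andP[w1' w2']] := truncP w' q a wc'.
  have := congr1 (fun f : Code => val (f (q, a))) ee; rewrite /code !ffunE/= !inordK// => tE.
  move: w1 w2 w1' w2'; rewrite tE -!natr1 => w1 w2 w1' w2'.
  by rewrite ler_norml; apply/andP; split; lra.
have y1 a : `|ft q a x| <= 1.
  apply: feature_norm_le1 => j; rewrite normrM normfV (gtr0_norm h0) ler_pdivrMr// mul1r.
  exact: xc.
have n1 := net w q x wc xc; have n2 := net w' q x wc' xc.
set S1 := \sum_a _ in n1; set S2 := \sum_a _ in n2.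
have SS : `|S1 - S2| <= p%:R * step.
  rewrite /S1 /S2 -sumrB; apply: (le_trans (ler_norm_sum _ _ _)).
  rewrite mulr_natl /p -sumr_const; apply: ler_sum => a _.
  by rewrite -mulrBl normrM -[leRHS]mulr1 ler_pM.
have -> : combination r_gt0 w.1 w.2 x - combination r_gt0 w'.1 w'.2 x =
  (combination r_gt0 w.1 w.2 x - S1) - (combination r_gt0 w'.1 w'.2 x - S2) + (S1 - S2) by ring.
apply: (le_trans (ler_normD _ _)); apply: lerD => //.
apply: (le_trans (ler_normB _ _)); rewrite -mulrA mulr2n mulrDl mul1r.
exact: lerD.
Qed.
End Covering.

(** * Integrals of functions of independent variables *)

Section Transfer.
Context {dT dS : measure_display} {T : measurableType dT} {S : measurableType dS}
  {R : realType} (P : {measure set T -> \bar R}).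
Local Open Scope ereal_scope.
Import HBNNSimple.

Let integral_nnsfun_comp (W : T -> R) (Z : T -> S) (h : {nnsfun S >-> R})
    (s := fset_set (h @` setT)) :
  measurable_fun setT W -> (forall t, 0 <= W t)%R -> measurable_fun setT Z ->
  \int[P]_t (W t * h (Z t))%:E =
    \sum_(i < #|` s|) (s`_i)%:E * \int[P]_(t in Z @^-1` (h @^-1` [set s`_i])) (W t)%:E.
Proof.
move=> mW W0 mZ.
have s0 (i : 'I_#|` s|) : (0 <= s`_i)%R.
  have : s`_i \in s by rewrite mem_nth.
  rewrite /s in_fset_set; last exact: fimfunP.
  by move=> /set_mem [y _ <-].
have mA (i : 'I_#|` s|) : measurable (Z @^-1` (h @^-1` [set s`_i])).
  by rewrite -[X in measurable X]setTI; apply: mZ => //; exact: measurable_funPTI.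
pose F (i : 'I_#|` s|) : T -> R := (fun t => W t * \1_(Z @^-1` (h @^-1` [set s`_i])) t)%R.
have mF (i : 'I_#|` s|) : measurable_fun setT (EFin \o F i).
  by apply/measurable_EFinP; apply: measurable_funM => //; exact: measurable_indic.
have F0 (i : 'I_#|` s|) t : 0 <= (F i t)%:E.
  by rewrite lee_fin mulr_ge0// indicE.
transitivity (\int[P]_t \sum_(i < #|` s|) ((s`_i)%:E * (F i t)%:E)).
  apply: eq_integral => t _; rewrite fimfunEord mulr_sumr -sumEFin; apply: eq_bigr => i _.
  by rewrite -EFinM mulrCA.
rewrite ge0_integral_sum//.
- apply: eq_bigr => i _; rewrite ge0_integralZl//; [|exact: mF|by rewrite lee_fin].
  congr (_ * _); rewrite [RHS]integral_mkcond; apply: eq_integral => t _.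
  rewrite patchE /F indicE; case: ifP => _; first by rewrite mulr1.
  by rewrite mulr0.
- by move=> i; apply: measurable_funeM; exact: mF.
- by move=> i t _; rewrite mule_ge0 ?lee_fin// -lee_fin.
Qed.

(** An inequality between the integrals of two densities over all events
    determined by [Z] extends to all nonnegative functions of [Z]. *)
Lemma le_integral_comp (W1 W2 : T -> R) (Z : T -> S) (g : S -> R) :
  measurable_fun setT W1 -> measurable_fun setT W2 ->
  (forall t, 0 <= W1 t)%R -> (forall t, 0 <= W2 t)%R ->
  measurable_fun setT Z -> measurable_fun setT g -> (forall y, 0 <= g y)%R ->
  (forall A, measurable A ->
     \int[P]_(t in Z @^-1` A) (W1 t)%:E <= \int[P]_(t in Z @^-1` A) (W2 t)%:E) ->
  \int[P]_t (W1 t * g (Z t))%:E <= \int[P]_t (W2 t * g (Z t))%:E.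
Proof.
move=> mW1 mW2 W10 W20 mZ mg g0 H.
have mg' : measurable_fun setT (EFin \o g) by exact/measurable_EFinP.
pose h := nnsfun_approx measurableT mg'.
have lim (W : T -> R) : measurable_fun setT W -> (forall t, 0 <= W t)%R ->
    \int[P]_t (W t * h n (Z t))%:E @[n --> \oo] --> \int[P]_t (W t * g (Z t))%:E.
  move=> mW W0.
  have -> : \int[P]_t (W t * g (Z t))%:E =
      \int[P]_t (limn (fun n => (W t * h n (Z t))%:E)).
    apply: eq_integral => t _; apply/esym/cvg_lim => //.
    under eq_fun do rewrite EFinM.
    rewrite EFinM; apply: cvgeZl => //.
    by apply: (cvg_nnsfun_approx measurableT mg'); [move=> x _; rewrite lee_fin|].
  apply: cvg_monotone_convergence => //.
  - move=> n; apply/measurable_EFinP; apply: measurable_funM => //.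
    by apply: measurableT_comp.
  - by move=> n t _; rewrite lee_fin mulr_ge0.
  - move=> t _ a b ab; rewrite lee_fin ler_wpM2l//.
    by have /lefP := nd_nnsfun_approx measurableT mg' ab; exact.
have L1 := lim W1 mW1 W10; have L2 := lim W2 mW2 W20.
rewrite -(cvg_lim _ L1)// -(cvg_lim _ L2)//; apply: lee_lim.
- by apply/cvg_ex; eexists; exact: L1.
- by apply/cvg_ex; eexists; exact: L2.
apply: nearW => n; rewrite !integral_nnsfun_comp//; apply: lee_sum => i _.
apply: lee_wpmul2l; last by apply: H; exact: measurable_funPTI.
rewrite lee_fin; set s := fset_set _.
have : s`_i \in s by rewrite mem_nth.
rewrite /s in_fset_set; last exact: fimfunP.
by move=> /set_mem [y _ <-].
Qed.

(** The equality is used for the regression function, where the two densities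
    are the positive parts of a function and of its opposite. *)
Lemma eq_integral_comp (W1 W2 : T -> R) (Z : T -> S) (g : S -> R) :
  measurable_fun setT W1 -> measurable_fun setT W2 ->
  (forall t, 0 <= W1 t)%R -> (forall t, 0 <= W2 t)%R ->
  measurable_fun setT Z -> measurable_fun setT g -> (forall y, 0 <= g y)%R ->
  (forall A, measurable A ->
     \int[P]_(t in Z @^-1` A) (W1 t)%:E = \int[P]_(t in Z @^-1` A) (W2 t)%:E) ->
  \int[P]_t (W1 t * g (Z t))%:E = \int[P]_t (W2 t * g (Z t))%:E.
Proof.
move=> mW1 mW2 W10 W20 mZ mg g0 H; apply/eqP; rewrite eq_le.
by apply/andP; split; apply: le_integral_comp => // A mA; rewrite H.
Qed.
End Transfer.

Section Independence.
Context {dT dS : measure_display} {T : measurableType dT} {S : measurableType dS}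
  {R : realType} (P : probability T R).
Local Open Scope ereal_scope.

Lemma integral_in_indic (W : T -> R) (A : set T) :
  \int[P]_(t in A) (W t)%:E = \int[P]_t (W t * \1_A t)%:E.
Proof.
rewrite integral_mkcond; apply: eq_integral => t _.
rewrite patchE indicE; case: ifP => _; first by rewrite mulr1.
by rewrite mulr0.
Qed.

(** The factors are passed one at a time from indicators of events to general
    functions; while they are all indicators, the claim is the independence of
    the events. *)
Lemma independent_prod_le1 (I : choiceType) (F : I -> set (set T))
    (J : choiceType) (idx : J -> I) (Z : J -> T -> S) (g : J -> S -> R) :
  mutually_independent P F -> injective idx ->
  (forall j, F (idx j) = generated_events (Z j)) ->
  (forall i, F i set0) ->
  (forall j, measurable_fun setT (Z j)) -> (forall j, measurable_fun setT (g j)) ->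
  (forall j y, 0 <= g j y)%R -> (forall j, \int[P]_t (g j (Z j t))%:E <= 1) ->
  forall l : seq J, uniq l -> \int[P]_t (\prod_(j <- l) g j (Z j t))%:E <= 1.
Proof.
move=> indep idx_inj FE F0 mZ mg g0 g1 l ul.
suff : forall (l' : seq J) (A : J -> set S), uniq (l ++ l') ->
    (forall j, measurable (A j)) ->
    \int[P]_t (\prod_(j <- l) g j (Z j t) * \prod_(j <- l') \1_(Z j @^-1` A j) t)%:E
      <= \prod_(j <- l') P (Z j @^-1` A j).
  move=> /(_ [::] (fun=> set0)); rewrite cats0 => /(_ ul (fun=> measurable0)).
  by rewrite big_nil; under eq_integral do rewrite big_nil mulr1.
have mprod (l0 : seq J) : measurable_fun setT (fun t => \prod_(j <- l0) g j (Z j t))%R.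
  by apply: measurable_prod => j _; apply: measurableT_comp.
have mZA j A : measurable A -> measurable (Z j @^-1` A).
  by move=> mA; rewrite -[X in measurable X]setTI; exact: mZ.
have mind (l0 : seq J) (A : J -> set S) : (forall j, measurable (A j)) ->
    measurable_fun setT (fun t => \prod_(j <- l0) \1_(Z j @^-1` A j) t : R)%R.
  move=> mA; apply: measurable_prod => j _; apply: measurable_indic; exact: mZA.
elim: l ul => [|j l IH] /= ul l' A ull' mA.
  pose E i := if pselect (exists2 j, j \in l' & idx j = i) is left e
    then Z (projT1 (cid2 e)) @^-1` A (projT1 (cid2 e)) else set0.
  have EE j : j \in l' -> E (idx j) = Z j @^-1` A j.
    move=> jl; rewrite /E; case: pselect => [e|]; last by move=> []; exists j.
    by case: (cid2 e) => j' /= _ /idx_inj ->.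
  have FEi i : F i (E i).
    rewrite /E; case: pselect => [e|]//; case: (cid2 e) => j' /= _ <-.
    by rewrite FE; exists (A j') => //; rewrite setTI.
  have := indep (map idx l') E _ FEi; rewrite map_inj_uniq// => /(_ ull').
  rewrite big_map => EP.
  have -> : \prod_(j <- l') P (Z j @^-1` A j) = \prod_(j <- l') P (E (idx j)).
    by rewrite big_seq [RHS]big_seq; apply: eq_bigr => j jl; rewrite EE.
  rewrite -EP.
  have mE : measurable (\bigcap_(i in [set` map idx l']) E i).
    apply: fin_bigcap_measurable => // i _; rewrite /E; case: pselect => [e|_]//; exact: mZA.
  rewrite -(setIT (\bigcap_(i in _) _)) -integral_indic//.
  rewrite le_eqVlt; apply/orP; left; apply/eqP; apply: eq_integral => t _; congr (_%:E).
  rewrite big_nil mul1r indicE.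
  case: (boolP (t \in _)) => [/set_mem tE|tE].
    rewrite big_seq big1// => j jl; rewrite indicE mem_set// -EE//.
    by apply: tE => /=; apply: map_f.
  have [j jl jA] : exists2 j, j \in l' & ~ (Z j @^-1` A j) t.
    apply: contrapT => H; move/negP: tE; apply; apply/mem_set => i /= /mapP[j jl ->].
    rewrite EE//; apply: contrapT => jA; apply: H; by exists j.
  by rewrite (big_rem j)//= indicE memNset// mul0r.
move: ul => /andP[jl ul].
pose W1 t : R := (\prod_(j <- l) g j (Z j t) * \prod_(j <- l') \1_(Z j @^-1` A j) t)%R.
pose c : R := (\prod_(j <- l') fine (P (Z j @^-1` A j)))%R.
have c0 : (0 <= c)%R by apply: prodr_ge0 => k _; rewrite fine_ge0.
have cE : c%:E = \prod_(j <- l') P (Z j @^-1` A j).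
  rewrite /c -prodEFin; apply: eq_bigr => k _; rewrite fineK// fin_num_measure//.
  exact: mZA.
have W1m : measurable_fun setT W1 by apply: measurable_funM; [exact: mprod|exact: mind].
have W10 t : (0 <= W1 t)%R.
  by rewrite mulr_ge0// prodr_ge0.
have -> : \int[P]_t (\prod_(j0 <- j :: l) g j0 (Z j0 t) *
    \prod_(j0 <- l') \1_(Z j0 @^-1` A j0) t)%:E = \int[P]_t (W1 t * g j (Z j t))%:E.
  by apply: eq_integral => t _; rewrite big_cons /W1; congr (_%:E); ring.
apply: (@le_trans _ _ (\int[P]_t (c * g j (Z j t))%:E)); last first.
  under eq_integral do rewrite EFinM.
  rewrite ge0_integralZl//.
  - rewrite -cE -[leRHS]mule1; apply: lee_wpmul2l; rewrite ?lee_fin//.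
  - by apply/measurable_EFinP; apply: measurableT_comp.
  - by move=> t _; rewrite lee_fin.
apply: (@le_integral_comp _ _ _ _ _ P W1 (fun=> c) (Z j) (g j)) => // B mB.
pose A' k := if k == j then B else A k.
have A'l' : forall k, k \in l' -> A' k = A k.
  move=> k kl; rewrite /A'; case: eqP => // kj.
  by move: ull'; rewrite mem_cat -kj kl orbT.
have ull2 : uniq (l ++ j :: l') by rewrite -cat1s uniq_catCA.
have mA' k : measurable (A' k) by rewrite /A'; case: ifP.
have H := IH ul (j :: l') A' ull2 mA'.
rewrite (integral_in_indic W1).
apply: (@le_trans _ _ (\int[P]_t (\prod_(j0 <- l) g j0 (Z j0 t) *
    \prod_(j0 <- j :: l') \1_(Z j0 @^-1` A' j0) t)%:E)).
  rewrite le_eqVlt; apply/orP; left; apply/eqP.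
  apply: eq_integral => t _; rewrite big_cons {1}/A' eqxx /W1; congr (_%:E).
  have -> : (\prod_(j0 <- l') \1_(Z j0 @^-1` A' j0) t = \prod_(j0 <- l') \1_(Z j0 @^-1` A j0) t :> R)%R.
    by rewrite big_seq [RHS]big_seq; apply: eq_bigr => k kl; rewrite A'l'.
  ring.
apply: (le_trans H); rewrite big_cons {1}/A' eqxx.
have -> : \prod_(j0 <- l') P (Z j0 @^-1` A' j0) = c%:E.
  by rewrite cE big_seq [RHS]big_seq; apply: eq_bigr => k kl; rewrite A'l'.
rewrite integral_cst; last exact: mZA.
by rewrite muleC.
Qed.
End Independence.

(** * The regression function as an orthogonal projection *)

Section Expectation.
Context {dT : measure_display} {T : measurableType dT} {R : realType} (P : probability T R).
Implicit Types f g : T -> R.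

Definition integrableR f := P.-integrable setT (EFin \o f).

Lemma integrableR_bounded f b : measurable_fun setT f -> (forall t, `|f t| <= b) -> integrableR f.
Proof.
move=> mf fb; apply: measurable_bounded_integrable => //.
  by rewrite (le_lt_trans (probability_le1 P _))// ltry.
by exists b; split; [exact: num_real|move=> x bx t _; exact: le_trans (fb t) (ltW bx)].
Qed.

Lemma integrableR_measurable f : integrableR f -> measurable_fun setT f.
Proof. by move=> /integrableP[/measurable_EFinP]. Qed.

Lemma integrableR_le f g : measurable_fun setT f -> (forall t, `|f t| <= `|g t|) ->
  integrableR g -> integrableR f.
Proof.
move=> mf fg; apply: le_integrable => //; first exact/measurable_EFinP.
by move=> t _ /=; rewrite lee_fin.
Qed.

Lemma integrableRD f g : integrableR f -> integrableR g -> integrableR (fun t => f t + g t).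
Proof. by move=> fi gi; exact: (integrableD measurableT fi gi). Qed.

Lemma integrableRZ c f : integrableR f -> integrableR (fun t => c * f t).
Proof. by move=> fi; exact: (integrableZl measurableT c fi). Qed.

Lemma integrableRB f g : integrableR f -> integrableR g -> integrableR (fun t => f t - g t).
Proof. by move=> fi gi; exact: (integrableB measurableT fi gi). Qed.

Lemma integral_EFin f : integrableR f -> (\int[P]_t (f t)%:E)%E = (\int[P]_t f t)%:E.
Proof. by move=> fi; rewrite /Rintegral fineK//; exact: (integrable_fin_num measurableT fi). Qed.

Lemma Rintegral_cst1 (c : R) : \int[P]_t c = c.
Proof. have := Rintegral_cst P measurableT c; have := probability_setT P => /= ->.
by rewrite mulr1. Qed.
End Expectation.

Section Regression.
Context {dT : measure_display} {T : measurableType dT} {R : realType} (P : probability T R).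
Context {d : nat} (X : {RV P >-> d.-tuple R}) (Y : {RV P >-> R}) (m : d.-tuple R -> R) (Mm : R).
Context (regr : regression_function X Y m) (mM : forall x, `|m x| <= Mm)
  (Yint : integrableR P Y).

Let m_meas : measurable_fun setT m. Proof. by case: regr. Qed.

Let mX_meas : measurable_fun setT (m \o X).
Proof. exact: measurableT_comp. Qed.

Let Vint : integrableR P (fun t => Y t - m (X t)).
Proof.
by apply: integrableRB => //; apply: (@integrableR_bounded _ _ _ _ _ Mm) => //; exact: mX_meas.
Qed.

Let Vm : measurable_fun setT (fun t => Y t - m (X t)).
Proof. exact: integrableR_measurable Vint. Qed.

Let V_event A : measurable A -> \int[P]_t ((Y t - m (X t)) * \1_(X @^-1` A) t) = 0.
Proof.
move=> mA.
have mXA : measurable (X @^-1` A) by rewrite -[X in measurable X]setTI; exact: measurable_funPT.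
have i1 f : integrableR P f -> integrableR P (fun t => f t * \1_(X @^-1` A) t).
  move=> fi; apply: (integrableR_le _ _ fi).
    by apply: measurable_funM; [exact: integrableR_measurable fi|exact: measurable_indic].
  by move=> t; rewrite normrM ler_piMr// indicE; case: (_ \in _); rewrite ?normr1 ?normr0.
have mXint : integrableR P (m \o X) by exact: (@integrableR_bounded _ _ _ _ _ Mm mX_meas (fun t => mM (X t))).
have [_ _ /(_ A mA)] := regr.
rewrite integral_pushforward//; first last.
- by apply: (integrableS measurableT) => //; exact: mXint.
- exact/measurable_EFinP.
rewrite integral_in_indic.
have -> : (\int[P]_(t in X @^-1` A) ((fun x => (m x)%:E) \o X) t = \int[P]_t (m (X t) * \1_(X @^-1` A) t)%:E)%E.
  exact: (integral_in_indic P (m \o X)).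
rewrite (integral_EFin (i1 _ Yint)) (integral_EFin (i1 _ mXint)) => -[E].
under eq_Rintegral do rewrite mulrBl.
by rewrite RintegralB ?E ?subrr//; apply: i1.
Qed.

(** The positive and negative parts of the residual have equal integrals over all
    events of the design, hence also against all bounded functions of it. *)
Lemma regression_orthogonal (u : d.-tuple R -> R) (b : R) :
  measurable_fun setT u -> (forall x, `|u x| <= b) ->
  integrableR P (fun t => (Y t - m (X t)) * u (X t)) /\
  \int[P]_t ((Y t - m (X t)) * u (X t)) = 0.
Proof.
move=> mu ub.
have mX : measurable_fun setT X by exact: measurable_funPT.
have b0 : 0 <= b by exact: le_trans (ub (X point)).
pose V t := Y t - m (X t).
pose Vp t : R := Num.max (V t) 0; pose Vn t : R := Num.max (- V t) 0.
have Vpn t : V t = Vp t - Vn t.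
  by rewrite /Vp /Vn; case: (leP (V t) 0) => V0; case: (leP (- V t) 0) => V1; lra.
have Vp0 t : 0 <= Vp t by rewrite /Vp le_max lexx orbT.
have Vn0 t : 0 <= Vn t by rewrite /Vn le_max lexx orbT.
have mVp : measurable_fun setT Vp by apply: measurable_maxr.
have mVn : measurable_fun setT Vn by apply: measurable_maxr => //; exact: measurableT_comp.
have pint (f : T -> R) : measurable_fun setT f -> (forall t, `|f t| <= `|V t|) -> integrableR P f.
  by move=> mf fV; apply: (integrableR_le mf fV).
have Vpi : integrableR P Vp.
  apply: pint => // t; rewrite /Vp; case: (leP (V t) 0) => // V0.
  by rewrite normr0.
have Vni : integrableR P Vn.
  apply: pint => // t; rewrite /Vn; case: (leP (- V t) 0) => // V0.
    by rewrite normr0.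
  by rewrite normrN.
have bint (f g : T -> R) : integrableR P f -> measurable_fun setT g -> (exists c : R, forall t, `|g t| <= c) ->
    integrableR P (fun t => f t * g t).
  move=> fi mg [c gc]; apply: (integrableR_le _ _ (integrableRZ c fi)).
    by apply: measurable_funM => //; exact: integrableR_measurable fi.
  have c0 : 0 <= c by exact: le_trans (gc point).
  by move=> t; rewrite !normrM mulrC (ger0_norm c0) ler_wpM2r.
have H A : measurable A ->
    (\int[P]_(t in X @^-1` A) (Vp t)%:E = \int[P]_(t in X @^-1` A) (Vn t)%:E)%E.
  move=> mA; rewrite (integral_in_indic P Vp) (integral_in_indic P Vn).
  have mXA : measurable (X @^-1` A) by rewrite -[X in measurable X]setTI; exact: measurable_funPT.
  have i1 f : integrableR P f -> integrableR P (fun t => f t * \1_(X @^-1` A) t).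
    move=> fi; apply: bint => //.
    by exists 1 => t; rewrite indicE; case: (_ \in _); rewrite ?normr1 ?normr0.
  rewrite (integral_EFin (i1 _ Vpi)) (integral_EFin (i1 _ Vni)); congr (_%:E).
  apply/eqP; rewrite -subr_eq0 -(RintegralB measurableT (i1 _ Vpi) (i1 _ Vni)); apply/eqP.
  rewrite -[RHS](V_event mA); apply: eq_Rintegral => t _.
  by rewrite -mulrBl -Vpn.
have mub : measurable_fun setT (fun x => u x + b) by exact: measurable_funD.
have ub0 x : 0 <= u x + b by have /ler_normlP[] := ub x; lra.
have := eq_integral_comp mVp mVn Vp0 Vn0 mX mub ub0 H.
have muX : measurable_fun setT (fun t => u (X t)) by exact: (measurableT_comp mu mX).
have uXb : exists c : R, forall t, `|u (X t)| <= c by exists b.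
have mubX : measurable_fun setT (fun t => u (X t) + b) by exact: measurable_funD.
have ubXb : exists c : R, forall t, `|u (X t) + b| <= c.
  by exists (b + b) => t; rewrite (le_trans (ler_normD _ _))// lerD// ger0_norm.
have Vi : integrableR P V by exact: Vint.
have iu : integrableR P (fun t => V t * u (X t)) by exact: bint.
rewrite (integral_EFin (bint _ _ Vpi mubX ubXb)) (integral_EFin (bint _ _ Vni mubX ubXb)) => -[E].
split=> //.
have E0 : \int[P]_t V t = 0.
  rewrite -[RHS](V_event measurableT); apply: eq_Rintegral => t _.
  by rewrite indicE mem_set// mulr1.
have : \int[P]_t (V t * (u (X t) + b)) = 0.
  under eq_Rintegral do rewrite Vpn mulrBl.
  by rewrite (RintegralB measurableT (bint _ _ Vpi mubX ubXb) (bint _ _ Vni mubX ubXb)) E subrr.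
under eq_Rintegral do rewrite mulrDr [X in _ + X]mulrC.
rewrite (RintegralD measurableT iu (integrableRZ b Vi)) (RintegralZl b measurableT Vi) E0.
by rewrite mulr0 addr0.
Qed.
End Regression.

(** * Deviations for finitely many functions *)

Section Truncation.
Context {R : realType}.
Implicit Types b y z : R.

Lemma truncate_norm_le b z : 0 <= b -> `|truncate b z| <= b.
Proof.
move=> b0; rewrite /truncate ler_norml le_max lexx/= ge_max ge_min lexx/=.
by rewrite andbT; lra.
Qed.

Lemma truncate_id b y : `|y| <= b -> truncate b y = y.
Proof.
rewrite ler_norml => /andP[y1 y2]; rewrite /truncate.
by rewrite (min_idPr y2) (max_idPr y1).
Qed.

Lemma truncate_dist b y z : 0 <= b -> `|truncate b y - truncate b z| <= `|y - z|.
Proof.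
move=> b0; rewrite /truncate.
wlog yz : y z / z <= y.
  move=> H; case: (leP z y) => [|/ltW]; first exact: H.
  by move=> yz; rewrite distrC (distrC y); exact: H.
rewrite [leRHS]ger0_norm ?subr_ge0// ler_norml /Order.max /Order.min.
by case: (ltP b y) => ?; case: (ltP b z) => ?; do ![case: ltP => ?]; apply/andP; split; lra.
Qed.

Lemma measurable_truncate b : measurable_fun setT (@truncate R b).
Proof.
apply: measurable_maxr => //; exact: measurable_minr.
Qed.

(** From [exp (- x) >= 1 - x], since [(1 - x) (1 + x + 2 x^2) >= 1] exactly when
    [x^2 (1 - 2 x) >= 0]. *)
Lemma expR_le_quadratic (x : R) : x <= 2^-1 -> expR x <= 1 + x + 2 * x ^+ 2.
Proof.
move=> x2; have := expR_ge1Dx (- x) => H.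
have e0 := expR_gt0 (- x).
rewrite -[x in expR x]opprK expRN -[leRHS]invrK lef_pV2 ?posrE//; last first.
  by rewrite invr_gt0; nra.
apply: le_trans H; rewrite -div1r ler_pdivrMr; last by nra.
have : 0 <= x ^+ 2 * (1 - 2 * x) by rewrite mulr_ge0 ?sqr_ge0//; lra.
by rewrite expr2; nra.
Qed.
End Truncation.

Section Deviation.
Context {dT : measure_display} {T : measurableType dT} {R : realType} (P : probability T R).
Context {d : nat} (X : {RV P >-> d.-tuple R}) (Y : {RV P >-> R}) (m : d.-tuple R -> R)
  (beta eta : R).
Context (regr : regression_function X Y m) (beta_gt0 : 0 < beta)
  (m_le : forall x, `|m x| <= beta) (Yint : integrableR P Y)
  (eta_ge : \int[P]_t `|Y t - truncate beta (Y t)| <= eta).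

(** The response is truncated, so that the gap is bounded whenever [f] is. *)
Definition loss_gap (f : d.-tuple R -> R) (z : d.-tuple R * R) : R :=
  (truncate beta z.2 - f z.1) ^+ 2 - (truncate beta z.2 - m z.1) ^+ 2.

Definition l2_dist2 (f : d.-tuple R -> R) : R := \int[P]_t (f (X t) - m (X t)) ^+ 2.

(** The exponent of the Chernoff argument; it is so small that the quadratic term
    of the exponential is absorbed by a fraction of the mean. *)
Definition tilt : R := (64 * beta ^+ 2)^-1.

Let m_meas : measurable_fun setT m. Proof. by case: regr. Qed.

Lemma measurable_loss_gap f : measurable_fun setT f -> measurable_fun setT (loss_gap f).
Proof.
move=> mf; apply: measurable_funB; apply: measurable_funX; apply: measurable_funB.
- by apply: measurableT_comp => //; exact: measurable_truncate.
- exact: measurableT_comp.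
- by apply: measurableT_comp => //; exact: measurable_truncate.
- exact: measurableT_comp.
Qed.

Lemma loss_gap_sub f g z : `|truncate beta z.2 - f z.1| <= 2 * beta ->
  `|truncate beta z.2 - g z.1| <= 2 * beta ->
  `|loss_gap f z - loss_gap g z| <= 4 * beta * `|f z.1 - g z.1|.
Proof.
move=> fb gb; rewrite /loss_gap.
have -> : (truncate beta z.2 - f z.1) ^+ 2 - (truncate beta z.2 - m z.1) ^+ 2 -
    ((truncate beta z.2 - g z.1) ^+ 2 - (truncate beta z.2 - m z.1) ^+ 2) =
  ((truncate beta z.2 - f z.1) + (truncate beta z.2 - g z.1)) * (g z.1 - f z.1) by ring.
rewrite normrM distrC ler_wpM2r//; apply: (le_trans (ler_normD _ _)); lra.
Qed.

Section OneFunction.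
Context (f : d.-tuple R -> R) (f_meas : measurable_fun setT f)
  (f_le : forall x, `|f x| <= beta).

(** The variance of the loss gap is controlled by its mean, the squared
    distance to the regression function; this is why the tilted loss gap has a
    mean of at most one, and it yields fast rates. *)
Lemma loss_gap_mgf tau : `|tau| = tilt ->
  (\int[P]_t (expR (tau * loss_gap f (X t, Y t)
     - ((tau + tilt / 2) * l2_dist2 f + 4 * tilt * beta * eta)))%:E <= 1)%E.
Proof.
move=> tauE.
have b2 : 0 < beta ^+ 2 by rewrite exprn_gt0.
have s0 : 0 < tilt by rewrite /tilt invr_gt0 mulr_gt0.
have sb : tilt * beta ^+ 2 = 64^-1.
  by rewrite /tilt; field; rewrite gt_eqF.
set Z := fun t => loss_gap f (X t, Y t).
pose D t := f (X t) - m (X t).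
pose V t := truncate beta (Y t) - m (X t).
have ZE t : Z t = D t ^+ 2 - 2 * (V t * D t) by rewrite /Z /loss_gap/= /V /D; ring.
have Db t : `|D t| <= 2 * beta.
  by rewrite (le_trans (ler_normB _ _))// mulr2n mulrDl mul1r lerD.
have Vb t : `|V t| <= 2 * beta.
  rewrite (le_trans (ler_normB _ _))// mulr2n mulrDl mul1r lerD//.
  by rewrite truncate_norm_le// ltW.
(* The square of the gap is bounded by a multiple of the squared distance, not
   merely by a constant. *)
have Zsq t : Z t ^+ 2 <= 16 * beta ^+ 2 * D t ^+ 2.
  have E : Z t = - D t * (2 * truncate beta (Y t) - f (X t) - m (X t)).
    by rewrite /Z /loss_gap/= /D; ring.
  have B : `|2 * truncate beta (Y t) - f (X t) - m (X t)| <= 4 * beta.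
    have := truncate_norm_le (Y t) (ltW beta_gt0); have := f_le (X t); have := m_le (X t).
    rewrite !ler_norml => /andP[? ?] /andP[? ?] /andP[? ?]; apply/andP; split; lra.
  rewrite E exprMn sqrrN mulrC ler_wpM2r ?sqr_ge0//.
  have -> : 16 * beta ^+ 2 = (4 * beta) ^+ 2 by ring.
  by rewrite -(real_normK (num_real (_ - m (X t)))) lerXn2r ?nnegrE// mulr_ge0// ltW.
have Zb t : `|Z t| <= 8 * beta ^+ 2.
  have -> : 8 * beta ^+ 2 = `|8 * beta ^+ 2| by rewrite ger0_norm// mulr_ge0// ltW.
  rewrite -ler_sqr ?nnegrE// !real_normK ?num_real//.
  apply: (le_trans (Zsq t)).
  have : D t ^+ 2 <= 4 * beta ^+ 2.
    have -> : 4 * beta ^+ 2 = (2 * beta) ^+ 2 by ring.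
    by rewrite -(real_normK (num_real (D t))) lerXn2r ?nnegrE// mulr_ge0// ltW.
  rewrite exprMn; nra.
pose G t := 1 + ((tau + tilt / 2) * D t ^+ 2 - 2 * tau * (V t * D t)).
have eG t : expR (tau * Z t) <= G t.
  have tz : tau * Z t <= 2^-1.
    apply: (le_trans (ler_norm _)); rewrite normrM tauE.
    have := ler_wpM2l (ltW s0) (Zb t); lra.
  apply: (le_trans (expR_le_quadratic tz)); rewrite /G ZE.
  have : 2 * (tau * Z t) ^+ 2 <= tilt / 2 * D t ^+ 2.
    rewrite exprMn -(real_normK (num_real tau)) tauE.
    have H1 := ler_wpM2l (sqr_ge0 tilt) (Zsq t).
    have H2 : tilt ^+ 2 * (16 * beta ^+ 2 * D t ^+ 2) = tilt / 4 * D t ^+ 2.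
      have -> : tilt ^+ 2 * (16 * beta ^+ 2 * D t ^+ 2) = (tilt * beta ^+ 2) * (16 * tilt * D t ^+ 2) by ring.
      by rewrite sb; field.
    move: H1; rewrite H2; lra.
  rewrite ZE; lra.
have mX : measurable_fun setT X by exact: measurable_funPT.
have mfX : measurable_fun setT (fun t => f (X t)) by exact: (measurableT_comp f_meas mX).
have mmX : measurable_fun setT (fun t => m (X t)) by exact: (measurableT_comp m_meas mX).
have mD : measurable_fun setT D by exact: measurable_funB.
have mTY : measurable_fun setT (fun t => truncate beta (Y t)).
  exact: (measurableT_comp (@measurable_truncate R beta)).
have mV : measurable_fun setT V by exact: measurable_funB.
have iD2 : integrableR P (fun t => D t ^+ 2).
  apply: (@integrableR_bounded _ _ _ _ _ ((2 * beta) ^+ 2)); first exact: measurable_funX.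
  by move=> t; rewrite normrX lerXn2r ?nnegrE// mulr_ge0// ltW.
have iVD : integrableR P (fun t => V t * D t).
  apply: (@integrableR_bounded _ _ _ _ _ (2 * beta * (2 * beta))); first exact: measurable_funM.
  by move=> t; rewrite normrM ler_pM.
have iG : integrableR P G.
  apply: integrableRD; first by apply: (@integrableR_bounded _ _ _ _ _ 1) => // t; rewrite normr1.
  by apply: integrableRB; exact: integrableRZ.
(* For the untruncated response this integral vanishes; truncation costs [eta]. *)
have Q : `|\int[P]_t (V t * D t)| <= 2 * beta * eta.
  have [iO O] := regression_orthogonal regr m_le Yint
    (measurable_funB f_meas m_meas) (fun x => le_trans (ler_normB _ _) (lerD (f_le x) (m_le x))).
  have iT : integrableR P (fun t => Y t - truncate beta (Y t)).
    apply: integrableRB => //; apply: (@integrableR_bounded _ _ _ _ _ beta) => // t.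
    by rewrite truncate_norm_le// ltW.
  have iE : integrableR P (fun t => (truncate beta (Y t) - Y t) * D t).
    apply: (integrableR_le _ _ (integrableRZ (2 * beta) iT)).
      by apply: measurable_funM => //; apply: measurable_funB.
    move=> t; rewrite !normrM distrC mulrC ler_wpM2r//.
    by rewrite (le_trans (Db t))// !ger0_norm// ltW.
  have -> : \int[P]_t (V t * D t) = \int[P]_t ((truncate beta (Y t) - Y t) * D t).
    have := RintegralD measurableT iE iO; rewrite O addr0 => <-.
    by apply: eq_Rintegral => t _; rewrite /V /D /=; ring.
  apply: (le_trans (le_normr_Rintegral measurableT iE)).
  apply: (@le_trans _ _ (\int[P]_t (2 * beta * `|Y t - truncate beta (Y t)|))).
    apply: le_Rintegral => //.
    + exact: (integrable_abse iE).
    + apply: integrableRZ; exact: (integrable_abse iT).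
    + by move=> t _; rewrite normrM distrC mulrC ler_wpM2r.
  rewrite (RintegralZl (2 * beta) measurableT (integrable_abse iT)).
  by rewrite ler_wpM2l// mulr_ge0// ltW.
set c := (_ + 4 * tilt * beta * eta).
have i1 : integrableR P (fun=> 1 : R).
  by apply: (@integrableR_bounded _ _ _ _ _ 1) => // t; rewrite normr1.
have EG : \int[P]_t G t <= 1 + c.
  rewrite (RintegralD measurableT i1 (integrableRB (integrableRZ _ iD2) (integrableRZ _ iVD))).
  rewrite Rintegral_cst1 lerD2l.
  rewrite (RintegralB measurableT (integrableRZ _ iD2) (integrableRZ _ iVD)).
  rewrite (RintegralZl _ measurableT iD2) (RintegralZl _ measurableT iVD) /c lerD2l.
  apply: (le_trans (ler_norm _)); rewrite normrN !normrM tauE ger0_norm//.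
  have := ler_wpM2l (ltW s0) Q; lra.
have mZ : measurable_fun setT Z.
  by apply: measurable_funB; apply: measurable_funX; exact: measurable_funB.
have mE : measurable_fun setT (fun t => expR (tau * Z t - c)).
  apply: measurableT_comp => //; apply: measurable_funB => //; exact: measurable_funM.
apply: (@le_trans _ _ (\int[P]_t (expR (- c) * G t)%:E)%E).
  apply: ge0_le_integral => //.
  - exact/measurable_EFinP.
  - by apply/measurable_EFinP/measurable_funM => //; exact: integrableR_measurable iG.
  - move=> t _; rewrite lee_fin addrC expRD ler_wpM2l ?expR_ge0//; exact: eG.
rewrite (integral_EFin (integrableRZ _ iG)) (RintegralZl _ measurableT iG) lee_fin.
rewrite expRN ler_pdivrMl ?expR_gt0// mulr1; apply: (le_trans EG); exact: expR_ge1Dx.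
Qed.
End OneFunction.

(** Union bound over finitely many functions, in expectation form: the excess
    [S] has a bounded mean, and the number of functions enters through its
    logarithm.  It rests on [1 + x <= exp x], applied to the exponents reduced
    by that logarithm. *)
Lemma uniform_deviation (n : nat) (Xs : 'I_n -> {RV P >-> d.-tuple R})
    (Ys : 'I_n -> {RV P >-> R}) (Code : finType) (fam : Code -> d.-tuple R -> R) :
  (0 < n)%N ->
  (forall g : d.-tuple R * R -> R, measurable_fun setT g -> (forall z, 0 <= g z) ->
     (\int[P]_t (g (X t, Y t))%:E <= 1)%E ->
     (\int[P]_t (\prod_(i < n) g (Xs i t, Ys i t))%:E <= 1)%E) ->
  (forall c, measurable_fun setT (fam c)) -> (forall c x, `|fam c x| <= beta) ->
  exists S : T -> R, [/\ measurable_fun setT S, forall t, 0 <= S t,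
    (\int[P]_t (S t)%:E <= 2%:E)%E &
    forall t c, let Z := n%:R^-1 * \sum_i loss_gap (fam c) (Xs i t, Ys i t) in
      l2_dist2 (fam c) <= 2 * Z + 2 / (n%:R * tilt) * (ln #|Code|%:R + S t) + 8 * beta * eta /\
      Z <= 3 / 2 * l2_dist2 (fam c) + (n%:R * tilt)^-1 * (ln #|Code|%:R + S t) + 4 * beta * eta].
Proof.
move=> n0 indep mfam famb.
have b2 : 0 < beta ^+ 2 by rewrite exprn_gt0.
have s0 : 0 < tilt by rewrite /tilt invr_gt0 mulr_gt0.
have [N0|N0] := posnP #|Code|.
  exists (fun=> 0); split=> //.
    by under eq_integral do rewrite (_ : 0%:E = 0%E)//; rewrite integral0 lee_fin.
  by move=> t c; have := card0_eq N0 c.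
pose q tau c := (tau + tilt / 2) * l2_dist2 (fam c) + 4 * tilt * beta * eta.
pose g tau c z := expR (tau * loss_gap (fam c) z - q tau c).
pose E tau c t : R := \prod_(i < n) g tau c (Xs i t, Ys i t).
have mg tau c : measurable_fun setT (g tau c).
  apply: measurableT_comp => //; apply: measurable_funB => //; apply: measurable_funM => //.
  exact: measurable_loss_gap.
have E0 tau c t : 0 <= E tau c t by rewrite prodr_ge0// => i _; exact: expR_ge0.
have mE tau c : measurable_fun setT (E tau c).
  apply: measurable_prod => i _; apply: measurableT_comp => //.
  by apply: measurable_fun_pair; exact: measurable_funPT.
have E1 tau c : `|tau| = tilt -> (\int[P]_t (E tau c t)%:E <= 1)%E.
  move=> tauE; apply: (indep (g tau c)) => //; first by move=> z; exact: expR_ge0.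
  exact: loss_gap_mgf.
have tN : `|- tilt| = tilt by rewrite normrN gtr0_norm.
have tP : `|tilt| = tilt by rewrite gtr0_norm.
have NR : 0 < (#|Code|%:R : R) by rewrite ltr0n.
(* The two signs of the exponent yield the two inequalities of the claim. *)
pose S t : R := #|Code|%:R^-1 * \sum_c (E (- tilt) c t + E tilt c t).
have S0 t : 0 <= S t.
  by rewrite mulr_ge0 ?invr_ge0// sumr_ge0// => c _; rewrite addr_ge0.
exists S; split => //.
- apply: measurable_funM => //; apply: measurable_sum => c; exact: measurable_funD.
- have -> : (\int[P]_t (S t)%:E = #|Code|%:R^-1%:E *
      \sum_(c : Code) (\int[P]_t (E (- tilt) c t)%:E + \int[P]_t (E tilt c t)%:E))%E.
    under eq_integral do rewrite EFinM -sumEFin.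
    rewrite ge0_integralZl//.
    + congr (_ * _)%E; rewrite ge0_integral_sum//.
      * apply: eq_bigr => c _; under eq_integral do rewrite EFinD.
        by rewrite ge0_integralD//; try (by move=> t _; rewrite lee_fin); exact/measurable_EFinP.
      * by move=> c; apply/measurable_EFinP; exact: measurable_funD.
      * by move=> c t _; rewrite lee_fin addr_ge0.
    + by apply: emeasurable_sum => c; apply/measurable_EFinP; exact: measurable_funD.
    + by move=> t _; apply: sume_ge0 => c _; rewrite lee_fin addr_ge0.
  have -> : 2%:E = (#|Code|%:R^-1%:E * (#|Code|%:R * 2)%:E)%E :> \bar R.
    by rewrite -EFinM mulKf// gt_eqF.
  apply: lee_wpmul2l; first by rewrite lee_fin invr_ge0.
  apply: (@le_trans _ _ (\sum_(c : Code) 2%:E)%E).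
    apply: lee_sum => c _; have -> : 2%:E = (1 + 1)%E :> \bar R by rewrite -EFinD.
    by apply: leeD; apply: E1.
  by rewrite sumEFin sumr_const mulr_natl lee_fin.
move=> t c Z.
pose W tau := \sum_(i < n) (tau * loss_gap (fam c) (Xs i t, Ys i t) - q tau c).
have WE tau : W tau = n%:R * (tau * Z - q tau c).
  rewrite /W sumrB -mulr_sumr sumr_const card_ord -[_ *+ n]mulr_natl /Z mulrBr.
  by congr (_ - _); rewrite mulrCA [n%:R * _]mulrA divff ?mul1r// pnatr_eq0 -lt0n.
have EE tau : E tau c t = expR (W tau) by rewrite /E /g -expR_sum.
have SE tau : (tau = tilt \/ tau = - tilt) -> W tau <= ln #|Code|%:R + S t.
  move=> tt; rewrite -lerBlDl.
  apply: (@le_trans _ _ (expR (W tau - ln #|Code|%:R))).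
    by apply: le_trans (expR_ge1Dx _); rewrite lerDr.
  rewrite expRD expRN lnK ?posrE// mulrC -EE /S ler_wpM2l ?invr_ge0//.
  rewrite (bigD1 c)//=; apply: (@le_trans _ _ (E (- tilt) c t + E tilt c t)).
    by case: tt => ->; rewrite ?lerDl ?lerDr.
  by rewrite lerDl sumr_ge0// => c' _; rewrite addr_ge0.
have n0' : 0 < (n%:R : R) by rewrite ltr0n.
have k0 : 0 < n%:R * tilt by rewrite mulr_gt0.
have A1 := SE _ (or_introl erefl); have A2 := SE _ (or_intror erefl).
move: A1 A2; rewrite !WE /q; set D := l2_dist2 _; set B := ln _ + S t => A1 A2.
have k0' : n%:R * tilt != 0 by rewrite gt_eqF.
split.
  rewrite -(ler_pM2l (_ : 0 < n%:R * tilt / 2)); last by rewrite divr_gt0.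
  have -> : n%:R * tilt / 2 * (2 * Z + 2 / (n%:R * tilt) * B + 8 * beta * eta) =
     n%:R * tilt * Z + B + 4 * (n%:R * tilt * beta * eta).
    by field; rewrite !gt_eqF.
  move: A2; lra.
rewrite -(ler_pM2l k0).
have -> : n%:R * tilt * (3 / 2 * D + (n%:R * tilt)^-1 * B + 4 * beta * eta) =
   3 / 2 * (n%:R * tilt * D) + B + 4 * (n%:R * tilt * beta * eta).
  by field; rewrite !gt_eqF.
move: A1; lra.
Qed.
End Deviation.

(** * Support, measurability and the sample *)

Section Support.
Context {R : realType} {d : nat} (mu : {measure set (d.-tuple R) -> \bar R}).

Let box (x : 'I_d -> R) (e : R) : set (d.-tuple R) :=
  [set y | forall i, `|tnth y i - x i| < e].

Let measurable_box x e : measurable (box x e).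
Proof.
have -> : box x e = \bigcap_(i in [set: 'I_d]) ((fun y => tnth y i) @^-1` `]x i - e, x i + e[).
  apply/seteqP; split=> y H i; first by move=> _ /=; rewrite in_itv/= -ltr_distl; exact: H.
  by have := H i I; rewrite /= in_itv/= -ltr_distl.
apply: fin_bigcap_measurable => // i _; rewrite -[X in measurable X]setTI.
exact: measurable_tnth.
Qed.

(** The complement of the support is covered by the countably many null boxes
    with rational data. *)
Lemma law_support_negligible : mu.-negligible (~` law_support mu).
Proof.
pose I := ({ffun 'I_d -> rat} * nat)%type.
pose b (i : I) := box (fun j => ratr (i.1 j)) (i.2.+1%:R^-1).
pose F n := if (choice.unpickle n : option I) is Some i then (if mu (b i) == 0%E then b i else set0) else set0.
apply: (@negligibleS _ _ _ _ (\bigcup_n F n)); last first.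
  apply: negligible_bigcup => n; rewrite /F; case: choice.unpickle => [i|]; last exact: negligible_set0.
  case: eqP => [i0|_]; last exact: negligible_set0.
  by exists (b i); split => //; exact: measurable_box.
move=> x nx; apply: contrapT => nF; apply: nx => e e0.
have [k ke] : exists k : nat, 2 * (k.+1%:R^-1 : R) <= e.
  exists (Num.bound (2 / e)).
  have := archi_boundP (_ : 0 <= 2 / e); rewrite divr_ge0 ?(ltW e0)// => /(_ isT) H.
  rewrite ler_pdivrMr// -ler_pdivrMl// mulrC.
  by rewrite (le_trans (ltW H))// ler_nat.
have k0 : 0 < (k.+1%:R^-1 : R) by rewrite invr_gt0.
have /choice[q qP] : forall j : 'I_d, exists q : rat, `|tnth x j - ratr q| < k.+1%:R^-1.
  move=> j; have jj : tnth x j - k.+1%:R^-1 < tnth x j + k.+1%:R^-1 by rewrite ltrBlDr -addrA ltrDl addr_gt0.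
  have [q] := rat_in_itvoo jj.
  by rewrite in_itv/= -ltr_distl distrC; exists q.
pose i : I := ([ffun j => q j], k).
have bx : b i x by move=> j /=; rewrite ffunE.
have sub : b i `<=` [set y | forall j, `|tnth y j - tnth x j| < e].
  move=> y yb j; apply: lt_le_trans ke.
  have := yb j; have := bx j; rewrite /=.
  have -> : tnth y j - tnth x j = (tnth y j - ratr ([ffun j => q j] j)) -
     (tnth x j - ratr ([ffun j => q j] j)) by ring.
  by move=> h1 h2; apply: (le_lt_trans (ler_normB _ _)); rewrite mulr2n mulrDl mul1r ltrD.
have : (mu (b i) != 0)%E.
  apply/eqP => bi0; apply: nF; exists (choice.pickle i) => //.
  by rewrite /F choice.pickleK bi0 eqxx.
rewrite -measure_gt0 => b0; apply: (lt_le_trans b0).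
apply: le_measure => //; rewrite inE; first exact: measurable_box.
exact: (measurable_box (tnth x) e).
Qed.
End Support.

Section Measurability.
Context {R : realType} {d L r : nat} (r_gt0 : (0 < r)%N).

Lemma measurable_logistic : measurable_fun setT (@logistic R).
Proof.
apply: continuous_measurable_fun => x.
by apply/differentiable_continuous/derivable1_diffP; case: (is_derive_logistic x).
Qed.

Lemma measurable_combination K (a : 'I_K -> R) (v : 'I_K -> inner_index d L r -> R) :
  measurable_fun setT (combination r_gt0 a v).
Proof.
apply: measurable_sum => k; apply: measurable_funM => //.
have H (v' : inner_index d L r -> R) l i : measurable_fun setT (fun x => layer v' x l i).
  elim: l i => [|l IH] i /=; apply: measurableT_comp (measurable_logistic) _;
    apply: measurable_funD => //; apply: measurable_sum => j; apply: measurable_funM => //.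
  exact: measurable_tnth.
exact: H.
Qed.
End Measurability.

Section Sample.
Context {dT : measure_display} {T : measurableType dT} {R : realType} (P : probability T R).
Context {d L r n K : nat} (X : {RV P >-> d.-tuple R}) (Y : {RV P >-> R})
  (Xs : 'I_n -> {RV P >-> d.-tuple R}) (Ys : 'I_n -> {RV P >-> R})
  (V : 'I_K -> inner_index d L r -> {RV P >-> R}).
Context (indep : mutually_independent P (sample_events X Y Xs Ys V))
  (same : forall i, same_law P (fun w => (Xs i w, Ys i w)) (fun w => (X w, Y w))).

Lemma sample_events0 i : sample_events X Y Xs Ys V i set0.
Proof.
have H (d' : measure_display) (S : measurableType d') (Z : T -> S) :
    generated_events Z set0 by exists set0 => //; rewrite preimage_set0 setI0.
by case: i => [[i|]|[k b]] /=; exact: H.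
Qed.

Let measurable_pair (A : {RV P >-> d.-tuple R}) (B : {RV P >-> R}) :
  measurable_fun setT (fun t => (A t, B t)).
Proof. by apply: measurable_fun_pair; exact: measurable_funPT. Qed.

Lemma same_law_integral i (g : d.-tuple R * R -> R) :
  measurable_fun setT g -> (forall z, 0 <= g z) ->
  (\int[P]_t (g (Xs i t, Ys i t))%:E = \int[P]_t (g (X t, Y t))%:E)%E.
Proof.
move=> mg g0.
have mg' : measurable_fun setT (EFin \o g) by exact/measurable_EFinP.
have E (A : {RV P >-> d.-tuple R}) (B : {RV P >-> R}) :
    (\int[P]_t (g (A t, B t))%:E =
     \int[pushforward P (fun t => (A t, B t))]_z (EFin \o g) z)%E.
  rewrite (ge0_integral_pushforward (measurable_pair A B))//.
  by move=> z _ /=; rewrite lee_fin.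
rewrite !E; apply: eq_measure_integral => A mA _; exact: same.
Qed.

Lemma sample_prod_le1 (g : d.-tuple R * R -> R) :
  measurable_fun setT g -> (forall z, 0 <= g z) ->
  (\int[P]_t (g (X t, Y t))%:E <= 1)%E ->
  (\int[P]_t (\prod_(i < n) g (Xs i t, Ys i t))%:E <= 1)%E.
Proof.
move=> mg g0 g1.
apply: (@independent_prod_le1 _ _ _ _ _ P _ (sample_events X Y Xs Ys V) 'I_n
  (fun i => inl (Some i)) (fun i t => (Xs i t, Ys i t)) (fun=> g) indep) => //.
- by move=> i j [].
- exact: sample_events0.
- by move=> i; exact: measurable_pair.
- by move=> i; rewrite same_law_integral.
- exact: index_enum_uniq.
Qed.
End Sample.

(** * Random initial weights *)

Section Initialization.
Context {dT : measure_display} {T : measurableType dT} {R : realType} (P : probability T R).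

(** One complement is introduced at a time: its probability is a difference of
    two products in which all other factors agree. *)
Lemma independent_complements (J : choiceType) (B : J -> set T) :
  (forall j, measurable (B j)) ->
  (forall s : seq J, uniq s ->
     P (\bigcap_(j in [set` s]) B j) = (\prod_(j <- s) fine (P (B j)))%:E) ->
  forall s : seq J, uniq s ->
    P (\bigcap_(j in [set` s]) ~` B j) = (\prod_(j <- s) (1 - fine (P (B j))))%:E.
Proof.
move=> mB indep s us.
suff : forall s' : seq J, uniq (s ++ s') ->
    P ((\bigcap_(j in [set` s]) ~` B j) `&` (\bigcap_(j in [set` s']) B j)) =
    (\prod_(j <- s) (1 - fine (P (B j))) * \prod_(j <- s') fine (P (B j)))%:E.
  move=> /(_ [::]); rewrite cats0 big_nil mulr1 => /(_ us) <-.
  by rewrite set_nil bigcap_set0 setIT.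
have mI (s0 : seq J) (C : J -> set T) : (forall j, measurable (C j)) ->
    measurable (\bigcap_(j in [set` s0]) C j).
  by move=> mC; apply: fin_bigcap_measurable.
elim: s us => [|j s IH] us s' ss'.
  by rewrite set_nil bigcap_set0 setTI big_nil mul1r indep.
move: us ss' => /= /andP[js us] /andP[jss' ss'].
have H1 := IH us s' ss'.
have H2 := IH us (j :: s') _.
have {}H2 := H2 (_ : uniq (s ++ j :: s')).
rewrite -cat1s uniq_catCA/= jss' ss' in H2; have {}H2 := H2 isT.
have cons_cap (C : J -> set T) (s0 : seq J) :
    \bigcap_(i in [set` j :: s0]) C i = C j `&` \bigcap_(i in [set` s0]) C i.
  apply/seteqP; split=> [t H|t [H3 H4] i /=]; first split.
  - by apply: H; rewrite /= mem_head.
  - by move=> i si; apply: H; rewrite /= in_cons si orbT.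
  - by rewrite in_cons => /orP[/eqP->//|si]; exact: H4.
rewrite cons_cap.
set C1 := \bigcap_(i in [set` s]) _ in H1 H2 *; set C2 := \bigcap_(i in [set` s']) _ in H1 *.
have mC1 : measurable C1 by apply: mI => i; exact: measurableC.
have mC2 : measurable C2 by exact: mI.
rewrite cons_cap -/C2 in H2.
have -> : ~` B j `&` C1 `&` C2 = (C1 `&` C2) `\` (C1 `&` (B j `&` C2)).
  apply/seteqP; split=> [t [[nB c1] c2]|t [[c1 c2] H]].
    by split=> // -[_ [bj _]].
  by split=> //; split=> // bj; apply: H.
have m12 : measurable (C1 `&` C2) by exact: measurableI.
have m1j2 : measurable (C1 `&` (B j `&` C2)) by do 2 apply: measurableI => //.
rewrite measureD//; last by rewrite (le_lt_trans (probability_le1 P m12))// ltry.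
have -> : C1 `&` C2 `&` (C1 `&` (B j `&` C2)) = C1 `&` (B j `&` C2).
  by apply/seteqP; split=> [t [_]|t [? [? ?]]].
transitivity ((\prod_(j0 <- s) (1 - fine (P (B j0))) * \prod_(j0 <- s') fine (P (B j0)))%:E -
  (\prod_(j0 <- s) (1 - fine (P (B j0))) * \prod_(j0 <- j :: s') fine (P (B j0)))%:E)%E.
  by congr (_ - _)%E.
rewrite -EFinB !big_cons; congr (_%:E); ring.
Qed.

(** When the target [c] is close to an end of the range, only one of the two
    neighbouring intervals of length [delta] lies in the range; one of them
    always does. *)
Lemma uniform_near_prob (Z : {RV P >-> R}) (rad c delta : R) :
  0 < delta -> delta <= rad -> `|c| <= rad -> uniformly_distributed Z (- rad) rad ->
  ((delta / (2 * rad))%:E <= P (Z @^-1` [set z | (`|z - c| <= delta)%R]))%E.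
Proof.
move=> d0 drad; rewrite ler_norml => /andP[c1 c2] [_ unif].
have rad0 : 0 < rad by lra.
have ab : - rad < rad by lra.
pose lo := if 0 <= c then c - delta else c.
have loP : [/\ - rad <= lo, lo + delta <= rad, c - delta <= lo & lo + delta <= c + delta].
  by rewrite /lo; case: (leP 0 c) => c0; split; lra.
case: loP => l1 l2 l3 l4.
have mI : measurable (`[lo, lo + delta]%classic : set R) by exact: measurable_itv.
have -> : (delta / (2 * rad))%:E = uniform_prob ab `[lo, lo + delta]%classic.
  rewrite /uniform_prob (eq_integral (fun=> ((rad - - rad)^-1)%:E)); last first.
    move=> x; rewrite inE/= in_itv/= /uniform_pdf => /andP[x1 x2].
    by rewrite ifT//; apply/andP; split; lra.
  rewrite integral_cst//= lebesgue_measure_itv/= lte_fin ltrDl d0 -EFinD -EFinM.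
  have -> : rad - - rad = 2 * rad by ring.
  by congr (_%:E); field; rewrite gt_eqF.
rewrite -(unif ab _ mI); apply: le_measure; rewrite ?inE.
- exact: mI.
- have -> : [set z : R | `|z - c| <= delta] = `[c - delta, c + delta]%classic.
    by apply/seteqP; split=> z /=; rewrite in_itv/= ler_distl.
  exact: measurable_itv.
- move=> t /=; rewrite in_itv/= ler_distl => /andP[h1 h2].
  by apply/andP; split; lra.
Qed.

Context {d L r n K Kt : nat} (X : {RV P >-> d.-tuple R}) (Y : {RV P >-> R})
  (Xs : 'I_n -> {RV P >-> d.-tuple R}) (Ys : 'I_n -> {RV P >-> R})
  (V : 'I_K -> inner_index d L r -> {RV P >-> R}).

(** Reserve a block of [q] random subnetworks for each target subnetwork.  A
    block fails with probability at most [(1 - p) ^ q], where [p] is the chance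
    that one random subnetwork is close to the target. *)
Lemma initial_selection (v : 'I_Kt -> inner_index d L r -> R)
    (rad : inner_index d L r -> R) (delta : R) (q : nat) :
  mutually_independent P (sample_events X Y Xs Ys V) ->
  0 < delta -> (forall b, delta <= rad b) -> (forall k b, `|v k b| <= rad b) ->
  (forall k b, uniformly_distributed (V k b) (- rad b) (rad b)) ->
  (Kt * q <= K)%N ->
  exists A : set T, [/\ measurable A,
    (P A <= (Kt%:R * expR (- (q%:R * \prod_b (delta / (2 * rad b)))))%:E)%E &
    forall t, ~ A t -> exists sel : 'I_Kt -> 'I_K, injective sel /\
      forall k b, `|V (sel k) b t - v k b| <= delta].
Proof.
move=> indep d0 drad vrad unif qK.
have idxP (k : 'I_Kt) (j : 'I_q) : (k * q + j < K)%N.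
  apply: leq_trans qK; apply: (@leq_trans (k.+1 * q)); last by rewrite leq_mul2r ltn_ord orbT.
  by rewrite mulSn addnC ltn_add2r.
pose idx k j : 'I_K := Ordinal (idxP k j).
have idx_inj k : injective (idx k).
  by move=> j j' /(congr1 val)/= /addnI /val_inj.
pose Q k b : set R := [set z | `|z - v k b| <= delta].
have mQ k b : measurable (Q k b).
  have -> : Q k b = `[v k b - delta, v k b + delta]%classic.
    by rewrite /Q; apply/seteqP; split=> z /=; rewrite in_itv/= ler_distl.
  exact: measurable_itv.
pose B k j : set T := \bigcap_(b in [set: inner_index d L r]) (V (idx k j) b @^-1` Q k b).
have mVQ i k b : measurable (V i b @^-1` Q k b).
  by rewrite -[X in measurable X]setTI; exact: measurable_funPT.
have mB k j : measurable (B k j) by apply: fin_bigcap_measurable => //; exact: finite_finset.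
pose p : R := \prod_b (delta / (2 * rad b)).
have indepB k (s : seq 'I_q) : uniq s -> P (\bigcap_(j in [set` s]) B k j) =
    (\prod_(j <- s) \prod_b P (V (idx k j) b @^-1` Q k b))%E.
  move=> us.
  pose l : seq (option 'I_n + 'I_K * inner_index d L r) :=
    [seq inr (idx k j, b) | j <- s, b <- index_enum _].
  pose E (i : option 'I_n + 'I_K * inner_index d L r) : set T :=
    if i is inr (i', b) then V i' b @^-1` Q k b else set0.
  have := indep l E; rewrite big_allpairs_dep => <-.
  - congr (P _); apply/seteqP; split=> [t H i /allpairsP[[j b] [js _ ->]]|t H j js b _].
      exact: (H j js b I).
    apply: (H (inr (idx k j, b))); apply/allpairsP; exists (j, b); split=> //.
  - apply: allpairs_uniq => //; first exact: index_enum_uniq.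
    by move=> [j b] [j' b'] _ _ /= -[/addnI /val_inj -> ->].
  - move=> [[i|]|[i b]]; [exists set0 => //|exists set0 => //|].
    + by rewrite preimage_set0 setI0.
    + by rewrite preimage_set0 setI0.
    + by exists (Q k b) => //; rewrite setTI.
have PB k j : P (B k j) = (\prod_b P (V (idx k j) b @^-1` Q k b))%E.
  have := indepB k [:: j] isT; rewrite big_seq1 => <-.
  by congr (P _); apply/seteqP; split=> [t H i /=|t H]; [rewrite inE => /eqP ->|apply: H; rewrite /= mem_head].
have pB k j : p <= fine (P (B k j)).
  rewrite -lee_fin fineK ?fin_num_measure// PB /p -prodEFin.
  have E b : P (V (idx k j) b @^-1` Q k b) = (fine (P (V (idx k j) b @^-1` Q k b)))%:E.
    by rewrite fineK// fin_num_measure.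
  under [leRHS]eq_bigr do rewrite E.
  rewrite !prodEFin lee_fin; apply: ler_prod => b _.
  have rb : 0 < rad b by exact: lt_le_trans (drad b).
  rewrite divr_ge0 ?(ltW d0) ?mulr_ge0 ?(ltW rb)//= -lee_fin -E.
  exact: uniform_near_prob.
have p0 : 0 <= p.
  apply: prodr_ge0 => b _; have rb : 0 < rad b by exact: lt_le_trans (drad b).
  by rewrite divr_ge0 ?(ltW d0) ?mulr_ge0 ?(ltW rb).
pose A k : set T := \bigcap_(j in [set` index_enum 'I_q]) ~` B k j.
have mA k : measurable (A k).
  by apply: fin_bigcap_measurable => // j _; exact: measurableC.
have PA k : (P (A k) <= (expR (- (q%:R * p)))%:E)%E.
  rewrite /A (@independent_complements _ (B k) (mB k)) ?index_enum_uniq//; last first.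
    move=> s us; rewrite indepB// -prodEFin; apply: eq_bigr => j _.
    by rewrite -PB fineK// fin_num_measure.
  rewrite lee_fin -mulrN expRM_natl -[X in _ ^+ X]card_ord -prodr_const.
  apply: ler_prod => j _; apply/andP; split.
    by rewrite subr_ge0 -lee_fin fineK ?fin_num_measure// probability_le1.
  by rewrite (le_trans _ (expR_ge1Dx _))// lerD2l lerN2.
pose A' (i : nat) : set T := if insub i is Some k then A k else set0.
have mA' i : measurable (A' i) by rewrite /A'; case: insub.
exists (\big[setU/set0]_(i < Kt) A' i); split.
- by apply: bigsetU_measurable => i _.
- apply: (le_trans (Boole_inequality _ _)); first by move=> i _; exact: mA'.
  apply: (@le_trans _ _ (\sum_(i < Kt) (expR (- (q%:R * p)))%:E)%E).
    apply: lee_sum => i _; rewrite /A'; case: insub => [k|]; first exact: PA.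
    by rewrite measure0 lee_fin expR_ge0.
  by rewrite sumEFin lee_fin sumr_const card_ord -(mulr_natl (expR _) Kt) lexx.
- move=> t nA.
  have /choice[sel selP] : forall k : 'I_Kt, exists j : 'I_q, B k j t.
    move=> k; apply: contrapT => H; apply: nA; rewrite -bigcup_mkord; exists (val k) => //=.
    rewrite /A' valK => j _ Bj.
    by apply: H; exists j.
  exists (fun k => idx k (sel k)); split.
    move=> k k' /(congr1 val)/= E; apply: val_inj => /=.
    have q0 : (0 < q)%N by exact: leq_ltn_trans (ltn_ord (sel k)).
    have := congr1 (fun x => x %/ q)%N E.
    by rewrite !divnMDl// !divn_small ?addn0.
  by move=> k b; exact: (selP k b I).
Qed.
End Initialization.

(** * Deviations for classes with a finite code *)

Section ClassDeviation.
Context {dT : measure_display} {T : measurableType dT} {R : realType} (P : probability T R).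
Context {d : nat} (X : {RV P >-> d.-tuple R}) (Y : {RV P >-> R}) (m : d.-tuple R -> R)
  (beta eta : R).
Context (regr : regression_function X Y m) (beta_gt0 : 0 < beta)
  (m_le : forall x, `|m x| <= beta) (Yint : integrableR P Y)
  (eta_ge : \int[P]_t `|Y t - truncate beta (Y t)| <= eta).
Context (null : set (d.-tuple R)) (null_meas : measurable null) (null0 : P (X @^-1` null) = 0%E).

Let m_meas : measurable_fun setT m. Proof. by case: regr. Qed.

Let mXf (f : d.-tuple R -> R) : measurable_fun setT f -> measurable_fun setT (fun t => f (X t)).
Proof. by move=> mf; apply: (measurableT_comp mf); exact: measurable_funPT. Qed.

Lemma l2_dist2_integrable (f : d.-tuple R -> R) : measurable_fun setT f -> (forall x, `|f x| <= beta) ->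
  integrableR P (fun t => (f (X t) - m (X t)) ^+ 2).
Proof.
move=> mf fb; apply: (@integrableR_bounded _ _ _ _ _ ((2 * beta) ^+ 2)).
  by apply: measurable_funX; apply: measurable_funB; exact: mXf.
move=> t; rewrite normrX lerXn2r ?nnegrE ?mulr_ge0 ?(ltW beta_gt0)//.
by rewrite (le_trans (ler_normB _ _))// mulr2n mulrDl mul1r lerD.
Qed.

Lemma l2_dist2_le (f : d.-tuple R -> R) : measurable_fun setT f -> (forall x, `|f x| <= beta) ->
  l2_dist2 X m f <= 4 * beta ^+ 2.
Proof.
move=> mf fb; rewrite -[leRHS](Rintegral_cst1 P); apply: le_Rintegral => //.
- exact: l2_dist2_integrable.
- apply: (@integrableR_bounded _ _ _ _ _ (4 * beta ^+ 2)) => // t.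
  by rewrite ger0_norm// mulr_ge0// sqr_ge0.
move=> t _; have -> : 4 * beta ^+ 2 = (2 * beta) ^+ 2 by ring.
rewrite -(real_normK (num_real (_ - _))) lerXn2r ?nnegrE ?mulr_ge0 ?(ltW beta_gt0)//.
by rewrite (le_trans (ler_normB _ _))// mulr2n mulrDl mul1r lerD.
Qed.

(** On the null set, where [f] and [g] may differ, both are bounded. *)
Lemma l2_dist2_near (f g : d.-tuple R -> R) (e : R) : measurable_fun setT f -> (forall x, `|f x| <= beta) ->
  measurable_fun setT g -> (forall x, `|g x| <= beta) ->
  (forall x, ~ null x -> `|f x - g x| <= e) ->
  l2_dist2 X m f <= 2 * l2_dist2 X m g + 2 * e ^+ 2.
Proof.
move=> mf fb mg gb fg.
have mN : measurable (X @^-1` null).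
  by rewrite -[X in measurable X]setTI; exact: measurable_funPT.
have i2 := l2_dist2_integrable mg gb.
have i3 : integrableR P (fun=> 2 * e ^+ 2).
  by apply: (@integrableR_bounded _ _ _ _ _ `|2 * e ^+ 2|).
have mI : measurable_fun setT (\1_(X @^-1` null) : T -> R) by exact: measurable_indic.
have i4 : integrableR P (fun t => \1_(X @^-1` null) t).
  apply: (@integrableR_bounded _ _ _ _ _ 1) => // t.
  by rewrite indicE; case: (_ \in _); rewrite ?normr1 ?normr0.
have i5 := integrableRD (integrableRD (integrableRZ 2 i2) i3) (integrableRZ (4 * beta ^+ 2) i4).
apply: (@le_trans _ _ (\int[P]_t (2 * (g (X t) - m (X t)) ^+ 2 + 2 * e ^+ 2 +
    4 * beta ^+ 2 * \1_(X @^-1` null) t))).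
  apply: le_Rintegral => //; first exact: l2_dist2_integrable.
  move=> t _; rewrite indicE; case: (boolP (t \in _)) => tN.
    rewrite mulr1; apply: ler_wpDl.
      by rewrite addr_ge0// mulr_ge0// sqr_ge0.
    have -> : 4 * beta ^+ 2 = (2 * beta) ^+ 2 by ring.
    rewrite -(real_normK (num_real (_ - _))) lerXn2r ?nnegrE ?mulr_ge0 ?(ltW beta_gt0)//.
    by rewrite (le_trans (ler_normB _ _))// mulr2n mulrDl mul1r lerD.
  rewrite mulr0 addr0.
  have := fg (X t) (fun nx => negP tN (mem_set nx)); set u := f _ - g _ => ue.
  have -> : f (X t) - m (X t) = u + (g (X t) - m (X t)) by rewrite /u; ring.
  have u2 : u ^+ 2 <= e ^+ 2.
    by rewrite -(real_normK (num_real u)) lerXn2r ?nnegrE// (le_trans _ ue).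
  set z := g (X t) - m (X t).
  have -> : (u + z) ^+ 2 = 2 * u ^+ 2 + 2 * z ^+ 2 - (u - z) ^+ 2 by ring.
  by have := sqr_ge0 (u - z); lra.
rewrite (RintegralD measurableT (integrableRD (integrableRZ 2 i2) i3) (integrableRZ (4 * beta ^+ 2) i4)).
rewrite (RintegralD measurableT (integrableRZ 2 i2) i3) (RintegralZl 2 measurableT i2) Rintegral_cst1.
rewrite (RintegralZl (4 * beta ^+ 2) measurableT i4).
have -> : \int[P]_t \1_(X @^-1` null) t = 0.
  rewrite /Rintegral integral_indic// setIT.
  exact: (congr1 fine null0).
by rewrite mulr0 addr0.
Qed.

Context {n : nat} (n_gt0 : (0 < n)%N)
  (Xs : 'I_n -> {RV P >-> d.-tuple R}) (Ys : 'I_n -> {RV P >-> R}).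
Context (indep : forall g : d.-tuple R * R -> R, measurable_fun setT g -> (forall z, 0 <= g z) ->
     (\int[P]_t (g (X t, Y t))%:E <= 1)%E ->
     (\int[P]_t (\prod_(i < n) g (Xs i t, Ys i t))%:E <= 1)%E).

Definition mean_gap (f : d.-tuple R -> R) t : R :=
  n%:R^-1 * \sum_i loss_gap m beta f (Xs i t, Ys i t).

(** Besides the entropy term of fast order [1 / n], the costs of the truncation
    of the response ([eta]) and of the resolution of the code ([e]). *)
Definition deviation_term (e : R) (N : nat) (S : R) : R :=
  4 / (n%:R * tilt beta) * (ln N%:R + S) + 16 * beta * eta + 16 * beta * e + 3 * e ^+ 2.

(** A class of functions with a finite code of resolution [e] is controlled
    through one representative for each code. *)
Lemma class_deviation (W : Type) (Cls : W -> Prop) (F : W -> d.-tuple R -> R)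
    (Code : finType) (code : W -> Code) (e : R) :
  0 <= e ->
  (forall w, measurable_fun setT (F w)) -> (forall w x, `|F w x| <= beta) ->
  (forall w w', Cls w -> Cls w' -> code w = code w' ->
     forall x, ~ null x -> `|F w x - F w' x| <= e) ->
  exists S : T -> R, [/\ measurable_fun setT S, forall t, 0 <= S t,
    (\int[P]_t (S t)%:E <= 2%:E)%E &
    forall t, (forall i, ~ null (Xs i t)) -> forall w, Cls w ->
      l2_dist2 X m (F w) <= 4 * mean_gap (F w) t + deviation_term e #|Code| (S t) /\
      mean_gap (F w) t <= 3 * l2_dist2 X m (F w) + deviation_term e #|Code| (S t)].
Proof.
move=> e0 mF Fb codeP.
pose rep (c : Code) : d.-tuple R -> R :=
  if pselect (exists2 w, Cls w & code w = c) is left h then F (projT1 (cid2 h)) else fun=> 0.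
have repm c : measurable_fun setT (rep c) by rewrite /rep; case: pselect.
have repb c x : `|rep c x| <= beta.
  by rewrite /rep; case: pselect => // ?; rewrite normr0 ltW.
have eta0 : 0 <= eta by rewrite (le_trans _ eta_ge)// Rintegral_ge0.
have b2 : 0 < beta ^+ 2 by rewrite exprn_gt0.
have s0 : 0 < tilt beta by rewrite /tilt invr_gt0 mulr_gt0.
have [S [mS S0 S2 HS]] := uniform_deviation regr beta_gt0 m_le Yint eta_ge n_gt0 indep repm repb.
exists S; split => // t tX w wC.
have [Dh Zh] := HS t (code w).
set h := rep (code w) in Dh Zh.
have hF x : ~ null x -> `|F w x - h x| <= e.
  move=> nx; rewrite /h /rep; case: pselect => [H|[]]; last by exists w.
  by case: (cid2 H) => w' /= w'C cw; exact: codeP.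
have Fh x : ~ null x -> `|h x - F w x| <= e by move=> nx; rewrite distrC; exact: hF.
have D1 := l2_dist2_near (mF w) (Fb w) (repm (code w)) (repb (code w)) hF.
have D2 := l2_dist2_near (repm (code w)) (repb (code w)) (mF w) (Fb w) Fh.
have n1 : 0 < (n%:R : R)^-1 by rewrite invr_gt0 ltr0n.
have ZZ : `|mean_gap (F w) t - mean_gap h t| <= 4 * beta * e.
  rewrite /mean_gap -mulrBr -sumrB normrM gtr0_norm//.
  apply: (@le_trans _ _ (n%:R^-1 * \sum_(i < n) (4 * beta * e))).
    rewrite ler_wpM2l ?(ltW n1)//; apply: (le_trans (ler_norm_sum _ _ _)).
    apply: ler_sum => i _.
    have tb : `|truncate beta (Ys i t)| <= beta by rewrite truncate_norm_le// ltW.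
    apply: (le_trans (loss_gap_sub m (beta := beta) _ _)) => /=.
    - by rewrite (le_trans (ler_normB _ _))// mulr2n mulrDl mul1r lerD.
    - by rewrite (le_trans (ler_normB _ _))// mulr2n mulrDl mul1r lerD// repb.
    - by rewrite ler_wpM2l ?mulr_ge0 ?(ltW beta_gt0)//; exact: hF.
  rewrite sumr_const card_ord -(mulr_natl (4 * beta * e) n) mulKf//.
  by rewrite pnatr_eq0 -lt0n.
have k0 : 0 < n%:R * tilt beta by rewrite mulr_gt0 ?ltr0n.
have lnS : 0 <= ln #|Code|%:R + S t.
  by rewrite addr_ge0// ln_ge0// ler1n; apply/card_gt0P; exists (code w).
move: ZZ; rewrite ler_norml => /andP[ZZ1 ZZ2].
rewrite /deviation_term.
have -> : 4 / (n%:R * tilt beta) * (ln #|Code|%:R + S t) =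
   4 * ((n%:R * tilt beta)^-1 * (ln #|Code|%:R + S t)) by rewrite mulrA.
move: Dh Zh; rewrite -/(mean_gap h t).
have -> : 2 / (n%:R * tilt beta) * (ln #|Code|%:R + S t) =
   2 * ((n%:R * tilt beta)^-1 * (ln #|Code|%:R + S t)) by rewrite mulrA.
have : 0 <= (n%:R * tilt beta)^-1 * (ln #|Code|%:R + S t) by rewrite mulr_ge0// invr_ge0 ltW.
set Q := _ * (ln _ + _) => Q0 Dh Zh.
have be : 0 <= beta * e by rewrite mulr_ge0// ltW.
have bn : 0 <= beta * eta by rewrite mulr_ge0// ltW.
have e2 : 0 <= e ^+ 2 by exact: sqr_ge0.
split; lra.
Qed.
End ClassDeviation.

(** * Oracle inequality for a fixed sample size *)

Section MeanBounds.
Context {dT : measure_display} {T : measurableType dT} {R : realType} (P : probability T R).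

(** The integral of a nonnegative function is a supremum over the simple
    functions below it.  The risk of the trained network, as a function of the
    sample, is bounded in this way without any discussion of its measurability. *)
Lemma le_integral_majorant (f g : T -> R) : (forall t, 0 <= f t) -> (forall t, f t <= g t) ->
  (\int[P]_t (f t)%:E <= \int[P]_t (g t)%:E)%E.
Proof.
move=> f0 fg; rewrite !ge0_integralTE; last 2 first.
- by move=> t; rewrite lee_fin (le_trans (f0 t)).
- by move=> t; rewrite lee_fin.
apply: le_ereal_sup => _ [h hf <-]; exists h => // t.
by apply: (le_trans (hf t)); rewrite lee_fin.
Qed.

(** The bound and the measurability are kept together, so that the integral of
    the majorant of the risk can be computed term by term. *)
Definition mean_le (f : T -> R) (b : R) :=
  [/\ measurable_fun setT f, forall t, 0 <= f t & (\int[P]_t (f t)%:E <= b%:E)%E].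

Lemma mean_leD f g b c : mean_le f b -> mean_le g c -> mean_le (fun t => f t + g t) (b + c).
Proof.
move=> [mf f0 fb] [mg g0 gc]; split.
- exact: measurable_funD.
- by move=> t; rewrite addr_ge0.
under eq_integral do rewrite EFinD.
rewrite ge0_integralD//; try (by move=> t _; rewrite lee_fin); try exact/measurable_EFinP.
by rewrite EFinD leeD.
Qed.

Lemma mean_leZ c f b : 0 <= c -> mean_le f b -> mean_le (fun t => c * f t) (c * b).
Proof.
move=> c0 [mf f0 fb]; split.
- exact: measurable_funM.
- by move=> t; rewrite mulr_ge0.
under eq_integral do rewrite EFinM.
rewrite ge0_integralZl//; [|exact/measurable_EFinP|by move=> t _; rewrite lee_fin].
by rewrite EFinM lee_wpmul2l// lee_fin.
Qed.

Lemma mean_le_cst c : 0 <= c -> mean_le (fun=> c) c.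
Proof.
move=> c0; split => //.
rewrite (integral_cst P measurableT).
by have := probability_setT P => /= ->; rewrite mule1.
Qed.

Lemma mean_le_sum (I : finType) (f : I -> T -> R) (b : I -> R) :
  (forall i, mean_le (f i) (b i)) -> mean_le (fun t => \sum_i f i t) (\sum_i b i).
Proof.
move=> H; elim: (index_enum I) => [|i s IH].
  by rewrite big_nil; under eq_fun do rewrite big_nil; exact: mean_le_cst.
rewrite big_cons; under eq_fun do rewrite big_cons.
exact: mean_leD.
Qed.

Lemma mean_le_indic (A : set T) (b : R) : measurable A -> (P A <= b%:E)%E ->
  mean_le (\1_A : T -> R) b.
Proof.
move=> mA Ab; split; first exact: measurable_indic.
  by move=> t; rewrite indicE.
by rewrite integral_indic// setIT.
Qed.
End MeanBounds.

Section ExponentialMoment.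
Context {R : realType}.

(** Jensen's inequality for the exponential function, by its tangent. *)
Lemma expR_mean_le (n : nat) (y : 'I_n -> R) (c : R) : (0 < n)%N -> 0 <= c ->
  c < n%:R^-1 * (\sum_i y i) -> expR c <= n%:R^-1 * \sum_i expR (y i).
Proof.
move=> n0 c0 cy.
have n1 : 0 < (n%:R : R)^-1 by rewrite invr_gt0 ltr0n.
apply: (@le_trans _ _ (n%:R^-1 * \sum_i (expR c * (1 + (y i - c))))).
  rewrite -mulr_sumr mulrCA ler_peMr ?expR_ge0//.
  rewrite big_split/= sumr_const card_ord sumrB sumr_const card_ord.
  rewrite -(mulr_natl c n) mulrDr mulVf ?pnatr_eq0 -?lt0n// lerDl mulrBr subr_ge0.
  by rewrite mulKf ?pnatr_eq0 -?lt0n// ltW.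
rewrite ler_wpM2l ?(ltW n1)// ler_sum// => i _.
have -> : expR (y i) = expR c * expR (y i - c) by rewrite -expRD addrC subrK.
by rewrite ler_wpM2l ?expR_ge0// expR_ge1Dx.
Qed.
End ExponentialMoment.

Lemma deviation_term_le {R : realType} (n N : nat) (n_gt0 : (0 < n)%N) (beta eta : R)
    (beta_gt0 : 0 < beta) (e S lnN : R) : ln N%:R <= lnN ->
  deviation_term beta eta (n := n) e N S <=
    4 / (n%:R * tilt beta) * lnN + 16 * beta * eta + 16 * beta * e + 3 * e ^+ 2 +
    4 / (n%:R * tilt beta) * S.
Proof.
move=> H; have : 4 / (n%:R * tilt beta) * ln N%:R <= 4 / (n%:R * tilt beta) * lnN.
  by rewrite ler_wpM2l// divr_ge0// mulr_ge0// /tilt invr_ge0 mulr_ge0// sqr_ge0.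
rewrite /deviation_term mulrDr; lra.
Qed.

Section Oracle.
Context {dT : measure_display} {T : measurableType dT} {R : realType} (P : probability T R).
Context {d L r : nat} (r_gt0 : (0 < r)%N).
Context (X : {RV P >-> d.-tuple R}) (Y : {RV P >-> R}) (m : d.-tuple R -> R)
  (beta eta : R).
Context (regr : regression_function X Y m) (beta_gt0 : 0 < beta)
  (m_le : forall x, `|m x| <= beta) (Yint : integrableR P Y)
  (eta_ge : \int[P]_t `|Y t - truncate beta (Y t)| <= eta).
Context (null : set (d.-tuple R)) (null_meas : measurable null) (null0 : P (X @^-1` null) = 0%E).
Context {n K Kt : nat} (n_gt0 : (0 < n)%N)
  (Xs : 'I_n -> {RV P >-> d.-tuple R}) (Ys : 'I_n -> {RV P >-> R})
  (V : 'I_K -> inner_index d L r -> {RV P >-> R}).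
Context (indep : mutually_independent P (sample_events X Y Xs Ys V))
  (same : forall i, same_law P (fun w => (Xs i w, Ys i w)) (fun w => (X w, Y w))).
Context (c5 C0 : R) (c5_gt0 : 0 < c5)
  (moment : (\int[P]_t (expR (c5 * Y t ^+ 2))%:E <= C0%:E)%E)
  (c5beta : n%:R <= expR (c5 * beta)).
(* [d0] bounds the distance of the selected initial weights to the targets, and
   [d1] the drift of the weights during training. *)
Context (a : 'I_Kt -> R) (v : 'I_Kt -> inner_index d L r -> R)
  (d0 d1 : R).
Context (M alpha A B e lnN ca pA s c3 lambda : R) (t0 : nat).
Context (Code1 Code2 : finType)
  (code1 : ('I_K -> R) * ('I_K -> inner_index d L r -> R) -> Code1)
  (code2 : ('I_Kt -> R) * ('I_Kt -> inner_index d L r -> R) -> Code2).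
Context (e_ge0 : 0 <= e) (ca_ge0 : 0 <= ca) (s_ge0 : 0 <= s) (lnN_ge0 : 0 <= lnN)
  (code1P : forall w w', in_class alpha A B w -> in_class alpha A B w' -> code1 w = code1 w' ->
      forall x : d.-tuple R, (forall j, `|tnth x j| <= M) ->
      `|combination r_gt0 w.1 w.2 x - combination r_gt0 w'.1 w'.2 x| <= e)
  (code2P : forall w w', in_class alpha A B w -> in_class alpha A B w' -> code2 w = code2 w' ->
      forall x : d.-tuple R, (forall j, `|tnth x j| <= M) ->
      `|combination r_gt0 w.1 w.2 x - combination r_gt0 w'.1 w'.2 x| <= e)
  (lnN1 : ln #|Code1|%:R <= lnN) (lnN2 : ln #|Code2|%:R <= lnN).
Context (nullM : forall x, ~ null x -> forall j, `|tnth x j| <= M)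
  (nullb : forall vb, (forall k b, `|vb k b - v k b| <= d0 + d1) ->
     forall x, ~ null x -> `|combination r_gt0 a vb x| <= beta).
Context (sP : forall vb, (forall k b, `|vb k b - v k b| <= d0 + d1) ->
     l2_dist2 X m (fun x => truncate beta (combination r_gt0 a vb x)) <= s).
Context (class2 : forall vb, (forall k b, `|vb k b - v k b| <= d0 + d1) ->
     in_class alpha A B (a, vb)).
Context (bad : set T) (bad_meas : measurable bad) (badP : (P bad <= pA%:E)%E)
  (init : forall t, ~ bad t -> exists sel : 'I_Kt -> 'I_K, injective sel /\
      forall k b, `|V (sel k) b t - v k b| <= d0).

Let weights (x : 'I_n -> d.-tuple R) (y : 'I_n -> R) v0 : weight_index d L r K -> R :=
  gradient_descent (empirical_risk r_gt0 c3 x y) lambda (initial_weights v0) t0.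

Context (train : forall t (U : R) (sel : 'I_Kt -> 'I_K), ~ bad t -> injective sel ->
  let x i := Xs i t in let y i := Ys i t in
  let v0 k b := V k b t in
  (forall i j, `|tnth (x i) j| <= M) ->
  n%:R^-1 * (\sum_i `|y i| ^+ 2) <= beta ->
  (forall vb, (forall k b, `|vb k b - v0 (sel k) b| <= d1) ->
     n%:R^-1 * (\sum_i `|y i - combination r_gt0 a vb (x i)| ^+ 2) <= U) ->
  let w := weights x y v0 in
  in_class alpha A B (fun k => w (inl k), fun k b => w (inr (k, b))) /\
  n%:R^-1 * (\sum_i `|y i - network r_gt0 w (x i)| ^+ 2) <= U + ca).

Let est t x : R := truncate beta (network r_gt0
  (weights (fun i => Xs i t) (fun i => Ys i t) (fun k b => V k b t)) x).

(** The last product is the trivial bound [4 beta ^ 2] of the distance times a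
    bound of the probability of the exceptional events. *)
Definition oracle_bound : R :=
  12 * s + 4 * ca + 5 * (4 / (n%:R * tilt beta) * lnN + 16 * beta * eta + 16 * beta * e + 3 * e ^+ 2)
  + 40 / (n%:R * tilt beta) + 4 * beta ^+ 2 *
    (C0 / n%:R + expR (- (c5 * beta ^+ 2)) * (n%:R * C0) + pA).

Let trunc_comb K' (w : ('I_K' -> R) * ('I_K' -> inner_index d L r -> R)) x : R :=
  truncate beta (combination r_gt0 w.1 w.2 x).

Let trunc_comb_meas K' w : measurable_fun setT (@trunc_comb K' w).
Proof.
apply: (measurableT_comp (@measurable_truncate R beta)).
exact: (@measurable_combination R d L r r_gt0 K' w.1 w.2).
Qed.

Let trunc_comb_le K' w x : `|@trunc_comb K' w x| <= beta.
Proof. by rewrite truncate_norm_le// ltW. Qed.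

Let null_sample i : P (Xs i @^-1` null) = 0%E.
Proof.
rewrite -null0.
have mA : measurable (fst @^-1` null : set (d.-tuple R * R)).
  by rewrite -[X in measurable X]setTI; exact: measurable_fst.
exact: (same i mA).
Qed.

(** Outside of exceptional events, the distance of the estimate to the regression
    function is at most four times its empirical loss gap, training bounds this
    gap by the one of the target network with slightly moved inner weights, and
    that gap is at most three times the distance of the moved network, up to
    deviations.  The exceptional events are a large mean of the squared
    responses, a response that is truncated, a design point in the null set, and
    a failed initialization.  Their indicators are replaced by exponential
    moments, so that the integrand has an explicit measurable majorant [Psi]. *)
Lemma oracle_inequality : (\int[P]_t (l2_dist2 X m (est t))%:E <= oracle_bound%:E)%E.
Proof.
have indepP (g : d.-tuple R * R -> R) : measurable_fun setT g -> (forall z, 0 <= g z) ->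
    (\int[P]_t (g (X t, Y t))%:E <= 1)%E ->
    (\int[P]_t (\prod_(i < n) g (Xs i t, Ys i t))%:E <= 1)%E.
  exact: (sample_prod_le1 indep same).
have codeP K' (Code : finType) (code : _ -> Code) :
  (forall w w' : ('I_K' -> R) * ('I_K' -> inner_index d L r -> R),
    in_class alpha A B w -> in_class alpha A B w' -> code w = code w' ->
      forall x : d.-tuple R, (forall j, `|tnth x j| <= M) ->
      `|combination r_gt0 w.1 w.2 x - combination r_gt0 w'.1 w'.2 x| <= e) ->
  (forall w w', in_class alpha A B w -> in_class alpha A B w' -> code w = code w' ->
     forall x, ~ null x -> `|trunc_comb w x - trunc_comb w' x| <= e).
  move=> H w w' wC w'C cE x nx; apply: (le_trans (truncate_dist _ _ (ltW beta_gt0))).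
  by apply: H => //; exact: nullM.
have [S1 [mS1 S10 S1m HS1]] := class_deviation regr beta_gt0 m_le Yint eta_ge null_meas null0
  n_gt0 indepP e_ge0 (@trunc_comb_meas K) (@trunc_comb_le K) (codeP _ _ _ code1P).
have [S2 [mS2 S20 S2m HS2]] := class_deviation regr beta_gt0 m_le Yint eta_ge null_meas null0
  n_gt0 indepP e_ge0 (@trunc_comb_meas Kt) (@trunc_comb_le Kt) (codeP _ _ _ code2P).
have b2 : 0 < beta ^+ 2 by rewrite exprn_gt0.
have t1 : 0 < tilt beta by rewrite /tilt invr_gt0 mulr_gt0.
have nt0 : 0 < n%:R * tilt beta by rewrite mulr_gt0 ?ltr0n.
have eta0 : 0 <= eta by rewrite (le_trans _ eta_ge)// Rintegral_ge0.
have n1 : 0 < (n%:R : R)^-1 by rewrite invr_gt0 ltr0n.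
pose base := 12 * s + 4 * ca + 5 * (4 / (n%:R * tilt beta) * lnN + 16 * beta * eta + 16 * beta * e + 3 * e ^+ 2).
have base0 : 0 <= base.
  by rewrite /base !addr_ge0 ?mulr_ge0 ?addr_ge0 ?mulr_ge0 ?sqr_ge0 ?invr_ge0 ?(ltW beta_gt0) ?(ltW nt0).
pose G i t : R := expR (c5 * Ys i t ^+ 2).
(* By Jensen's inequality, a mean of the squared responses above [beta] forces the
   mean of [G] above [exp (c5 beta)], which is at least [n]. *)
pose bad1 t : R := n%:R^-1 * (n%:R^-1 * \sum_i G i t).
pose bad2 t : R := expR (- (c5 * beta ^+ 2)) * \sum_i G i t.
pose bad3 t : R := \sum_(i < n) \1_(Xs i @^-1` null) t.
pose Psi t : R := base + (4 / (n%:R * tilt beta) * S1 t + 16 / (n%:R * tilt beta) * S2 t)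
  + 4 * beta ^+ 2 * (bad1 t + bad2 t + bad3 t + \1_bad t).
have mG i : mean_le P (G i) C0.
  split.
  - apply: measurableT_comp => //; apply: measurable_funM => //; apply: measurable_funX.
    exact: measurable_funPT.
  - by move=> t; exact: expR_ge0.
  rewrite (same_law_integral same i (g := fun z => expR (c5 * z.2 ^+ 2)))//.
    apply: measurableT_comp => //; apply: measurable_funM => //; apply: measurable_funX.
    exact: measurable_snd.
have mPsi : mean_le P Psi oracle_bound.
  have -> : oracle_bound = base + (4 / (n%:R * tilt beta) * 2 + 16 / (n%:R * tilt beta) * 2)
    + 4 * beta ^+ 2 * (n%:R^-1 * (n%:R^-1 * \sum_(i < n) C0) +
       expR (- (c5 * beta ^+ 2)) * \sum_(i < n) C0 + \sum_(i < n) 0 + pA).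
    rewrite /oracle_bound -/base sumr_const card_ord -(mulr_natl C0 n) mulKf; last by rewrite pnatr_eq0 -lt0n.
    by rewrite big1// addr0 [_^-1 * C0]mulrC; ring.
  apply: mean_leD; first (apply: mean_leD; first exact: mean_le_cst).
    apply: mean_leD; apply: mean_leZ => //; by rewrite divr_ge0// ltW.
  apply: mean_leZ; first by rewrite mulr_ge0// ltW.
  apply: mean_leD; last exact: mean_le_indic.
  apply: mean_leD; last first.
    apply: mean_le_sum => i; apply: mean_le_indic.
      by rewrite -[X in measurable X]setTI; exact: measurable_funPT.
    by rewrite null_sample.
  apply: mean_leD.
    do 2 (apply: mean_leZ; first exact: ltW); exact: mean_le_sum.
  by apply: mean_leZ; [exact: expR_ge0|exact: mean_le_sum].
case: mPsi => [mPsi Psi0 PsiI]; apply: le_trans PsiI.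
have est_meas t : measurable_fun setT (est t).
  exact: (@trunc_comb_meas K (_, _)).
have est_le t x : `|est t x| <= beta by rewrite truncate_norm_le// ltW.
apply: le_integral_majorant => t; first by rewrite Rintegral_ge0// => ? _; exact: sqr_ge0.
have G0 i : 0 <= G i t by exact: expR_ge0.
have SG0 : 0 <= \sum_i G i t by rewrite sumr_ge0.
have bad10 : 0 <= bad1 t by rewrite mulr_ge0 ?(ltW n1)// mulr_ge0 ?(ltW n1).
have bad20 : 0 <= bad2 t by rewrite mulr_ge0 ?expR_ge0.
have bad30 : 0 <= bad3 t by rewrite sumr_ge0.
have bad40 : 0 <= (\1_bad t : R) by rewrite indicE.
have Sterm : 0 <= 4 / (n%:R * tilt beta) * S1 t + 16 / (n%:R * tilt beta) * S2 t.
  by rewrite addr_ge0// mulr_ge0// divr_ge0// ltW.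
have crude : 1 <= bad1 t + bad2 t + bad3 t + \1_bad t -> l2_dist2 X m (est t) <= Psi t.
  move=> H; apply: (le_trans (l2_dist2_le regr beta_gt0 m_le (est_meas t) (est_le t))).
  rewrite /Psi -[leLHS]mulr1; apply: ler_wpDl; first exact: addr_ge0.
  by rewrite ler_wpM2l// mulr_ge0// ltW.
have [H1|H1] := ltP beta (n%:R^-1 * \sum_i Ys i t ^+ 2).
  apply: crude; have : 1 <= bad1 t.
    rewrite /bad1 -ler_pdivrMl// invrK mulr1.
    apply: (le_trans c5beta); apply: expR_mean_le => //; first by rewrite mulr_ge0// ltW.
    by rewrite -mulr_sumr mulrCA ltr_pM2l.
  lra.
have [H2|H2] := pselect (exists i, beta < `|Ys i t|).
  case: H2 => i Hi; apply: crude; have : 1 <= bad2 t.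
    rewrite /bad2 expRN -ler_pdivrMl ?invr_gt0 ?expR_gt0// invrK mulr1.
    rewrite (bigD1 i)//=; apply: (@le_trans _ _ (G i t)); last by rewrite lerDl sumr_ge0.
    rewrite ler_expR ler_wpM2l ?(ltW c5_gt0)//.
    by rewrite -(real_normK (num_real (Ys i t))) lerXn2r ?nnegrE ?(ltW beta_gt0)// ltW.
  lra.
have [H3|H3] := pselect (exists i, null (Xs i t)).
  case: H3 => i Hi; apply: crude; have : 1 <= bad3 t.
    rewrite /bad3 (bigD1 i)//= indicE mem_set// lerDl sumr_ge0// => j _.
  lra.
have [H4|H4] := pselect (bad t).
  by apply: crude; rewrite [leRHS]addrC indicE (mem_set H4) lerDl !addr_ge0.
have Yle i : `|Ys i t| <= beta by rewrite leNgt; apply/negP => H; apply: H2; exists i.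
have Xn i : ~ null (Xs i t) by move=> H; apply: H3; exists i.
have [sel [sel_inj selP]] := init H4.
pose mres := n%:R^-1 * \sum_(i < n) (Ys i t - m (Xs i t)) ^+ 2.
have gapE f : mean_gap m beta Xs Ys f t = n%:R^-1 * \sum_(i < n) (Ys i t - f (Xs i t)) ^+ 2 - mres.
  rewrite /mean_gap /mres -mulrBr -sumrB; congr (_ * _); apply: eq_bigr => i _.
  by rewrite /loss_gap/= truncate_id.
pose dt1 := deviation_term beta eta (n := n) e #|Code1| (S1 t).
pose dt2 := deviation_term beta eta (n := n) e #|Code2| (S2 t).
pose U := mres + 3 * s + dt2.
have near vb : (forall k b, `|vb k b - V (sel k) b t| <= d1) ->
    forall k b, `|vb k b - v k b| <= d0 + d1.
  move=> H k b; have -> : vb k b - v k b = (V (sel k) b t - v k b) + (vb k b - V (sel k) b t) by ring.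
  by apply: (le_trans (ler_normD _ _)); rewrite lerD.
have HU vb : (forall k b, `|vb k b - V (sel k) b t| <= d1) ->
    n%:R^-1 * (\sum_i `|Ys i t - combination r_gt0 a vb (Xs i t)| ^+ 2) <= U.
  move=> /near vbn.
  have [_ Z2] := HS2 t Xn (a, vb) (class2 vbn).
  have := sP vbn => D2; rewrite gapE in Z2.
  have E : \sum_(i < n) (Ys i t - trunc_comb (a, vb) (Xs i t)) ^+ 2 =
     \sum_i `|Ys i t - combination r_gt0 a vb (Xs i t)| ^+ 2.
    apply: eq_bigr => i _; rewrite real_normK ?num_real// /trunc_comb truncate_id//.
    by apply: nullb.
  move: Z2; rewrite E /U -/dt2 -/(trunc_comb (a, vb)); lra.
have Ymean : n%:R^-1 * (\sum_i `|Ys i t| ^+ 2) <= beta.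
  by under eq_bigr do rewrite real_normK ?num_real//.
have [wC wU] := train H4 sel_inj (fun i j => nullM (Xn i) j) Ymean HU.
have [D1 _] := HS1 t Xn _ wC.
have estE : trunc_comb (fun k => weights (fun i => Xs i t) (fun i => Ys i t) (fun k b => V k b t) (inl k),
    fun k b => weights (fun i => Xs i t) (fun i => Ys i t) (fun k b => V k b t) (inr (k, b))) = est t by [].
rewrite estE gapE in D1.
have Zest : n%:R^-1 * \sum_(i < n) (Ys i t - est t (Xs i t)) ^+ 2 <= U + ca.
  apply: le_trans wU; rewrite ler_wpM2l ?(ltW n1)//; apply: ler_sum => i _.
  rewrite -(real_normK (num_real (_ - _))) lerXn2r ?nnegrE//.
  by rewrite -{1}(truncate_id (Yle i)); apply: truncate_dist; exact: ltW.
have dt1E := deviation_term_le n_gt0 eta beta_gt0 e (S1 t) lnN1; rewrite -/dt1 in dt1E.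
have dt2E := deviation_term_le n_gt0 eta beta_gt0 e (S2 t) lnN2; rewrite -/dt2 in dt2E.
have e16 : 16 / (n%:R * tilt beta) * S2 t = 4 * (4 / (n%:R * tilt beta) * S2 t) by ring.
have last0 : 0 <= 4 * beta ^+ 2 * (bad1 t + bad2 t + bad3 t + \1_bad t).
  by apply: mulr_ge0; [rewrite mulr_ge0// ltW | rewrite !addr_ge0].
rewrite -/dt1 in D1; rewrite /Psi /base e16.
move: D1 Zest dt1E dt2E last0; rewrite /U; lra.
Qed.
End Oracle.

(** * Growth rates *)

Section Growth.
Context {R : realType}.

Lemma ln_eventually_ge (C : R) : \forall n \near \oo, C <= ln n%:R.
Proof.
near=> n; rewrite -[leLHS]expRK ler_ln ?posrE ?expR_gt0//.
  by near: n; exact: nbhs_infty_ger.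
rewrite (lt_le_trans (expR_gt0 C))//; near: n; exact: nbhs_infty_ger.
Unshelve. all: by end_near. Qed.

Lemma powR_expR_ln (n : nat) (x : R) : (0 < n)%N -> n%:R `^ x = expR (x * ln n%:R).
Proof. by move=> n0; rewrite /powR pnatr_eq0 -[n == 0%N]negbK -lt0n n0. Qed.

(** The exponential function outgrows every power: with [p = q + 1] factors,
    [exp x = exp (x / p) ^ p >= (x / p) ^ p]. *)
Lemma polylog_le_power (q : nat) (C delta : R) : 0 < delta -> 
  \forall n \near \oo, C * ln n%:R ^+ q <= n%:R `^ delta.
Proof.
move=> delta0; pose x : R := delta / q.+1%:R.
have x0 : 0 < x by rewrite divr_gt0.
near=> n.
have l0 : 0 <= ln n%:R :> R by near: n; exact: ln_eventually_ge.
rewrite powR_expR_ln; last by near: n; exists 1%N.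
have -> : delta * ln n%:R = q.+1%:R * (x * ln n%:R) by rewrite mulrA [_ * x]mulrC divfK.
rewrite expRM_natl.
have xl0 : 0 <= x * ln n%:R by exact: mulr_ge0 (ltW x0) l0.
apply: (@le_trans _ _ ((x * ln n%:R) ^+ q.+1)); last first.
  rewrite lerXn2r ?nnegrE ?expR_ge0//.
  by rewrite (le_trans _ (expR_ge1Dx _))// lerDr.
rewrite exprMn (exprSr (ln _)) [leRHS](_ : _ = (x ^+ q.+1 * ln n%:R) * ln n%:R ^+ q); last by ring.
rewrite ler_wpM2r ?exprn_ge0// mulrC -ler_pdivrMr ?exprn_gt0//.
by near: n; exact: ln_eventually_ge.
Unshelve. all: by end_near. Qed.

(** All factors that grow are replaced by one common bound [y]; the product with
    the most factors has [2 L] of them. *)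
Lemma smoothness_bound_le (L K : nat) (A Q c3 Phi B y : R) : (0 < L)%N ->
  0 <= A -> 0 <= Q -> 0 <= c3 -> 0 <= Phi -> 1 <= y -> 1 + Phi <= y -> 1 + Phi / c3 <= y ->
  0 <= B <= y ->
  smoothness_bound (L := L) A Q c3 Phi B K <=
    K%:R * ((2 * A + 2 * Q + (1 + A) ^+ 2 + c3) * y ^+ (2 * L)).
Proof.
move=> L0 A0 Q0 c30 Phi0 y1 y2 y3 /andP[B0 By].
have y0 : 0 <= y by rewrite (le_trans _ y1).
have p0 : 0 <= 1 + Phi by rewrite addr_ge0.
have q0 : 0 <= 1 + Phi / c3 by rewrite addr_ge0// divr_ge0.
have yB k : B ^+ k <= y ^+ k by rewrite lerXn2r.
have AB : A * B ^+ L.-1 <= A * y ^+ L.-1 by rewrite ler_wpM2l.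
have QB : Q * B ^+ (2 * L.-1) <= Q * y ^+ (2 * L.-1) by rewrite ler_wpM2l.
have AB0 : 0 <= A * B ^+ L.-1 by rewrite mulr_ge0 ?exprn_ge0.
have QB0 : 0 <= Q * B ^+ (2 * L.-1) by rewrite mulr_ge0 ?exprn_ge0.
have yL : y ^+ L = y * y ^+ L.-1 by rewrite -exprS prednK.
have y2L : y ^+ (2 * L) = y ^+ L * y ^+ L by rewrite -exprD addnn mul2n.
have y2L1 : y ^+ (2 * L) = y * y * y ^+ (2 * L.-1).
  by rewrite y2L yL -{2}(prednK L0) mul2n -addnn exprD -{2}(prednK L0)/=; ring.
have yL1 : 1 <= y ^+ L by rewrite exprn_ege1.
have yL2 : 1 <= y ^+ (2 * L) by rewrite exprn_ege1.
have yLL : y ^+ L <= y ^+ (2 * L) by rewrite y2L ler_peMl ?exprn_ge0.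
rewrite /smoothness_bound ler_wpM2l//.
apply: (@le_trans _ _ (2 * y * (A * y ^+ L.-1 + y * (Q * y ^+ (2 * L.-1))) +
   (1 + y * (A * y ^+ L.-1)) ^+ 2 + c3)).
  rewrite lerD2r lerD//.
    apply: ler_pM.
    - by rewrite mulr_ge0.
    - by rewrite addr_ge0// mulr_ge0.
    - by rewrite ler_wpM2l.
    - by rewrite lerD// ler_pM.
  rewrite lerXn2r ?nnegrE ?addr_ge0 ?mulr_ge0 ?exprn_ge0//.
  by rewrite lerD2l ler_pM.
have -> : 2 * y * (A * y ^+ L.-1 + y * (Q * y ^+ (2 * L.-1))) + (1 + y * (A * y ^+ L.-1)) ^+ 2 + c3 =
   2 * A * y ^+ L + 2 * Q * y ^+ (2 * L) + (1 + A * y ^+ L) ^+ 2 + c3.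
  by rewrite y2L1 yL; ring.
have H1 : A * y ^+ L <= A * y ^+ (2 * L) by rewrite ler_wpM2l.
have H3 : c3 <= c3 * y ^+ (2 * L) by rewrite ler_peMr.
have H2 : (1 + A * y ^+ L) ^+ 2 <= (1 + A) ^+ 2 * y ^+ (2 * L).
  rewrite y2L -expr2 -exprMn lerXn2r ?nnegrE ?mulr_ge0 ?addr_ge0 ?mulr_ge0 ?exprn_ge0//.
  by rewrite mulrDl mul1r lerD2r.
lra.
Qed.
End Growth.

(** * Moments of the response and distances to the regression function *)

Section MomentTail.
Context {dT : measure_display} {T : measurableType dT} {R : realType} (P : probability T R)
  (Y : {RV P >-> R}) (c5 C0 : R) (c5_gt0 : 0 < c5)
  (moment : (\int[P]_t (expR (c5 * Y t ^+ 2))%:E <= C0%:E)%E).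

Let W t : R := expR (c5 * Y t ^+ 2).

Let W_int : integrableR P W.
Proof.
apply/integrableP; split.
  apply/measurable_EFinP; apply: measurableT_comp => //; apply: measurable_funM => //.
  by apply: measurable_funX; exact: measurable_funPT.
under eq_integral do rewrite /= ger0_norm ?expR_ge0//.
by rewrite (le_lt_trans moment)// ltry.
Qed.

Lemma exp_moment_integrable : integrableR P Y.
Proof.
apply: (integrableR_le _ _ (integrableRZ (1 + c5^-1) W_int)); first exact: measurable_funPT.
move=> t; have c50 : 0 <= c5^-1 by rewrite invr_ge0 ltW.
have WE := expR_ge1Dx (c5 * Y t ^+ 2); rewrite -/(W t) in WE.
have Y0 : 0 <= `|Y t| by [].
have W1 : 1 <= W t by rewrite -expR0 ler_expR mulr_ge0 ?sqr_ge0// ltW.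
have cW : Y t ^+ 2 <= c5^-1 * W t.
  by rewrite -ler_pdivrMl ?invr_gt0// invrK; lra.
rewrite [leRHS]ger0_norm; last by rewrite mulr_ge0 ?addr_ge0// expR_ge0.
rewrite mulrDl mul1r; apply: (@le_trans _ _ (1 + Y t ^+ 2)); last lra.
by rewrite -(real_normK (num_real (Y t))); nra.
Qed.

(** Where the truncation acts, [|Y|] exceeds [beta], and [exp (c5 Y^2 / 2)] is at
    most [exp (c5 Y^2)] times the small factor [exp (- c5 beta^2 / 2)]. *)
Lemma truncation_tail (beta : R) : 0 <= beta -> 2 <= c5 * beta ->
  \int[P]_t `|Y t - truncate beta (Y t)| <= C0 * expR (- (c5 * beta ^+ 2 / 2)).
Proof.
move=> b0 cb; set w := expR (- _).
apply: (@le_trans _ _ (\int[P]_t (w * W t))); last first.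
  rewrite (RintegralZl w measurableT W_int) mulrC ler_wpM2r ?expR_ge0//.
  by rewrite -lee_fin -integral_EFin.
have Ym : measurable_fun setT Y by exact: measurable_funPT.
have dom t : `|Y t - truncate beta (Y t)| <= w * W t.
  have [yb|yb] := leP `|Y t| beta.
    by rewrite truncate_id// subrr normr0 mulr_ge0 ?expR_ge0.
  apply: (@le_trans _ _ `|Y t|).
    have t0 : truncate beta 0 = 0 by rewrite truncate_id// normr0.
    rewrite /truncate; case: (ltP beta (Y t)) => h1.
      by rewrite max_r ?(le_trans _ b0) ?oppr_le0// !gtr0_norm ?subr_gt0// ?(le_lt_trans b0)// gerBl.
    have Yb : Y t < - beta by move: yb; rewrite ltr_normr ltNge h1/=; lra.
    by rewrite max_l ?(ltW Yb)// !ltr0_norm; lra.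
  apply: (@le_trans _ _ (c5 * `|Y t| ^+ 2 / 2)); first nra.
  apply: (@le_trans _ _ (expR (c5 * `|Y t| ^+ 2 / 2))).
    by rewrite (le_trans _ (expR_ge1Dx _))// lerDr.
  rewrite /w /W -expRD ler_expR -(real_normK (num_real (Y t))).
  have : beta ^+ 2 <= `|Y t| ^+ 2 by rewrite lerXn2r ?nnegrE// ltW.
  nra.
have i1 := integrableRZ w W_int.
have mD : measurable_fun setT (fun t => `|Y t - truncate beta (Y t)|).
  apply: measurableT_comp => //; apply: measurable_funB => //.
  exact: (measurableT_comp (@measurable_truncate R beta)).
apply: le_Rintegral => //.
apply: (integrableR_le mD _ i1) => t; rewrite normr_id.
by rewrite (ger0_norm (_ : 0 <= w * W t)) ?mulr_ge0 ?expR_ge0//; exact: dom.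
Qed.
End MomentTail.

Section LawDistance.
Context {dT : measure_display} {T : measurableType dT} {R : realType} (P : probability T R).
Context {d : nat} (X : {RV P >-> d.-tuple R}) (m : d.-tuple R -> R).

Lemma l2_dist2_distribution (b : R) (f : d.-tuple R -> R) : measurable_fun setT m ->
  measurable_fun setT f -> (forall x, `|f x - m x| <= b) ->
  (\int[distribution P X]_x (`|f x - m x| ^+ 2)%:E = (l2_dist2 X m f)%:E)%E.
Proof.
move=> mm mf fb.
have mg : measurable_fun setT (fun x => `|f x - m x| ^+ 2).
  by apply: measurable_funX; apply: measurableT_comp => //; exact: measurable_funB.
rewrite ge0_integral_distribution; [|exact/measurable_EFinP|by move=> y; rewrite lee_fin exprn_ge0].
have mX : measurable_fun setT X by exact: measurable_funPT.
have gi : integrableR P (fun t => `|f (X t) - m (X t)| ^+ 2).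
  apply: (@integrableR_bounded _ _ _ _ _ (b ^+ 2)); first exact: (measurableT_comp mg).
  by move=> t; rewrite normrX normr_id lerXn2r ?nnegrE// (le_trans _ (fb (X t))).
rewrite (integral_EFin gi); congr (_%:E); apply: eq_Rintegral => t _.
by rewrite real_normK ?num_real.
Qed.

(** Truncating at a bound of [m] does not increase the distance to [m]. *)
Lemma l2_dist2_truncate_le (beta : R) (f : d.-tuple R -> R) : 0 <= beta ->
  measurable_fun setT m -> measurable_fun setT f -> (forall x, `|m x| <= beta) ->
  ((l2_dist2 X m (fun x => truncate beta (f x)))%:E <=
     \int[distribution P X]_x (`|f x - m x| ^+ 2)%:E)%E.
Proof.
move=> b0 mm mf mb.
have mt : measurable_fun setT (fun x => truncate beta (f x)).
  exact: (measurableT_comp (@measurable_truncate R beta)).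
rewrite -(@l2_dist2_distribution (beta + beta))//; last first.
  move=> x; apply: (le_trans (ler_normB _ _)); apply: lerD => //.
  exact: truncate_norm_le.
apply: le_integral_majorant => x; first exact: exprn_ge0.
rewrite lerXn2r ?nnegrE// -[X in `|_ - X|](truncate_id (mb x)).
exact: truncate_dist.
Qed.
End LawDistance.

(** * The risk under explicit numerical conditions *)

Section SampleSize.
Context {dT : measure_display} {T : measurableType dT} {R : realType} (P : probability T R).
Context {d L r : nat} (r_gt0 : (0 < r)%N).
Context (X : {RV P >-> d.-tuple R}) (Y : {RV P >-> R}) (m : d.-tuple R -> R).

Lemma uniform_out_of_range (Z : {RV P >-> R}) (rad : R) : uniformly_distributed Z (- rad) rad ->
  P (Z @^-1` ~` `[- rad, rad]%classic) = 0%E.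
Proof.
move=> [H _]; rewrite -preimage_setC.
have mZ : measurable (Z @^-1` `[- rad, rad]%classic).
  by rewrite -[X in measurable X]setTI; exact: measurable_funPT.
by rewrite (probability_setC P mZ) H subee.
Qed.

Lemma uniform_in_range_ae (K : nat) (V : 'I_K -> inner_index d L r -> {RV P >-> R})
    (rad : inner_index d L r -> R) :
  (forall k b, uniformly_distributed (V k b) (- rad b) (rad b)) ->
  P.-negligible (~` [set t | forall k b, `|V k b t| <= rad b]).
Proof.
move=> unif; pose I := ('I_K * inner_index d L r)%type.
pose out (i : I) : set T := V i.1 i.2 @^-1` ~` `[- rad i.2, rad i.2]%classic.
pose F n := if (choice.unpickle n : option I) is Some i then out i else set0.
apply: (@negligibleS _ _ _ _ (\bigcup_n F n)).
  move=> t /= /existsNP[k /existsNP[b H]]; exists (choice.pickle ((k, b) : I)) => //.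
  by rewrite /F choice.pickleK /out/= in_itv/= -ler_norml.
apply: negligible_bigcup => n; rewrite /F; case: choice.unpickle => [[k b]|]; last exact: negligible_set0.
exists (out (k, b)); split => //; last exact: uniform_out_of_range.
rewrite -[X in measurable X]setTI; apply: measurable_funPT => //.
by apply: measurableC; exact: measurable_itv.
Qed.

Let radius_ge (c l : R) : 0 < l -> 1 <= 5 * c * l -> l / 5 <= c * l ^+ 2.
Proof. by move=> l0 H; rewrite expr2; nra. Qed.

Let drift_le (l : R) : 0 < l -> 4 / 5 * l <= l.
Proof. by move=> l0; lra. Qed.

Let norm_le_sqrDr (w : R) : `|w| <= 1 + `|w| ^+ 2.
Proof. by have := normr_ge0 w; nra. Qed.

(** The oracle inequality with the weights of the theorem.  The neighbourhood of
    radius [l = log n] of the target weights is split: [l / 5] for the distance of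
    the selected initial weights, and [4 l / 5] for the drift during training.
    The constants of the smoothness bound and of the code depend only on the
    design radius [M] and on the order [k] of the local approximations, and are
    chosen before the sample size. *)
Lemma risk_at_sample_size (M : R) (k : nat) : 0 <= M -> (0 < k)%N ->
  exists (A0 Q0 C : R) (e p : nat), [/\ 0 <= A0, 0 <= Q0, 1 <= C &
  forall (tau c1 c2 c3 c4 c5 C0 lambda : R) (n K Kt t0 : nat)
    (Xs : 'I_n -> {RV P >-> d.-tuple R}) (Ys : 'I_n -> {RV P >-> R})
    (V : 'I_K -> inner_index d L r -> {RV P >-> R})
    (a : 'I_Kt -> R) (v : 'I_Kt -> inner_index d L r -> R)
    (h step pA s : R) (G N : nat),
  let l := ln n%:R in let beta := c4 * l in
  let rad := inner_radius (d := d) (L := L) (r := r) c1 c2 tau n in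
  let A := c2 * l ^+ 2 * n%:R `^ tau + l in let B := c1 * l ^+ 2 + l in
  let H := K%:R * (1 + beta / c3 + c1 * l ^+ 2) * (C * B ^+ e) in
  let rho := d%:R * A * h in
  0 < tau -> [/\ 0 < c1, 0 < c2, 0 < c3, 0 < c4 & 0 < c5] ->
  [/\ (0 < n)%N, (0 < Kt <= K)%N, (0 < t0)%N & 0 < lambda] ->
  mutually_independent P (sample_events X Y Xs Ys V) ->
  (forall i, same_law P (fun w => (Xs i w, Ys i w)) (fun w => (X w, Y w))) ->
  (forall k b, uniformly_distributed (V k b) (- rad b) (rad b)) ->
  (forall x, law_support (distribution P X) x -> forall j, `|tnth x j| <= M) ->
  (\int[P]_t (expR (c5 * Y t ^+ 2))%:E <= C0%:E)%E ->
  regression_function X Y m ->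
  (forall x, `|m x| <= beta) ->
  (forall k, `|a k| <= c1 * l ^+ 2) ->
  (forall k b, `|v k b| <= rad b) ->
  (forall vb, (forall k b, `|vb k b - v k b| <= l) ->
    forall x, law_support (distribution P X) x -> `|combination r_gt0 a vb x| <= beta) ->
  (forall vb, (forall k b, `|vb k b - v k b| <= l) ->
     l2_dist2 X m (fun x => truncate beta (combination r_gt0 a vb x)) <= s) ->
  [/\ 1 <= l, 1 <= 5 * c1 * l, 1 <= 5 * c2 * l, 2 <= c5 * beta & n%:R <= expR (c5 * beta)] ->
  2 * lambda * t0%:R * beta <= (4 / 5 * l) ^+ 2 ->
  lambda * smoothness_bound (L := L) A0 Q0 c3 beta B K <= 2^-1 ->
  Kt%:R * expR (- ((K %/ Kt)%N%:R * \prod_b (l / 5 / (2 * rad b)))) <= pA ->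
  [/\ 0 < h, rho <= 1, M / h < G.+1%:R, 0 < step & 2 * H / step < N.+1%:R] ->
  (\int[P]_w (l2_dist2 X m (estimate r_gt0 c3 c4 lambda t0
      (fun i => Xs i w) (fun i => Ys i w) (fun k b => V k b w)))%:E <=
   (oracle_bound beta (C0 * expR (- (c5 * beta ^+ 2 / 2))) (n := n) c5 C0
      (2 * H * rho ^+ k + p%:R * step) ((G.+1 ^ d * p)%N%:R * ln N.+1%:R)
      ((c3 + (2 * lambda * t0%:R)^-1) * \sum_(k < Kt) `|a k| ^+ 2) pA s)%:E)%E].
Proof.
move=> M0 k0; have [A0 [Q0 [A00 Q00 training]]] := @training_oracle R d L r r_gt0 M M0.
have [C [e [p [C1 code]]]] := @network_code R d L r r_gt0 k k0.
exists A0, Q0, C, e, p; split => //.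
move=> tau c1 c2 c3 c4 c5 C0 lambda n K Kt t0 Xs Ys V a v h step pA s G N l beta rad A B H rho
  tau0 [c10 c20 c30 c40 c50] [n0 /andP[Kt0 KtK] t00 la0] indep same unif suppM moment regr mb aB vB
  suppb sP [l1 c1l c2l cb nb] travel smooth initP [h0 rho1 MG step0 HN].
have l0 : 0 < l by exact: lt_le_trans l1.
have K0 : (0 < K)%N by exact: leq_trans KtK.
have beta0 : 0 < beta by rewrite mulr_gt0.
have nu1 : 1 <= n%:R `^ tau.
  by rewrite powR_expR_ln// -[leLHS]expR0 ler_expR; exact: mulr_ge0 (ltW tau0) (ltW l0).
have l2 : l <= l ^+ 2 by rewrite expr2 ler_peMl// ltW.
have c1l2 : l / 5 <= c1 * l ^+ 2 by exact: radius_ge.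
have c2l2 : l / 5 <= c2 * l ^+ 2 * n%:R `^ tau.
  have : l / 5 <= c2 * l ^+ 2 by exact: radius_ge.
  by move=> /le_trans -> //; rewrite ler_peMr// mulr_ge0 ?sqr_ge0// ltW.
have drad b : l / 5 <= rad b by case: b.
have radA ij : rad (inl ij) + l <= A by [].
have radB b : rad (inr b) + l <= B by [].
have A1 : 0 <= A by rewrite addr_ge0 ?(ltW l0)// (le_trans _ c2l2)// divr_ge0// ltW.
have B1 : 1 <= B by rewrite (le_trans l1)// lerDr mulr_ge0 ?sqr_ge0// ltW.
set alpha := 1 + beta / c3 + c1 * l ^+ 2 in H HN *.
have bc3 : 0 <= beta / c3 by rewrite divr_ge0// ltW.
have cl2 : 0 <= c1 * l ^+ 2 by rewrite mulr_ge0 ?sqr_ge0// ltW.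
have alpha0 : 0 <= alpha by rewrite !addr_ge0.
have [Code1 [code1 [card1 code1P]]] := code K G N alpha A B h M step B1 h0 A1 rho1 alpha0 step0 MG HN.
have CB0 : 0 <= C * B ^+ e by rewrite mulr_ge0 ?exprn_ge0 ?(le_trans _ C1) ?(le_trans _ B1).
have HtH : Kt%:R * alpha * (C * B ^+ e) <= H.
  by rewrite ler_wpM2r// ler_wpM2r// ler_nat.
have HtN : 2 * (Kt%:R * alpha * (C * B ^+ e)) / step < N.+1%:R.
  by apply: le_lt_trans HN; rewrite ler_wpM2r ?invr_ge0 ?(ltW step0)// ler_wpM2l.
have [Code2 [code2 [card2 code2P]]] := code Kt G N alpha A B h M step B1 h0 A1 rho1 alpha0 step0 MG HtN.
have rho0 : 0 <= rho by rewrite !mulr_ge0// ltW.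
have H0 : 0 <= H := mulr_ge0 (mulr_ge0 (ler0n _ _) alpha0) CB0.
have [null [null_meas nullP nullS]] := law_support_negligible (distribution P X).
have nullsupp x : ~ null x -> law_support (distribution P X) x.
  by move=> nx; apply: contrapT => /nullS.
have KqK : (Kt * (K %/ Kt) <= K)%N by rewrite mulnC leq_divM.
have l5 : 0 < l / 5 by rewrite divr_gt0.
have [init_bad [mIB PIB selP]] := initial_selection indep l5 drad vB unif KqK.
have [out [out_meas outP outS]] := uniform_in_range_ae unif.
have inP t : ~ out t -> forall k b, `|V k b t| <= rad b.
  by move=> ot; apply: contrapT => /outS.
have dd : l / 5 + 4 / 5 * l = l by field.
have res0 : 0 <= 2 * H * rho ^+ k + p%:R * step.
  have H20 : 0 <= 2 * H := mulr_ge0 (ler0n _ 2) H0.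
  exact: addr_ge0 (mulr_ge0 H20 (exprn_ge0 k rho0)) (mulr_ge0 (ler0n _ _) (ltW step0)).
have c_norm (w : R) : `|w| ^+ 2 <= beta / c3 -> `|w| <= alpha.
  move=> w2; rewrite (le_trans _ (_ : 1 + beta / c3 <= _)) ?lerDl//.
  by rewrite (le_trans (norm_le_sqrDr w))// lerD2l.
have mbad : measurable (init_bad `|` out) by exact: measurableU.
have Pbad : (P (init_bad `|` out) <= pA%:E)%E.
  apply: (le_trans (measureU2 _ mIB out_meas)).
  by rewrite [X in (_ + X)%E]outP adde0; apply: (le_trans PIB); rewrite lee_fin.
have cardE (Code : finType) : #|Code| = (N.+1 ^ (G.+1 ^ d * p))%N ->
    ln #|Code|%:R <= (G.+1 ^ d * p)%N%:R * ln N.+1%:R :> R.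
  by move=> ->; rewrite natrX lnXn// mulr_natl.
rewrite /estimate -/l -/beta.
apply: (oracle_inequality (c3 := c3) (lambda := lambda) (t0 := t0) (s := s) (lnN := (G.+1 ^ d * p)%N%:R * ln N.+1%:R)
  (ca := (c3 + (2 * lambda * t0%:R)^-1) * \sum_(k1 < Kt) `|a k1| ^+ 2) regr beta0 mb (exp_moment_integrable c50 moment)
  (truncation_tail moment (ltW beta0) cb) null_meas nullP n0 indep same c50 moment nb
  (a := a) (v := v) (d0 := l / 5) (d1 := 4 / 5 * l) (M := M) (alpha := alpha) (A := A) (B := B)
  res0 _ _ _ code1P (code2 := code2) _ _ _ _ _ _ _ mbad Pbad) => //.
- by rewrite mulr_ge0 ?addr_ge0 ?invr_ge0 ?mulr_ge0 ?(ltW c30) ?(ltW la0)// sumr_ge0.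
- apply: le_trans (sP v _); last by move=> k' b; rewrite subrr normr0 ltW.
  by rewrite Rintegral_ge0// => t _; exact: sqr_ge0.
- by rewrite mulr_ge0// ln_ge0// ler1n.
- move=> w w' w1 w2 w3 x xM; apply: (le_trans (code2P w w' w1 w2 w3 x xM)).
  by rewrite lerD2r ler_wpM2r ?exprn_ge0// ler_wpM2l.
- exact: cardE.
- exact: cardE.
- by move=> x /nullsupp; exact: suppM.
- by rewrite dd => vb vbv x /nullsupp; exact: suppb.
- by rewrite dd.
- rewrite dd => vb vbv; split => [k'|k'] /=.
    by rewrite (le_trans (aB k'))// lerDr addr_ge0.
  have vbl b : `|vb k' b| <= rad b + l.
    have -> : vb k' b = v k' b + (vb k' b - v k' b) by ring.
    by rewrite (le_trans (ler_normD _ _))// lerD.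
  by split => [ij|b]; apply: (le_trans (vbl _)); [exact: radA|exact: radB].
- by move=> t nb'; apply: selP => tb; apply: nb'; left.
move=> t U sel nb' sel_inj x y v0 xM yb HU w.
have /inP vin : ~ out t by move=> ot; apply: nb'; right.
have d10 : 0 <= 4 / 5 * l by rewrite mulr_ge0// ltW.
have d1l := drift_le l0.
have vB' k' b : `|v0 k' (inr b)| + 4 / 5 * l <= B.
  exact: le_trans (lerD (vin k' (inr b)) d1l) (radB b).
have [w1 w2 w3] := training c3 beta B lambda (4 / 5 * l) U n K Kt t0 x y v0 sel a n0 K0 t00 c30 la0
  d10 sel_inj xM B1 vB' yb travel smooth HU.
split => //; split=> k' /=.
  apply: c_norm; rewrite ler_pdivlMr// mulrC; apply: le_trans w2.
  by rewrite ler_wpM2l ?(ltW c30)// (bigD1 k')//= lerDl sumr_ge0// => ? _; exact: exprn_ge0.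
have wb b : `|w (inr (k', b))| <= rad b + l.
  have -> : w (inr (k', b)) = v0 k' b + (w (inr (k', b)) - v0 k' b) by ring.
  exact: le_trans (ler_normD _ _) (lerD (vin k' b) (le_trans (w1 k' b) d1l)).
by split => [ij|b]; apply: (le_trans (wb _)); [exact: radA|exact: radB].
Qed.

End SampleSize.

(** * Asymptotic choice of the parameters *)

Section Asymptotics.
Context {R : realType}.

(** The total drift of the weights during training stays below [4/5 log n]:
    up to the rounding of the number of steps, its square is at most
    [2 c4 c6 (log n) ^ 2 <= (log n) ^ 2 / 2]. *)
Lemma training_length (c4 c6 l Lam lambda : R) (t0 : nat) : 0 < c4 -> 0 < c6 -> 1 <= l ->
  20 * c4 <= l -> 4 * c4 * c6 <= 1 -> 1 <= Lam -> lambda = Lam^-1 ->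
  t0%:Z = Num.ceil (c6 * Lam * l) ->
  [/\ (0 < t0)%N, 2 * lambda * t0%:R * (c4 * l) <= (4 / 5 * l) ^+ 2 &
      (2 * lambda * t0%:R)^-1 <= (2 * c6)^-1].
Proof.
move=> c40 c60 l1 lc cc Lam1 -> tE.
have Lam0 : 0 < Lam by exact: lt_le_trans Lam1.
have lo : c6 * Lam * l <= t0%:R by have := Num.Theory.ceil_ge (c6 * Lam * l); rewrite -tE.
have hi : t0%:R < c6 * Lam * l + 1 by have := Num.Theory.gt_pred_ceil (c6 * Lam * l); rewrite -tE intrB ltrBlDr.
have la : Lam^-1 <= 1 by rewrite invf_le1.
have l0 : 0 < l by lra.
have pos : 0 < c6 * Lam * l by rewrite !mulr_gt0.
have t00 : (0 < t0)%N by rewrite -(ltr_nat R); exact: lt_le_trans lo.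
have lo' : c6 <= Lam^-1 * t0%:R.
  rewrite mulrC ler_pdivlMr//; apply: le_trans lo; rewrite ler_peMr//; exact: mulr_ge0 (ltW c60) (ltW Lam0).
have hi' : Lam^-1 * t0%:R <= c6 * l + 1.
  rewrite ler_pdivrMl//; apply: (le_trans (ltW hi)).
  have -> : Lam * (c6 * l + 1) = c6 * Lam * l + Lam by ring.
  by rewrite lerD2l.
split=> //.
  rewrite -(mulrA 2); set u := Lam^-1 * _ in lo' hi' *.
  apply: (@le_trans _ _ (2 * (c6 * l + 1) * (c4 * l))).
    by rewrite ler_wpM2r ?mulr_ge0 ?(ltW c40) ?(ltW l0)// ler_wpM2l.
  have -> : 2 * (c6 * l + 1) * (c4 * l) = (4 * c4 * c6) * (l * l / 2) + (20 * c4) * (l / 10) by field.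
  have h1 : (4 * c4 * c6) * (l * l / 2) <= 1 * (l * l / 2).
    by rewrite ler_wpM2r// divr_ge0// mulr_ge0// ltW.
  have h2 : 20 * c4 * (l / 10) <= l * (l / 10) by rewrite ler_wpM2r// divr_ge0// ltW.
  have l2 : 0 <= l * l by rewrite mulr_ge0// ltW.
  by rewrite expr2; lra.
rewrite -(mulrA 2) lef_pV2 ?posrE ?mulr_gt0 ?invr_gt0 ?ltr0n//.
by rewrite ler_wpM2l.
Qed.

(** The smoothness bound is of order [K l ^ (4 L)], which the step size beats by
    several powers of the logarithm. *)
Lemma step_size_small (L : nat) (A Q c1 c3 c4 : R) : (0 < L)%N -> 0 <= A -> 0 <= Q ->
  0 < c1 -> 0 < c3 -> 0 < c4 ->
  exists D : R, forall (l Lam : R) (K : nat), (0 < K)%N -> 1 <= l -> D <= l ->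
    l ^+ (10 * L + 10) * K%:R `^ (3 / 2) <= Lam ->
    1 <= Lam /\
    Lam^-1 * smoothness_bound (L := L) A Q c3 (c4 * l) (c1 * l ^+ 2 + l) K <= 2^-1.
Proof.
move=> L0 A0 Q0 c10 c30 c40.
pose D1 : R := 1 + c4 + c4 / c3 + (c1 + 1).
pose D0 : R := 2 * A + 2 * Q + (1 + A) ^+ 2 + c3.
have D00 : 0 <= D0 by have := sqr_ge0 (1 + A); rewrite /D0; lra.
have q0 : 0 <= c4 / c3 by rewrite divr_ge0// ltW.
have D11 : 1 <= D1 by rewrite /D1; lra.
exists (2 * D0 * D1 ^+ (2 * L)) => l Lam K K0 l1 Dl LamP.
have l0 : 0 < l by exact: lt_le_trans l1.
have l2 : l <= l ^+ 2 by rewrite expr2 ler_peMr// ltW.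
have l3 : 1 <= l ^+ 2 by exact: le_trans l2.
have K1 : 1 <= K%:R :> R by rewrite ler1n.
have KK : K%:R <= K%:R `^ (3 / 2) :> R.
  by rewrite -[leLHS](powRr1 (ler0n _ _)) ler_powR//; lra.
have lP : 1 <= l ^+ (10 * L + 10) by rewrite exprn_ege1.
have Lam0 : l ^+ (10 * L + 10) * K%:R <= Lam.
  by apply: le_trans LamP; rewrite ler_wpM2l// (le_trans _ lP).
have Lam1 : 1 <= Lam.
  by apply: le_trans Lam0; rewrite -[leLHS]mulr1 ler_pM.
split=> //; rewrite ler_pdivrMl; last exact: lt_le_trans Lam1.
have y1 : 1 <= D1 * l ^+ 2 by rewrite -[leLHS]mulr1 ler_pM.
have c4l : c4 * l <= c4 * l ^+ 2 by rewrite ler_wpM2l// ltW.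
have cl3 : c4 / c3 * l <= c4 / c3 * l ^+ 2 by rewrite ler_wpM2l.
have c4l2 : 0 <= c4 * l ^+ 2 by rewrite mulr_ge0 ?sqr_ge0// ltW.
have cl4 : 0 <= c4 / c3 * l ^+ 2 by rewrite mulr_ge0 ?sqr_ge0.
have cl5 : 0 <= c1 * l ^+ 2 by rewrite mulr_ge0 ?sqr_ge0// ltW.
have y2 : 1 + c4 * l <= D1 * l ^+ 2 by rewrite /D1 !mulrDl !mul1r; lra.
have y3 : 1 + c4 * l / c3 <= D1 * l ^+ 2.
  by rewrite mulrAC /D1 !mulrDl !mul1r; lra.
have y4 : 0 <= c1 * l ^+ 2 + l <= D1 * l ^+ 2.
  by apply/andP; split; [|rewrite /D1 !mulrDl !mul1r]; lra.
have Phi0 : 0 <= c4 * l by rewrite mulr_ge0// ltW.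
apply: (le_trans (smoothness_bound_le K L0 A0 Q0 (ltW c30) Phi0 y1 y2 y3 y4)).
rewrite -/D0 exprMn -exprM.
have -> : K%:R * (D0 * (D1 ^+ (2 * L) * l ^+ (2 * (2 * L)))) =
   2 * D0 * D1 ^+ (2 * L) * (l ^+ (2 * (2 * L)) * K%:R / 2) by field.
apply: (@le_trans _ _ (l * (l ^+ (2 * (2 * L)) * K%:R / 2))).
  by rewrite ler_wpM2r// divr_ge0// mulr_ge0 ?exprn_ge0// ltW.
rewrite !mulrA -exprS ler_wpM2r ?invr_ge0//; apply: le_trans Lam0.
by rewrite ler_wpM2r// ler_weXn2l// mulnA -addn1 leq_add// leq_mul2r orbT.
Qed.
End Asymptotics.

Section EventualConditions.
Context {R : realType}.

(** A single random subnetwork hits the target with a probability of order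
    [n ^ (- r (d + 1) tau)], up to logarithms: only the [r (d + 1)] input weights
    range over an interval of polynomial length.  A block contains at least
    [n ^ (r (d + 1) tau + 1)] subnetworks, so the exponent of the failure
    probability is almost [n] and exceeds [(kappa + 1) log n]. *)
Lemma initialization_failure (d L r : nat) (c1 c2 tau kappa : R) :
  0 < c1 -> 0 < c2 -> 0 < kappa ->
  \forall n \near \oo, forall K Kt : nat, (0 < Kt <= K)%N -> K%:R <= n%:R `^ kappa ->
    2 <= K%:R / (Kt%:R * n%:R `^ ((r * d.+1)%:R * tau + 1)) ->
    Kt%:R * expR (- ((K %/ Kt)%N%:R *
      \prod_(b : inner_index d L r) (ln n%:R / 5 / (2 * inner_radius c1 c2 tau n b)))) <= n%:R^-1.
Proof.
move=> c10 c20 kappa0; pose N1 := (r * d.+1)%N; pose N2 := (L.-1 * r * r.+1)%N.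
pose D : R := 10 * (c1 + c2).
near=> n => K Kt /andP[Kt0 KtK] Kn ratio.
have n0 : (0 < n)%N by near: n; exists 1%N.
have l1 : 1 <= ln n%:R :> R by near: n; exact: ln_eventually_ge.
have poly : (kappa + 1) * D ^+ (N1 + N2) * ln n%:R ^+ (N1 + N2).+1 <= n%:R `^ (1 : R).
  by near: n; exact: polylog_le_power.
have nE : n%:R = expR (ln n%:R) :> R by rewrite lnK// posrE ltr0n.
have nuE : n%:R `^ ((r * d.+1)%:R * tau + 1) = (n%:R `^ tau) ^+ N1 * n%:R.
  rewrite powRD; last by rewrite pnatr_eq0 -lt0n n0 implybT.
  by rewrite powRr1// mulrC [_ * tau]mulrC powRrM powR_mulrn ?powR_ge0// mulrC.
have nR0 : 0 < n%:R :> R by rewrite ltr0n.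
have nu0 : 0 < n%:R `^ tau by exact: powR_gt0.
move: nuE nu0 ratio; set nu := n%:R `^ tau => nuE nu0; rewrite nuE => ratio.
set l := ln n%:R in l1 poly nE *.
have l0 : 0 < l by exact: lt_le_trans l1.
have D0 : 0 < D by rewrite mulr_gt0// addr_gt0.
have Dl0 : 0 < D * l by exact: mulr_gt0.
have c1l0 : 0 < 10 * c1 * l by rewrite !mulr_gt0.
have c2l0 : 0 < 10 * c2 * l by rewrite !mulr_gt0.
pose z : R := (D * l)^-1.
have z0 : 0 < z by rewrite invr_gt0.
have prod_ge : z ^+ (N1 + N2) / nu ^+ N1 <=
    \prod_(b : inner_index d L r) (l / 5 / (2 * inner_radius c1 c2 tau n b)).
  rewrite big_sumType/= !prodr_const !card_prod !card_ord -/nu -/l.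
  rewrite [leLHS](_ : _ = (z / nu) ^+ N1 * z ^+ N2); last first.
    by rewrite exprD [(z / nu) ^+ N1]exprMn [nu^-1 ^+ N1]exprVn mulrAC.
  apply: ler_pM; rewrite ?exprn_ge0 ?divr_ge0 ?(ltW z0) ?(ltW nu0)//.
    rewrite lerXn2r ?nnegrE ?divr_ge0 ?mulr_ge0 ?sqr_ge0 ?(ltW z0) ?(ltW nu0) ?(ltW l0) ?(ltW c20)//.
    have -> : l / 5 / (2 * (c2 * l ^+ 2 * nu)) = (10 * c2 * l)^-1 / nu.
      by field; rewrite !gt_eqF.
    rewrite ler_wpM2r ?invr_ge0 ?(ltW nu0)// lef_pV2 ?posrE//.
    by rewrite ler_wpM2r ?(ltW l0)// ler_wpM2l// lerDr ltW.
  rewrite lerXn2r ?nnegrE ?divr_ge0 ?mulr_ge0 ?sqr_ge0 ?(ltW z0) ?(ltW l0) ?(ltW c10)//.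
  have -> : l / 5 / (2 * (c1 * l ^+ 2)) = (10 * c1 * l)^-1.
    by field; rewrite !gt_eqF.
  rewrite lef_pV2 ?posrE//.
  by rewrite ler_wpM2r ?(ltW l0)// ler_wpM2l// lerDl ltW.
have KtR : 0 < Kt%:R :> R by rewrite ltr0n.
have q_ge : nu ^+ N1 * n%:R <= (K %/ Kt)%N%:R.
  have q1 : (0 < K %/ Kt)%N by rewrite divn_gt0.
  have := ltn_ceil K Kt0; rewrite -(ltr_nat R) natrM => Kq.
  have : 2 * (Kt%:R * (nu ^+ N1 * n%:R)) <= K%:R.
    by move: ratio; rewrite ler_pdivlMr// !mulr_gt0// exprn_gt0.
  move=> /le_lt_trans /(_ Kq); rewrite mulrCA mulrC ltr_pM2r// => H.
  have q2 : (K %/ Kt).+1%:R <= 2 * (K %/ Kt)%N%:R :> R.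
    by rewrite -natrM ler_nat mul2n -addnn -addn1 leq_add2l.
  by have := lt_le_trans H q2; rewrite ltr_pM2l// => /ltW.
set q := (K %/ Kt)%N%:R in q_ge *; set pr := \prod_b _ in prod_ge *.
have expo : (kappa + 1) * l <= q * pr.
  apply: (@le_trans _ _ (nu ^+ N1 * n%:R * (z ^+ (N1 + N2) / nu ^+ N1))); last first.
    apply: ler_pM => //; first by rewrite mulr_ge0 ?exprn_ge0// ltW.
    by rewrite divr_ge0 ?exprn_ge0// ltW.
  rewrite [leRHS](_ : _ = n%:R * z ^+ (N1 + N2)); last by field; rewrite gt_eqF ?exprn_gt0.
  rewrite /z exprVn ler_pdivlMr ?(exprn_gt0 _ Dl0)// exprMn.
  rewrite powRr1// exprS in poly; apply: le_trans poly.
  by rewrite le_eqVlt; apply/orP; left; apply/eqP; ring.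
apply: (@le_trans _ _ (n%:R `^ kappa * expR (- ((kappa + 1) * l)))).
  apply: ler_pM; rewrite ?expR_ge0//; first by rewrite (le_trans _ Kn)// ler_nat.
  by rewrite ler_expR lerN2.
rewrite powR_expR_ln// -/l -expRD.
have -> : kappa * l + - ((kappa + 1) * l) = - l by ring.
by rewrite expRN -nE.
Unshelve. all: by end_near. Qed.

(** The sides [h] of the cubes are chosen such that the local expansion
    parameter [d A h] is a small negative power of [n]; a fixed order [k] of the
    expansion then makes the approximation error smaller than [1 / n]. *)
Lemma code_parameters (d e p k : nat) (C M c1 c2 c3 c4 tau kappa eps : R) : (0 < d)%N ->
  0 <= M -> 1 <= C -> 0 < c1 -> 0 < c2 -> 0 < c3 -> 0 < c4 -> 0 < tau -> 0 < kappa -> 0 < eps ->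
  kappa + 2 <= k%:R * (eps / (2 * d%:R)) ->
  \forall n \near \oo, forall K : nat, K%:R <= n%:R `^ kappa ->
  let l := ln n%:R in let rho := n%:R `^ (- (eps / (2 * d%:R))) in
  let A := c2 * l ^+ 2 * n%:R `^ tau + l in
  let H := K%:R * (1 + c4 * l / c3 + c1 * l ^+ 2) * (C * (c1 * l ^+ 2 + l) ^+ e) in
  exists (h : R) (G N : nat), [/\ 0 < h, d%:R * A * h = rho /\ rho <= 1, M / h < G.+1%:R,
    2 * H / n%:R^-1 < N.+1%:R & 2 * H * rho ^+ k <= 2 / n%:R /\
    l ^+ 2 * ((G.+1 ^ d * p)%N%:R * ln N.+1%:R) <= p%:R * (kappa + 3) * n%:R `^ (tau * d%:R + eps)].
Proof.
move=> d0 M0 C1 c10 c20 c30 c40 tau0 kappa0 eps0 kP.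
pose del := eps / (2 * d%:R).
have dR : 0 < d%:R :> R by rewrite ltr0n.
have del0 : 0 < del by rewrite divr_gt0// mulr_gt0.
pose D1 : R := 1 + c4 / c3 + c1 + 1.
pose D3 : R := M * d%:R * (c2 + 1) + 1.
near=> n => K Kn.
have l1 : 1 <= ln n%:R :> R by near: n; exact: ln_eventually_ge.
have poly1 : D1 * C * D1 ^+ e * ln n%:R ^+ (2 * e.+1) <= n%:R `^ (1 : R).
  by near: n; exact: polylog_le_power.
have poly2 : D3 ^+ d * ln n%:R ^+ (2 * d + 3) <= n%:R `^ (eps / 2).
  by near: n; apply: polylog_le_power; rewrite divr_gt0.
set l := ln n%:R in l1 poly1 poly2 *; set rho := n%:R `^ (- (eps / (2 * d%:R))).
set A := c2 * l ^+ 2 * n%:R `^ tau + l.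
set H := K%:R * (1 + c4 * l / c3 + c1 * l ^+ 2) * (C * (c1 * l ^+ 2 + l) ^+ e).
have n3 : (3 <= n)%N by near: n; exists 3%N.
have n0 : (0 < n)%N by exact: leq_trans n3.
have nR0 : 0 < n%:R :> R by rewrite ltr0n.
have nR1 : 1 <= n%:R :> R by rewrite ler1n.
have l0 : 0 < l by exact: lt_le_trans l1.
have l2 : l <= l ^+ 2 by rewrite expr2 ler_peMr// ltW.
have l3 : 1 <= l ^+ 2 by exact: le_trans l2.
have nu1 : 1 <= n%:R `^ tau.
  by rewrite powR_expR_ln// -[leLHS]expR0 ler_expR; exact: mulr_ge0 (ltW tau0) (ltW l0).
have rho0 : 0 < rho by exact: powR_gt0.
have rho1 : rho <= 1.
  by rewrite /rho powR_expR_ln// -[leRHS]expR0 ler_expR mulNr oppr_le0; exact: mulr_ge0 (ltW del0) (ltW l0).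
have Apos : 0 < A by rewrite addr_gt0 // !mulr_gt0 ?exprn_gt0 ?powR_gt0.
have dA : 0 < d%:R * A by rewrite mulr_gt0.
pose h := rho / (d%:R * A).
have h0 : 0 < h by rewrite divr_gt0.
have q0 : 0 <= c4 / c3 by rewrite divr_ge0// ltW.
have cl3 : c4 / c3 * l <= c4 / c3 * l ^+ 2 by rewrite ler_wpM2l.
have cl4 : 0 <= c4 / c3 * l ^+ 2 by rewrite mulr_ge0 ?sqr_ge0.
have cl5 : 0 <= c1 * l ^+ 2 by rewrite mulr_ge0 ?sqr_ge0// ltW.
have D11 : 1 <= D1 by rewrite /D1; lra.
have a0 : 0 <= 1 + c4 * l / c3 + c1 * l ^+ 2.
  by rewrite !addr_ge0// divr_ge0 ?mulr_ge0// ltW.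
have B0 : 0 <= c1 * l ^+ 2 + l by rewrite addr_ge0// ltW.
have a1 : 1 + c4 * l / c3 + c1 * l ^+ 2 <= D1 * l ^+ 2.
  by rewrite mulrAC /D1 !mulrDl !mul1r; lra.
have B1 : c1 * l ^+ 2 + l <= D1 * l ^+ 2 by rewrite /D1 !mulrDl !mul1r; lra.
have D10 : 0 <= D1 * l ^+ 2 by exact: le_trans B1.
have C0 : 0 <= C by exact: le_trans C1.
have HH : H <= n%:R `^ kappa * n%:R.
  rewrite /H -mulrA; apply: ler_pM => //.
    by rewrite mulr_ge0// mulr_ge0// exprn_ge0.
  rewrite powRr1// in poly1; apply: le_trans poly1.
  rewrite [leRHS](_ : _ = (D1 * l ^+ 2) * (C * (D1 * l ^+ 2) ^+ e)); last first.
    by rewrite mulnS exprD (exprM l) (exprMn e D1); ring.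
  apply: ler_pM => //; first by rewrite mulr_ge0 ?exprn_ge0.
  by rewrite ler_wpM2l// lerXn2r.
have H0 : 0 <= H.
  have b0 : 0 <= C * (c1 * l ^+ 2 + l) ^+ e by exact: mulr_ge0 C0 (exprn_ge0 e B0).
  exact: mulr_ge0 (mulr_ge0 (ler0n _ _) a0) b0.
have nk : n%:R `^ kappa * n%:R * rho ^+ k <= n%:R^-1.
  rewrite -powR_mulrn ?powR_ge0// -powRrM.
  rewrite -[X in _ * X * _](powRr1 (ltW nR0)) -!powRD ?(gt_eqF nR0) ?implybT//.
  rewrite -[leRHS]powR_inv1 ?(ltW nR0)// ler_powR// -/del; move: kP; rewrite -/del => kP.
  have -> : - del * k%:R = - (k%:R * del) by ring.
  lra.
pose Mh := M / h; pose Hn := 2 * H / n%:R^-1.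
have Mh0 : 0 <= Mh by rewrite divr_ge0// ltW.
have Hn0 : 0 <= Hn by rewrite divr_ge0 ?invr_ge0 ?(ltW nR0)// mulr_ge0.
have /andP[G1 G2] := truncn_itv Mh0.
have /andP[N1 N2] := truncn_itv Hn0.
exists h, (Num.trunc Mh), (Num.trunc Hn); split => //.
  by split=> //; rewrite /h mulrC divfK// gt_eqF.
split.
  rewrite -mulrA ler_wpM2l//; apply: le_trans nk.
  by rewrite ler_wpM2r// exprn_ge0// ltW.
set G := Num.trunc Mh in G1 G2 *; set N := Num.trunc Hn in N1 N2 *.
have lnN : ln N.+1%:R <= (kappa + 3) * l.
  rewrite -[leRHS]expRK ler_ln ?posrE ?ltr0n ?expR_gt0// -powR_expR_ln//.
  have n1 : 1 <= n%:R `^ kappa.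
    by rewrite powR_expR_ln// -[leLHS]expR0 ler_expR; exact: mulr_ge0 (ltW kappa0) (ltW l0).
  have -> : n%:R `^ (kappa + 3) = n%:R `^ kappa * n%:R * n%:R * n%:R.
    rewrite powRD ?(gt_eqF nR0) ?implybT//.
    by rewrite powR_mulrn ?(ltW nR0)// !exprS expr0 mulr1 !mulrA.
  set u := n%:R `^ kappa * n%:R * n%:R.
  have u1 : 1 <= u.
    by rewrite -[leLHS]mulr1 ler_pM// -[leLHS]mulr1 ler_pM.
  have Hu : Hn <= 2 * u.
    by rewrite /Hn invrK -mulrA ler_wpM2l// ler_wpM2r// ltW.
  have n3R : 3 <= n%:R :> R by rewrite ler_nat.
  rewrite -addn1 natrD; apply: (@le_trans _ _ (2 * u + u)).
    by apply: lerD => //; exact: le_trans Hu.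
  have -> : 2 * u + u = u * 3 by ring.
  by rewrite ler_wpM2l// (le_trans _ u1).
have Al : A <= (c2 + 1) * (l ^+ 2 * n%:R `^ tau).
  rewrite /A mulrDl mul1r mulrA lerD2l; apply: (le_trans l2).
  by rewrite ler_peMr// sqr_ge0.
have GG : G.+1%:R <= D3 * (l ^+ 2 * n%:R `^ (tau + del)).
  have w1 : 1 <= l ^+ 2 * n%:R `^ (tau + del).
    rewrite -[leLHS]mulr1 ler_pM// powR_expR_ln// -[leLHS]expR0 ler_expR.
    exact: mulr_ge0 (addr_ge0 (ltW tau0) (ltW del0)) (ltW l0).
  rewrite -addn1 natrD /D3 mulrDl mul1r; apply: lerD => //.
  apply: (le_trans G1); rewrite /Mh /h invf_div.
  have -> : M * (d%:R * A / rho) = M * d%:R * A * n%:R `^ del.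
    by rewrite /rho powRN invrK !mulrA.
  rewrite powRD ?(gt_eqF nR0) ?implybT//.
  rewrite [leRHS](_ : _ = M * d%:R * ((c2 + 1) * (l ^+ 2 * n%:R `^ tau)) * n%:R `^ del); last by ring.
  by rewrite ler_wpM2r ?powR_ge0// ler_wpM2l// mulr_ge0.
have D30 : 0 <= D3 by rewrite addr_ge0// !mulr_ge0// addr_ge0// ltW.
rewrite natrM natrX.
have GD : G.+1%:R ^+ d <= D3 ^+ d * l ^+ (2 * d) * n%:R `^ (tau * d%:R + eps / 2).
  apply: (@le_trans _ _ ((D3 * (l ^+ 2 * n%:R `^ (tau + del))) ^+ d)).
    by apply: (lerXn2r _ _ _ GG); rewrite nnegrE// (le_trans _ GG).
  rewrite (exprMn d D3) (exprMn d (l ^+ 2)) -(exprM l) mulrA.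
  rewrite -[(n%:R `^ (tau + del)) ^+ d]powR_mulrn ?powR_ge0// -powRrM.
  by have -> : (tau + del) * d%:R = tau * d%:R + eps / 2 by rewrite /del; field; rewrite gt_eqF.
have lnN0 : 0 <= ln N.+1%:R :> R by rewrite ln_ge0// ler1n.
apply: (@le_trans _ _ (l ^+ 2 * (D3 ^+ d * l ^+ (2 * d) * n%:R `^ (tau * d%:R + eps / 2) * p%:R *
    ((kappa + 3) * l)))).
  rewrite ler_wpM2l ?sqr_ge0//; apply: ler_pM => //.
  by rewrite ler_wpM2r.
have -> : tau * d%:R + eps = (tau * d%:R + eps / 2) + eps / 2 by field.
rewrite [in leRHS]powRD ?(gt_eqF nR0) ?implybT//.
rewrite [leLHS](_ : _ = p%:R * (kappa + 3) * (n%:R `^ (tau * d%:R + eps / 2) *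
   (D3 ^+ d * l ^+ (2 * d + 3)))); last by rewrite exprD; ring.
have pk : 0 <= p%:R * (kappa + 3) by rewrite mulr_ge0// addr_ge0// ltW.
by rewrite ler_wpM2l// ler_wpM2l// powR_ge0.
Unshelve. all: by end_near. Qed.
End EventualConditions.

Section FinalBound.
Context {R : realType}.

(** Every term apart from the approximation error and the penalty is at most a
    constant times [l ^ 2 / n] or [l ^ 2 lnN / n]. *)
Lemma oracle_bound_le (c3 c4 c5 c6 C0 rc Cc : R) : 0 < c3 -> 0 < c4 -> 0 < c5 -> 0 < c6 ->
  0 <= C0 -> 0 <= rc -> 0 <= Cc -> 1 <= c4 * c5 ->
  exists2 c : R, 0 < c & forall (n : nat) (l w res lnN S s u pA : R), (0 < n)%N -> l = ln n%:R ->
    1 <= l -> 2 <= c4 * l -> l ^+ 2 / n%:R <= w -> 0 <= res <= rc / n%:R ->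
    l ^+ 2 * lnN <= Cc * (w * n%:R) -> 0 <= S -> 0 <= s -> u <= (2 * c6)^-1 -> pA <= n%:R^-1 ->
    oracle_bound (c4 * l) (C0 * expR (- (c5 * (c4 * l) ^+ 2 / 2))) (n := n) c5 C0 res lnN
      ((c3 + u) * S) pA s <= c * (w + S + s).
Proof.
move=> c30 c40 c50 c60 C00 rc0 Cc0 c45.
have k0 : 0 <= (2 * c6)^-1 by rewrite invr_ge0 mulr_ge0// ltW.
pose a1 := 1280 * c4 ^+ 2 * Cc + 80 * c4 * C0 + 80 * c4 * rc + 15 * rc ^+ 2 + 2560 * c4 ^+ 2 +
  4 * c4 ^+ 2 * (2 * C0 + 1).
have m4 : 0 <= c4 ^+ 2 by exact: sqr_ge0.
have m5 : 0 <= c4 ^+ 2 * Cc by exact: mulr_ge0.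
have m6 : 0 <= c4 * C0 := mulr_ge0 (ltW c40) C00.
have m7 : 0 <= c4 * rc := mulr_ge0 (ltW c40) rc0.
have m8 : 0 <= c4 ^+ 2 * C0 by exact: mulr_ge0.
have m9 : 0 <= rc ^+ 2 by exact: sqr_ge0.
have k1 : 0 <= 256 * c4 ^+ 2 := mulr_ge0 (ler0n _ 256) m4.
have k2 : 0 <= 16 * (c4 * C0) := mulr_ge0 (ler0n _ 16) m6.
have k3 : 0 <= 16 * c4 := mulr_ge0 (ler0n _ 16) (ltW c40).
have k5 : 0 <= 2560 * c4 ^+ 2 := mulr_ge0 (ler0n _ 2560) m4.
have k6 : 0 <= 4 * c4 ^+ 2 := mulr_ge0 (ler0n _ 4) m4.
have a10 : 0 <= a1 by rewrite /a1; lra.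
exists (a1 + 4 * (c3 + (2 * c6)^-1) + 12).
  by lra.
move=> n l w res lnN S s u pA n0 lE l1 c4l lw /andP[res0 resP] lnNP S0 s0 uP pAP.
have nR0 : 0 < n%:R :> R by rewrite ltr0n.
have nR1 : 1 <= n%:R :> R by rewrite ler1n.
have l0 : 0 < l by exact: lt_le_trans l1.
have nE : n%:R^-1 = expR (- l) by rewrite lE expRN lnK// posrE.
set x := (n%:R : R)^-1 in lw resP pAP nE *.
have x0 : 0 < x by rewrite invr_gt0.
have x1 : x <= 1 by rewrite invf_le1.
have nx : n%:R * x = 1 by rewrite divff// gt_eqF.
have lx : l * x <= l ^+ 2 * x by rewrite ler_wpM2r ?(ltW x0)// expr2 ler_peMr// ltW.
have xw : x <= w.
  by apply: le_trans lw; apply: le_trans lx; rewrite ler_peMl// ltW.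
have w0 : 0 <= w by exact: le_trans (ltW x0) xw.
set t := expR (- (c5 * (c4 * l) ^+ 2 / 2)).
have tx : t <= x.
  rewrite nE ler_expR lerN2.
  have -> : c5 * (c4 * l) ^+ 2 / 2 = (c4 * c5) * ((c4 * l) * l / 2) by ring.
  have h : l <= c4 * l * l / 2 by rewrite ler_pdivlMr// mulrC ler_wpM2r// ltW.
  by apply: (le_trans h); rewrite ler_peMl// (le_trans _ h)// ltW.
have t0 : 0 <= t by exact: expR_ge0.
have TE : expR (- (c5 * (c4 * l) ^+ 2)) = t * t by rewrite /t -expRD; congr expR; field.
have ll0 : 0 <= l ^+ 2 by exact: sqr_ge0.
have h1 : l ^+ 2 * lnN * x <= Cc * w.
  have -> : Cc * w = Cc * (w * n%:R) * x by rewrite -!mulrA nx mulr1.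
  by rewrite ler_wpM2r// ltW.
have h2 : l * t <= w by apply: le_trans (le_trans lx lw); rewrite ler_wpM2l// ltW.
have h3 : l * res <= rc * w.
  apply: (@le_trans _ _ (rc * (l * x))).
    by rewrite mulrCA ler_wpM2l// ltW.
  by rewrite ler_wpM2l// (le_trans lx).
have h4 : res ^+ 2 <= rc ^+ 2 * w.
  apply: (@le_trans _ _ ((rc * x) ^+ 2)).
    by rewrite lerXn2r ?nnegrE// (le_trans res0).
  rewrite exprMn ler_wpM2l ?sqr_ge0//; apply: le_trans xw.
  by rewrite expr2 ler_piMr// ltW.
have k7 : 0 <= 2 * C0 + 1 := addr_ge0 (mulr_ge0 (ler0n _ 2) C00) ler01.
have h6 : l ^+ 2 * (C0 * x + t * t * (n%:R * C0) + pA) <= (2 * C0 + 1) * w.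
  have h : t * t * (n%:R * C0) <= C0 * x.
    apply: (@le_trans _ _ (x * x * (n%:R * C0))).
      by rewrite ler_wpM2r ?mulr_ge0// ler_pM.
    rewrite [leLHS](_ : _ = C0 * x * (n%:R * x)); last by ring.
    by rewrite nx mulr1.
  apply: (@le_trans _ _ (l ^+ 2 * ((2 * C0 + 1) * x))).
    have -> : (2 * C0 + 1) * x = C0 * x + C0 * x + x by ring.
    by rewrite ler_wpM2l// lerD// lerD2l.
  by rewrite mulrCA ler_wpM2l.
have uS : u * S <= (2 * c6)^-1 * S by rewrite ler_wpM2r.
rewrite /oracle_bound /tilt TE -/t -/x.
have -> : 4 / (n%:R * (64 * (c4 * l) ^+ 2)^-1) * lnN = 256 * c4 ^+ 2 * (l ^+ 2 * lnN * x).
  by rewrite /x; field; rewrite !gt_eqF.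
have -> : 40 / (n%:R * (64 * (c4 * l) ^+ 2)^-1) = 2560 * c4 ^+ 2 * (l ^+ 2 * x).
  by rewrite /x; field; rewrite !gt_eqF.
have -> : 4 * (c4 * l) ^+ 2 * (C0 * x + t * t * (n%:R * C0) + pA) =
  4 * c4 ^+ 2 * (l ^+ 2 * (C0 * x + t * t * (n%:R * C0) + pA)) by ring.
have -> : 16 * (c4 * l) * (C0 * t) = 16 * (c4 * C0) * (l * t) by ring.
have -> : 16 * (c4 * l) * res = 16 * c4 * (l * res) by ring.
have g1 := ler_wpM2l k1 h1.
have g2 := ler_wpM2l k2 h2.
have g3 := ler_wpM2l k3 h3.
have g5 := ler_wpM2l k5 lw.
have g6 := ler_wpM2l k6 h6.
have -> : (a1 + 4 * (c3 + (2 * c6)^-1) + 12) * (w + S + s) = a1 * w + a1 * (S + s) +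
   4 * (c3 * S + (2 * c6)^-1 * S) + 4 * (c3 + (2 * c6)^-1) * (w + s) + 12 * s + 12 * (w + S) by ring.
have p1 : 0 <= a1 * (S + s) by rewrite mulr_ge0// addr_ge0.
have p2 : 0 <= 4 * (c3 + (2 * c6)^-1) * (w + s).
  exact: mulr_ge0 (mulr_ge0 (ler0n _ 4) (addr_ge0 (ltW c30) k0)) (addr_ge0 w0 s0).
have -> : (c3 + u) * S = c3 * S + u * S by rewrite mulrDl.
move: g1 g2 g3 h4 g5 g6 p1 p2 uS.
set X1 := 256 * _ * (_ * x); set X2 := 16 * _ * (l * t); set X3 := 16 * c4 * (l * res).
set X5 := 2560 * _ * (_ * x); set X6 := 4 * _ * (_ * (_ + pA)).
set Y1 := a1 * (S + s); set Y2 := 4 * _ * (w + s); set Y3 := u * S; set Y4 := (2 * c6)^-1 * S.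
rewrite /a1; move: S0 s0 w0; clear.
move=> *; lra.
Qed.
End FinalBound.

(** * The risk of the estimate *)

Section Estimate.
Context {dT : measure_display} {T : measurableType dT} {R : realType} (P : probability T R).
Context {d L r : nat} (r_gt0 : (0 < r)%N).
Context (X : {RV P >-> d.-tuple R}) (Y : {RV P >-> R}) (m : d.-tuple R -> R).

Lemma measurable_estimate (c3 c4 lambda : R) (t n K : nat) (x : 'I_n -> d.-tuple R) (y : 'I_n -> R)
    (v : 'I_K -> inner_index d L r -> R) :
  measurable_fun setT (estimate r_gt0 c3 c4 lambda t x y v).
Proof.
apply: (measurableT_comp (@measurable_truncate R (c4 * ln n%:R))).
exact: measurable_combination.
Qed.

Lemma estimate_norm_le (c3 c4 lambda : R) (t n K : nat) (x : 'I_n -> d.-tuple R) (y : 'I_n -> R)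
    (v : 'I_K -> inner_index d L r -> R) z : 0 <= c4 -> (0 < n)%N ->
  `|estimate r_gt0 c3 c4 lambda t x y v z| <= c4 * ln n%:R.
Proof. by move=> c40 n0; rewrite truncate_norm_le// mulr_ge0// ln_ge0// ler1n. Qed.

(** Both the estimate and the regression function are bounded, which settles
    the finitely many sample sizes that the asymptotic argument leaves out. *)
Lemma crude_risk_bound (c3 c4 lambda b : R) (t n K : nat) (Xs : 'I_n -> {RV P >-> d.-tuple R})
    (Ys : 'I_n -> {RV P >-> R}) (V : 'I_K -> inner_index d L r -> {RV P >-> R}) :
  regression_function X Y m -> (0 < n)%N -> 0 <= c4 -> 0 < b -> (forall x, `|m x| <= b) ->
  c4 * ln n%:R <= b ->
  (\int[P]_w (l2_dist2 X m (estimate r_gt0 c3 c4 lambda t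
      (fun i => Xs i w) (fun i => Ys i w) (fun k j => V k j w)))%:E <= (4 * b ^+ 2)%:E)%E.
Proof.
move=> regr n0 c40 b0 mb cb.
have [_ _] := mean_le_cst P (mulr_ge0 (ler0n R 4) (sqr_ge0 b)); apply: le_trans.
apply: le_integral_majorant => w; first by rewrite Rintegral_ge0// => ? _; exact: sqr_ge0.
apply: (l2_dist2_le regr b0 mb); first exact: measurable_estimate.
by move=> x; apply: le_trans cb; exact: estimate_norm_le.
Qed.
End Estimate.

Theorem theorem1 (R : realType) (d L r : nat)
  (d_gt0 : (0 < d)%N) (L_gt0 : (0 < L)%N) (r_gt0 : (0 < r)%N)
  (tau c1 c2 c3 c4 c5 c6 : R)
  (tau_gt0 : 0 < tau) (c1_gt0 : 0 < c1) (c2_gt0 : 0 < c2) (c3_gt0 : 0 < c3)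
  (c4_gt0 : 0 < c4) (c5_gt0 : 0 < c5) (c6_gt0 : 0 < c6)
  (disp : measure_display) (T : measurableType disp) (P : probability T R)
  (X : {RV P >-> d.-tuple R}) (Y : {RV P >-> R}) (m : d.-tuple R -> R)
  (Xs : forall n, 'I_n -> {RV P >-> d.-tuple R})
  (Ys : forall n, 'I_n -> {RV P >-> R})
  (K Kt t : nat -> nat) (Ln lambda : nat -> R)
  (V : forall n, 'I_(K n) -> inner_index d L r -> {RV P >-> R})
  (a : forall n, 'I_(Kt n) -> R)
  (v : forall n, 'I_(Kt n) -> inner_index d L r -> R) :
  (* data and initial weights *)
  (forall n, (0 < n)%N ->
    mutually_independent P (sample_events X Y (@Xs n) (@Ys n) (@V n))) ->
  (forall n, (0 < n)%N -> forall i : 'I_n,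
    same_law P (fun w => (Xs n i w, Ys n i w)) (fun w => (X w, Y w))) ->
  (forall n, (0 < n)%N -> forall k b,
    uniformly_distributed (V n k b)
      (- inner_radius c1 c2 tau n b) (inner_radius c1 c2 tau n b)) ->
  bounded_in_Rd (law_support (distribution P X)) ->
  ('E_P[(fun w => expR (c5 * Y w ^+ 2))] < +oo)%E ->
  regression_function X Y m ->
  bounded_fun m ->
  (* the fixed weights *)
  (forall n, (0 < n)%N -> (0 < Kt n <= K n)%N) ->
  (forall n, (0 < n)%N -> forall k, `|a n k| <= c1 * ln n%:R ^+ 2) ->
  (forall n, (0 < n)%N -> forall k b,
    `|v n k b| <= inner_radius c1 c2 tau n b) ->
  (forall n, (0 < n)%N -> forall vb : 'I_(Kt n) -> inner_index d L r -> R,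
    (forall k b, `|vb k b - v n k b| <= ln n%:R) ->
    forall x, law_support (distribution P X) x ->
    `|combination r_gt0 (a n) vb x| <= c4 * ln n%:R) ->
  (* growth conditions *)
  (exists2 kappa : R, 0 < kappa &
    (K n)%:R / n%:R `^ kappa @[n --> \oo] --> (0 : R)) ->
  (K n)%:R / ((Kt n)%:R * n%:R `^ ((r * d.+1)%:R * tau + 1)) @[n --> \oo]
    --> (+oo : set_system R) ->
  (forall n, (0 < n)%N -> 0 < Ln n) ->
  (forall n, (0 < n)%N ->
    ln n%:R ^+ (10 * L + 10) * (K n)%:R `^ (3 / 2) <= Ln n) ->
  (forall n, (0 < n)%N -> (t n)%:Z = Num.ceil (c6 * Ln n * ln n%:R)) ->
  (forall n, (0 < n)%N -> lambda n = (Ln n)^-1) ->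
  1 <= 2 * c3 * c6 -> 1 <= c4 * c5 -> 4 * c4 * c6 <= 1 ->
  forall eps : R, 0 < eps ->
  exists2 c7 : R, 0 < c7 & forall n, (0 < n)%N ->
    (\int[P]_w \int[distribution P X]_x
       (`|estimate r_gt0 c3 c4 (lambda n) (t n)
            (fun i => Xs n i w) (fun i => Ys n i w) (fun k b => V n k b w) x
          - m x| ^+ 2)%R%:E
     <= c7%:E *
        ((n%:R `^ (tau * d%:R + eps) / n%:R)%R%:E
         + (\sum_(k < Kt n) `|a n k| ^+ 2)%R%:E
         + ereal_sup
             [set (\int[distribution P X]_x
                     (`|combination r_gt0 (a n) vb x - m x| ^+ 2)%R%:E)%E
             | vb in [set vb : 'I_(Kt n) -> inner_index d L r -> R |
                 forall k b, (`|vb k b - v n k b| <= ln n%:R)%R]]))%E.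
Proof.
move=> indep same unif [M0 suppM0] moment regr mbd KtK aB vB suppb [kappa kappa0 Kk] ratio Ln0 LnP
  tE laE cc1 cc2 cc3 eps eps0.
have [mm _ _] := regr.
pose M := Num.max M0 0.
have M_ge0 : 0 <= M by rewrite le_max lexx orbT.
have suppM x : law_support (distribution P X) x -> forall j, `|tnth x j| <= M.
  by move=> xs j; rewrite le_max suppM0.
have [Mm Mm0 mM] : exists2 b : R, 0 < b & forall x, `|m x| <= b.
  have [B [_ HB]] := mbd; exists (`|B| + 1); first by rewrite ltr_wpDl.
  move=> x; apply: (HB (`|B| + 1)) => //.
  by rewrite (le_lt_trans (ler_norm B))// ltrDl.
pose C0 : R := fine 'E_P[(fun w => expR (c5 * Y w ^+ 2))].
have moment0 : (0 <= 'E_P[(fun w => expR (c5 * Y w ^+ 2))])%E.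
  by apply: expectation_ge0 => w; exact: expR_ge0.
have C00 : 0 <= C0 by exact: fine_ge0.
have momentE : (\int[P]_t (expR (c5 * Y t ^+ 2))%:E <= C0%:E)%E.
  by rewrite /C0 fineK ?ge0_fin_numE// unlock.
pose risk n : \bar R := (\int[P]_w (l2_dist2 X m (estimate r_gt0 c3 c4 (lambda n) (t n)
      (fun i => Xs n i w) (fun i => Ys n i w) (fun k b => V n k b w)))%:E)%E.
have riskE n : (0 < n)%N ->
  (\int[P]_w \int[distribution P X]_x
       (`|estimate r_gt0 c3 c4 (lambda n) (t n)
            (fun i => Xs n i w) (fun i => Ys n i w) (fun k b => V n k b w) x
          - m x| ^+ 2)%R%:E = risk n)%E.
  move=> n0; apply: eq_integral => w _.
  apply: (@l2_dist2_distribution _ _ _ _ _ _ _ (c4 * ln n%:R + Mm)) => //.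
    exact: measurable_estimate.
  move=> x; apply: (le_trans (ler_normB _ _)); apply: lerD => //.
  by apply: estimate_norm_le => //; exact: ltW.
pose Q n : R := n%:R `^ (tau * d%:R + eps) / n%:R.
pose S n : R := \sum_(k < Kt n) `|a n k| ^+ 2.
pose sup n : \bar R := ereal_sup
             [set (\int[distribution P X]_x
                     (`|combination r_gt0 (a n) vb x - m x| ^+ 2)%R%:E)%E
             | vb in [set vb : 'I_(Kt n) -> inner_index d L r -> R |
                 forall k b, (`|vb k b - v n k b| <= ln n%:R)%R]].
have S0 n : 0 <= S n by apply: sumr_ge0 => k _; exact: exprn_ge0.
have sup_ub n vb : (forall k b, `|vb k b - v n k b| <= ln n%:R) ->
    (\int[distribution P X]_x (`|combination r_gt0 (a n) vb x - m x| ^+ 2)%R%:E <= sup n)%E.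
  by move=> H; apply: ereal_sup_ubound; exists vb.
have sup_ge0 n : (0 < n)%N -> (0 <= sup n)%E.
  move=> n0; apply: le_trans (sup_ub n (v n) _).
    by apply: integral_ge0 => x _; rewrite lee_fin exprn_ge0.
  by move=> k b; rewrite subrr normr0 ln_ge0// ler1n.
have suff_fin (c7 : R) n : (0 < n)%N -> 0 < c7 ->
    (forall s : R, 0 <= s -> sup n = s%:E -> (risk n <= (c7 * (Q n + S n + s))%:E)%E) ->
    (risk n <= c7%:E * ((Q n)%:E + (S n)%:E + sup n))%E.
  move=> n0 c70; have := sup_ge0 n n0; case: (sup n) => [s s0 H|_ _|//].
    by rewrite -!EFinD -EFinM; apply: H => //; rewrite -lee_fin.
  by rewrite -EFinD addey// mulry gtr0_sg// mul1e leey.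
suff [c c0 [n1 large]] : exists2 c : R, 0 < c & exists n1 : nat, forall n, (n1 <= n)%N -> (0 < n)%N ->
    forall s : R, 0 <= s -> sup n = s%:E -> (risk n <= (c * (Q n + S n + s))%:E)%E.
  (* Sample sizes below [n1]: the risk is bounded, and the first term on the right
     is at least [1 / n]. *)
  pose b := c4 * ln n1.+1%:R + Mm.
  have ln1 : 0 <= ln n1.+1%:R :> R by rewrite ln_ge0// ler1n.
  have b0 : 0 < b by rewrite ltr_wpDl// mulr_ge0// ltW.
  have b2 : 0 <= 4 * b ^+ 2 := mulr_ge0 (ler0n _ 4) (sqr_ge0 b).
  have b2n : 0 <= 4 * b ^+ 2 * n1.+1%:R := mulr_ge0 b2 (ler0n _ _).
  have c7 : 0 < c + 4 * b ^+ 2 * n1.+1%:R by rewrite ltr_pwDl.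
  exists (c + 4 * b ^+ 2 * n1.+1%:R) => //.
  move=> n n0; rewrite riskE//; apply: suff_fin => //.
  move=> s s0 sE; have nR0 : 0 < n%:R :> R by rewrite ltr0n.
  have Q0 : 0 <= Q n by rewrite divr_ge0 ?powR_ge0// ltW.
  have QSs : 0 <= Q n + S n + s by rewrite !addr_ge0.
  have [n1n|nn1] := leqP n1 n.
    by apply: (le_trans (large n n1n n0 s s0 sE)); rewrite lee_fin ler_wpM2r// lerDl.
  apply: (@le_trans _ _ (4 * b ^+ 2)%:E).
    apply: (crude_risk_bound r_gt0 c3 (lambda n) (t n) (Xs n) (Ys n) (V n) regr n0 (ltW c4_gt0) b0).
      by move=> x; rewrite (le_trans (mM x))// lerDr mulr_ge0// ltW.
    apply: (@le_trans _ _ (c4 * ln n1.+1%:R)); last by rewrite lerDl ltW.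
    by rewrite ler_wpM2l ?(ltW c4_gt0)// ler_ln ?posrE ?ltr0n// ler_nat ltnW// ltnW.
  rewrite lee_fin; apply: (@le_trans _ _ (4 * b ^+ 2 * n1.+1%:R * Q n)).
    rewrite -mulrA ler_peMr//.
    rewrite /Q mulrA ler_pdivlMr// mul1r.
    rewrite -[leLHS]mulr1; apply: ler_pM => //; first by rewrite ler_nat ltnW// ltnW.
    rewrite powR_expR_ln// -[leLHS]expR0 ler_expR mulr_ge0 ?ln_ge0 ?ler1n//.
    by rewrite addr_ge0 ?mulr_ge0// ltW.
  apply: (@le_trans _ _ (4 * b ^+ 2 * n1.+1%:R * (Q n + S n + s))).
    by rewrite ler_wpM2l// -addrA lerDl addr_ge0.
  by rewrite ler_wpM2r// lerDr ltW.
(* With this order the local approximation error is at most [n ^ (- (kappa + 2))];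
   the output and coefficient bounds of at most [n ^ kappa] subnetworks contribute
   a factor of about [n ^ (kappa + 1)]. *)
pose k := Num.bound ((kappa + 2) / (eps / (2 * d%:R))).
have dR : 0 < d%:R :> R by rewrite ltr0n.
have del0 : 0 < eps / (2 * d%:R) by rewrite divr_gt0// mulr_gt0.
have kap2 : 0 < kappa + 2 by rewrite addr_gt0.
have kP : kappa + 2 <= k%:R * (eps / (2 * d%:R)).
  by rewrite -ler_pdivrMr// ltW// archi_boundP// ltW// divr_gt0.
have k0 : (0 < k)%N.
  by rewrite -(ltr_nat R) -(pmulr_lgt0 _ del0) (lt_le_trans kap2).
have H := @risk_at_sample_size _ _ R P d L r r_gt0 X Y m M k M_ge0 k0.
case: H => A0 [Q0 [C [e [p [A00 Q00 C1 fixed]]]]].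
have [D DP] := step_size_small L_gt0 A00 Q00 c1_gt0 c3_gt0 c4_gt0.
have pk0 : 0 <= p%:R * (kappa + 3) by rewrite mulr_ge0// addr_ge0// ltW.
have p20 : 0 <= 2 + p%:R :> R by rewrite addr_ge0.
have [c c0 cP] := oracle_bound_le c3_gt0 c4_gt0 c5_gt0 c6_gt0 C00 p20 pk0 cc2.
exists c => //.
suff [n1 _ n1P] : \forall n \near \oo, forall s : R, 0 <= s -> sup n = s%:E ->
    (risk n <= (c * (Q n + S n + s))%:E)%E.
  by exists n1 => n n1n _; exact: n1P.
near=> n.
have n0 : (0 < n)%N by near: n; exists 1%N.
have l1 : 1 <= ln n%:R :> R by near: n; exact: ln_eventually_ge.
have l2 : (5 * c1)^-1 <= ln n%:R by near: n; exact: ln_eventually_ge.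
have l3 : (5 * c2)^-1 <= ln n%:R by near: n; exact: ln_eventually_ge.
have l4 : 2 / c4 <= ln n%:R by near: n; exact: ln_eventually_ge.
have l5 : Mm / c4 <= ln n%:R by near: n; exact: ln_eventually_ge.
have l6 : 20 * c4 <= ln n%:R by near: n; exact: ln_eventually_ge.
have l7 : D <= ln n%:R by near: n; exact: ln_eventually_ge.
have l8 : 2 / (c4 * c5) <= ln n%:R by near: n; exact: ln_eventually_ge.
have Kkn : (K n)%:R / n%:R `^ kappa <= 1 by near: n; exact: (cvgr_le _ Kk).
have ration : 2 <= (K n)%:R / ((Kt n)%:R * n%:R `^ ((r * d.+1)%:R * tau + 1)).
  by near: n; exact: (cvgry_ge ratio).
have initn : forall K' Kt' : nat, (0 < Kt' <= K')%N -> K'%:R <= n%:R `^ kappa ->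
    2 <= K'%:R / (Kt'%:R * n%:R `^ ((r * d.+1)%:R * tau + 1)) ->
    Kt'%:R * expR (- ((K' %/ Kt')%N%:R *
      \prod_(b : inner_index d L r) (ln n%:R / 5 / (2 * inner_radius c1 c2 tau n b)))) <= n%:R^-1.
  by near: n; exact: initialization_failure.
have polyQ : 1 * ln n%:R ^+ 2 <= n%:R `^ (tau * d%:R + eps).
  by near: n; apply: polylog_le_power; rewrite ltr_wpDl// mulr_ge0// ltW.
have coden : forall K' : nat, K'%:R <= n%:R `^ kappa ->
  let l := ln n%:R in let rho := n%:R `^ (- (eps / (2 * d%:R))) in
  let A := c2 * l ^+ 2 * n%:R `^ tau + l in
  let H := K'%:R * (1 + c4 * l / c3 + c1 * l ^+ 2) * (C * (c1 * l ^+ 2 + l) ^+ e) in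
  exists (h : R) (G N : nat), [/\ 0 < h, d%:R * A * h = rho /\ rho <= 1, M / h < G.+1%:R,
    2 * H / n%:R^-1 < N.+1%:R & 2 * H * rho ^+ k <= 2 / n%:R /\
    l ^+ 2 * ((G.+1 ^ d * p)%N%:R * ln N.+1%:R) <= p%:R * (kappa + 3) * n%:R `^ (tau * d%:R + eps)].
  by near: n; exact: code_parameters.
move=> s s0 sE.
have nR0 : 0 < n%:R :> R by rewrite ltr0n.
have l0 : 0 < ln n%:R :> R by exact: lt_le_trans l1.
have KtKn := KtK n n0.
have KnR : (K n)%:R <= n%:R `^ kappa by move: Kkn; rewrite ler_pdivrMr ?powR_gt0// mul1r.
have [h [G [N [h0 [rhoE rho1] MG HN [Hrho lnNP]]]]] := coden (K n) KnR.
have [Ln1 smooth] := DP (ln n%:R) (Ln n) (K n) (leq_trans (andP KtKn).1 (andP KtKn).2) l1 l7 (LnP n n0).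
have [t0 travel tau_le] := training_length c4_gt0 c6_gt0 l1 l6 cc3 Ln1 (laE n n0) (tE n n0).
have la0 : 0 < lambda n by rewrite laE// invr_gt0 Ln0.
have smooth' : lambda n * smoothness_bound (L := L) A0 Q0 c3 (c4 * ln n%:R) (c1 * ln n%:R ^+ 2 + ln n%:R) (K n) <= 2^-1.
  by rewrite laE.
have mbn x : `|m x| <= c4 * ln n%:R.
  by rewrite (le_trans (mM x))// mulrC -ler_pdivrMr.
have sP vb : (forall k b, `|vb k b - v n k b| <= ln n%:R) ->
    l2_dist2 X m (fun x => truncate (c4 * ln n%:R) (combination r_gt0 (a n) vb x)) <= s.
  move=> H; rewrite -lee_fin -sE; apply: le_trans (sup_ub n vb H).
  apply: l2_dist2_truncate_le => //; first by rewrite mulr_ge0// ltW.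
  exact: measurable_combination.
have expn : n%:R <= expR (c5 * (c4 * ln n%:R)).
  rewrite -[leLHS]lnK ?posrE// ler_expR mulrA ler_peMl ?(ltW l0)//.
  by rewrite mulrC.
have c1l : 1 <= 5 * c1 * ln n%:R by rewrite -ler_pdivrMl ?mulr_gt0// mulr1.
have c2l : 1 <= 5 * c2 * ln n%:R by rewrite -ler_pdivrMl ?mulr_gt0// mulr1.
have cbl : 2 <= c5 * (c4 * ln n%:R).
  by rewrite mulrA -ler_pdivrMl ?mulr_gt0// mulrC [c5 * c4]mulrC.
have c4l : 2 <= c4 * ln n%:R by rewrite -ler_pdivrMl// mulrC.
have rhoE' : d%:R * (c2 * ln n%:R ^+ 2 * n%:R `^ tau + ln n%:R) * h <= 1 by rewrite rhoE.
have nV0 : 0 < (n%:R : R)^-1 by rewrite invr_gt0.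
have R1 := fixed tau c1 c2 c3 c4 c5 C0 (lambda n) n (K n) (Kt n) (t n) (Xs n) (Ys n) (V n) (a n) (v n)
  h n%:R^-1 n%:R^-1 s G N tau_gt0 (And5 c1_gt0 c2_gt0 c3_gt0 c4_gt0 c5_gt0)
  (And4 n0 KtKn t0 la0) (indep n n0) (same n n0) (unif n n0) suppM momentE regr mbn (aB n n0) (vB n n0)
  (suppb n n0) sP (And5 l1 c1l c2l cbl expn) travel smooth' (initn (K n) (Kt n) KtKn KnR ration)
  (And5 h0 rhoE' MG nV0 HN).
apply: (le_trans R1); rewrite lee_fin rhoE; apply: cP => //.
- by rewrite ler_wpM2r ?(ltW nV0)// -[leLHS]mul1r.
- apply/andP; split; last first.
    by rewrite [leRHS]mulrDl lerD2r.
  have l2_ge0 : 0 <= ln n%:R ^+ 2 :> R by exact: sqr_ge0.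
  have cl_ge0 : 0 <= c1 * ln n%:R ^+ 2 by exact: mulr_ge0 (ltW c1_gt0) l2_ge0.
  have al_ge0 : 0 <= 1 + c4 * ln n%:R / c3 + c1 * ln n%:R ^+ 2.
    by rewrite !addr_ge0// divr_ge0 ?(ltW c3_gt0)// mulr_ge0 ?(ltW c4_gt0)// ltW.
  have B_ge0 : 0 <= c1 * ln n%:R ^+ 2 + ln n%:R by exact: addr_ge0 cl_ge0 (ltW l0).
  have CB_ge0 := mulr_ge0 (le_trans ler01 C1) (exprn_ge0 e B_ge0).
  have H_ge0 := mulr_ge0 (mulr_ge0 (ler0n R (K n)) al_ge0) CB_ge0.
  apply: addr_ge0; last exact: mulr_ge0 (ler0n _ _) (ltW nV0).
  apply: mulr_ge0; first exact: mulr_ge0 (ler0n _ 2) H_ge0.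
  by rewrite exprn_ge0// powR_ge0.
- by rewrite /Q divfK ?gt_eqF.
- exact: S0.
Unshelve. all: by end_near. Qed.
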